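(* The map sending the $\simeq$-equivalence class of $(a,b,c,\lambda,\delta)\in\mathbf{PM}$ to the isomorphism class of $W_\lambda^\delta(a,b,c)$ is a well-defined bijection from the set $\mathbf{PM}/\!\simeq$ of $\simeq$-equivalence classes of $\mathbf{PM}$ onto $\mathbf{IM}$.
   Context: $\mathbb F$ is an algebraically closed field and $q\in\mathbb F^\times$ is a root of unity of order $d$ with $d\notin\{1,2,4\}$; $d'=d$ if $d$ is odd, $d'=d/2$ if $d$ is even. $\sqrt{x}$ denotes a fixed square root of $x\in\mathbb F$. $\triangle_q$ is the unital associative $\mathbb F$-algebra with generators $A,B,C$ subject to: each of $A+\frac{qBC-q^{-1}CB}{q^2-q^{-2}}$, $B+\frac{qCA-q^{-1}AC}{q^2-q^{-2}}$, $C+\frac{qAB-q^{-1}BA}{q^2-q^{-2}}$ is central; $\alpha,\beta,\gamma$ are these times $q+q^{-1}$. For a $\triangle_q$-module $V$ and $\mu\in\mathbb F^\times$, $V(\mu)=\{v: Bv=(\mu+\mu^{-1})v\}$; $\mu$ is a marginal weight of $V$ if some nonzero $v\in V(\mu)$ satisfies $(B-\mu q^2-\mu^{-1}q^{-2})(B-\mu-\mu^{-1})Av=0$. For $(a,b,c,\lambda)\in(\mathbb F^\times)^4$, $i\in\mathbb N$: $\theta_i=a\lambda^{-1}q^{2i}+a^{-1}\lambda q^{-2i}$, $\theta_i^*=b\lambda^{-1}q^{2i}+b^{-1}\lambda q^{-2i}$, $\varphi_i=a^{-1}b^{-1}\lambda q(q^i-q^{-i})(\lambda^{-1}q^{i-1}-\lambda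 q^{1-i})(q^{-i}-abc\lambda^{-1}q^{i-1})(q^{-i}-abc^{-1}\lambda^{-1}q^{i-1})$. $M_\lambda(a,b,c)$ has basis $\{m_i\}_{i\in\mathbb N}$ with $(A-\theta_i)m_i=m_{i+1}$, $(B-\theta_i^* )m_i=\varphi_im_{i-1}$, and $\alpha,\beta,\gamma$ acting as $(b+b^{-1})(c+c^{-1})+(a+a^{-1})(\lambda q+\lambda^{-1}q^{-1})$, $(c+c^{-1})(a+a^{-1})+(b+b^{-1})(\lambda q+\lambda^{-1}q^{-1})$, $(a+a^{-1})(b+b^{-1})+(c+c^{-1})(\lambda q+\lambda^{-1}q^{-1})$. For $\delta\in\mathbb F$, $W_\lambda^\delta(a,b,c)$ is the quotient of $M_\lambda(a,b,c)$ by the span of $\{\delta m_i-m_{d'+i}\}_{i\in\mathbb N}$ (dimension $d'$). $\{\pm1\}$ acts on $(\mathbb F^\times)^4$ by $(-1)\cdot(a,b,c,\lambda)=(-a,-b,-c,-\lambda)$; $\mathfrak S_4$ acts on the right on $\{\pm1\}$-orbits $[\cdot]$ by $[a,b,c,\lambda](1\,2)=[a,b,c^{-1},\lambda]$, $[a,b,c,\lambda](3\,4)=[a^{-1},b,c,\lambda]$, $[a,b,c,\lambda](2\,3)=[a/s,b/s,c/s,\lambda/s]$, $s=\sqrt{abc\lambda q}$. $(a,b,c,\lambda)\approx(\bar a,\bar b,\bar c,\bar\lambda)$ if their orbits lie in the same $\mathfrak S_4$-orbit; $(a,b,c,\lambda,\delta)\simeq_{\pm,\mathfrak S_4}(\bar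 a,\bar b,\bar c,\bar\lambda,\bar\delta)$ if moreover $\delta+a^{d'}\lambda^{-d'}+a^{-d'}\lambda^{d'}=\bar\delta+\bar a^{d'}\bar\lambda^{-d'}+\bar a^{-d'}\bar\lambda^{d'}$. Define $(a,b,c,\lambda,\delta)\sim(\bar a,\bar b,\bar c,\bar\lambda,\bar\delta)$ if one of: (i) $(a,b,c,\lambda,\delta)\simeq_{\pm,\mathfrak S_4}(\bar a,\bar b,\bar c,\bar\lambda,\bar\delta)$; (ii) $(\bar a,\bar b,\bar c,\bar\lambda,\bar\delta)=(a^{-1},b,c,\lambda^{-1}q^{-2},\delta)$ and $\lambda^2\in\{q^{2i}:0\le i\le d'-2\}$; (iii) $(\bar a,\bar b,\bar c,\bar\lambda,\bar\delta)=(a^{-1},b^{-1},c,\lambda^{-1}q^{-2},\delta)$, $b^2\lambda^{-2}\notin\{q^{2(d'-i+1)}:0\le i\le d'-2\}$, and $\delta(b^{d'}\lambda^{-d'}-b^{-d'}\lambda^{d'})=a^{-d'}b^{-d'}(\lambda^{2d'}-1)(a^{d'}b^{d'}c^{d'}\lambda^{-d'}q^{d'}-1)(a^{d'}b^{d'}c^{-d'}\lambda^{-d'}q^{d'}-1)$. Let $\simeq$ be the equivalence relation on $(\mathbb F^\times)^4\times\mathbb F$ generated by $\sim$. $\mathbf{PM}$ is the set of $(a,b,c,\lambda,\delta)\in(\mathbb F^\times)^4\times\mathbb F$ such that for all $(\bar a,\bar b,\bar c,\bar\lambda,\bar\delta)\simeq_{\pm,\mathfrak S_4}(a,b,c,\lambda,\delta)$,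 $\bar\delta\ne0$ or $\bar\lambda^2\notin\{q^{2i}:0\le i\le d'-2\}$ (this set is closed under $\simeq$). $\mathbf{IM}$ is the set of isomorphism classes of $d'$-dimensional irreducible $\triangle_q$-modules having a marginal weight. *)

(* Defs.v *)
From HB Require Import structures.
From mathcomp Require Import all_boot all_algebra.
From Stdlib Require Import Relations.Relation_Operators.
Import GRing.Theory.
Local Open Scope ring_scope.

Section Defs.
Variable F : closedFieldType.
Variable q : F.
Variable d : nat.

Definition dprime : nat := if odd d then d else d./2.

(* points (a,b,c,lambda) of F^4; the paper's (F^x)^4 is cut out by [nzq] *)
Record quad := Quad { qa : F; qb : F; qc : F; ql : F }.
Definition nzq (x : quad) : Prop :=
  [/\ qa x != 0, qb x != 0, qc x != 0 & ql x != 0].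

(* generator moves of {+-1} and of the transpositions (1 2), (3 4), (2 3)
   of S_4 (any square root s of a b c lambda q gives the same {+-1}-orbit) *)
Definition s4_step (x y : quad) : Prop :=
  nzq x /\ nzq y /\
  let: Quad a b c l := x in
  [\/ y = Quad (- a) (- b) (- c) (- l),
      y = Quad a b c^-1 l,
      y = Quad a^-1 b c l
    | exists2 s : F, s ^+ 2 = a * b * c * l * q &
        y = Quad (a / s) (b / s) (c / s) (l / s)].

(* x ~~ y : the {+-1}-orbits of x and y lie in the same S_4-orbit *)
Definition approx : quad -> quad -> Prop := clos_refl_sym_trans quad s4_step.

Definition quint := (quad * F)%type.

Definition dinv (x : quint) : F :=
  let: (Quad a b c l, dl) := x in
  dl + a ^+ dprime / l ^+ dprime + l ^+ dprime / a ^+ dprime.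

Definition simeq_pmS4 (x y : quint) : Prop :=
  nzq x.1 /\ nzq y.1 /\ approx x.1 y.1 /\ dinv x = dinv y.

Definition lam_set (z : F) : Prop :=
  exists2 i : nat, (i <= dprime - 2)%N & z = q ^ (2 * i%:Z).
Definition blam_set (z : F) : Prop :=
  exists2 i : nat, (i <= dprime - 2)%N &
    z = q ^ (2 * (dprime%:Z - i%:Z + 1)).

Definition sim (x y : quint) : Prop :=
  nzq x.1 /\ nzq y.1 /\
  let: (Quad a b c l, dl) := x in
  [\/ simeq_pmS4 x y,
      y = (Quad a^-1 b c (l^-1 * q^-2), dl) /\ lam_set (l ^+ 2)
    | [/\ y = (Quad a^-1 b^-1 c (l^-1 * q^-2), dl),
          ~ blam_set (b ^+ 2 / l ^+ 2) &
          dl * (b ^+ dprime / l ^+ dprime - l ^+ dprime / b ^+ dprime) =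
          (a ^+ dprime * b ^+ dprime)^-1 * (l ^+ (2 * dprime) - 1) *
          (a ^+ dprime * b ^+ dprime * c ^+ dprime / l ^+ dprime * q ^+ dprime - 1) *
          (a ^+ dprime * b ^+ dprime / c ^+ dprime / l ^+ dprime * q ^+ dprime - 1)]].

Definition simeq : quint -> quint -> Prop := clos_refl_sym_trans quint sim.

Definition inPM (x : quint) : Prop :=
  nzq x.1 /\
  forall y : quint, simeq_pmS4 y x -> y.2 != 0 \/ ~ lam_set (ql y.1 ^+ 2).

(* ---- Delta_q-modules, given by the actions of A, B, C on F^n (column
   vectors); a module structure is exactly a triple of matrices such that
   the three elements required to be central commute with A, B, C ---- *)
Definition kq : F := (q ^+ 2 - q ^- 2)^-1.

Section Modules.
Variable n : nat.
Implicit Types A B C X : 'M[F]_n.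

Definition commutes_all A B C X : Prop :=
  [/\ X *m A = A *m X, X *m B = B *m X & X *m C = C *m X].

Definition is_module A B C : Prop :=
  [/\ commutes_all A B C (A + kq *: (q *: (B *m C) - q^-1 *: (C *m B))),
      commutes_all A B C (B + kq *: (q *: (C *m A) - q^-1 *: (A *m C)))
    & commutes_all A B C (C + kq *: (q *: (A *m B) - q^-1 *: (B *m A)))].

(* irreducible: nonzero and no invariant subspace other than 0 and F^n
   (subspaces are row spaces of matrices U; u^T |-> X u^T is u |-> u X^T) *)
Definition irreducible A B C : Prop :=
  (0 < n)%N /\
  forall U : 'M[F]_n,
    (U *m A^T <= U)%MS -> (U *m B^T <= U)%MS -> (U *m C^T <= U)%MS ->
    U = 0 \/ row_full U.

Definition is_marginal_weight A B (mu : F) : Prop :=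
  mu != 0 /\
  exists v : 'cV[F]_n,
    [/\ v != 0, B *m v = (mu + mu^-1) *: v &
        (B - (mu * q ^+ 2 + mu^-1 * q ^- 2)%:M) *m
          ((B - (mu + mu^-1)%:M) *m (A *m v)) = 0].

Definition has_marginal_weight A B : Prop :=
  exists mu : F, is_marginal_weight A B mu.

Definition mod_iso A B C A' B' C' : Prop :=
  exists2 P : 'M[F]_n, P \in unitmx &
    [/\ P *m A = A' *m P, P *m B = B' *m P & P *m C = C' *m P].
End Modules.

(* ---- the module W_lambda^delta(a,b,c) in the basis given by the images of
   m_0, ..., m_{d'-1} (note m_{d'} = delta m_0 in the quotient) ---- *)
Definition theta (x : quint) (i : nat) : F :=
  qa x.1 / ql x.1 * q ^+ (2 * i) + ql x.1 / qa x.1 * q ^- (2 * i).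
Definition thetas (x : quint) (i : nat) : F :=
  qb x.1 / ql x.1 * q ^+ (2 * i) + ql x.1 / qb x.1 * q ^- (2 * i).
Definition phi (x : quint) (i : nat) : F :=
  let: (Quad a b c l, _) := x in
  a^-1 * b^-1 * l * q * (q ^+ i - q ^- i) *
  (l^-1 * q ^ (i%:Z - 1) - l * q ^ (1 - i%:Z)) *
  (q ^- i - a * b * c / l * q ^ (i%:Z - 1)) *
  (q ^- i - a * b / c / l * q ^ (i%:Z - 1)).
Definition gammaW (x : quint) : F :=
  let: (Quad a b c l, _) := x in
  (a + a^-1) * (b + b^-1) + (c + c^-1) * (l * q + l^-1 * q^-1).

Definition WA (x : quint) : 'M[F]_dprime :=
  \matrix_(j, i) ((j == i)%:R * theta x i
                  + (nat_of_ord j == (nat_of_ord i).+1)%:R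
                  + ((nat_of_ord i == dprime.-1) && (nat_of_ord j == 0%N))%:R * x.2).
Definition WB (x : quint) : 'M[F]_dprime :=
  \matrix_(j, i) ((j == i)%:R * thetas x i
                  + ((nat_of_ord j).+1 == nat_of_ord i)%:R * phi x i).
(* C is determined by the value of gamma *)
Definition WC (x : quint) : 'M[F]_dprime :=
  (gammaW x / (q + q^-1))%:M
  - kq *: (q *: (WA x *m WB x) - q^-1 *: (WB x *m WA x)).

End Defs.

Arguments is_module {F} q {n} A B C.
Arguments irreducible {F n} A B C.
Arguments has_marginal_weight {F} q {n} A B.
Arguments is_marginal_weight {F} q {n} A B mu.
Arguments mod_iso {F n} A B C A' B' C'.

(* Main.v *)
Require Import Defs.
From HB Require Import structures.
From mathcomp Require Import all_boot all_algebra.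
From mathcomp Require Import ring.
From Stdlib Require Import Relations.Relation_Operators.
Import GRing.Theory.
Local Open Scope ring_scope.

(* A vector v with B v = theta*_0 v and B A v = theta*_1 A v + kappa v generates a quotient of the
   Verma-type module M_lambda(a,b,c), where (a,b,c,lambda) is determined up to S_4 and sign by
   mu = b / lambda, by kappa and by the central characters: writing mu = nu^2 q, these data are the
   elementary symmetric functions of four elements y1, ..., y4 with product 1 permuted by S_4.  On an
   irreducible module of dimension d' the operator (A - theta_(d'-1)) ... (A - theta_0) is central, and
   its scalar is delta; delta + a^d' lambda^-d' + a^-d' lambda^d' depends only on A.  This gives
   surjectivity and the invariance of W under (i).

   The Casimir element yields a quartic equation for the weight mu' of any other marginal vector of W:
   mu' = mu, mu' = q^2 / mu, or mu' comes from a zero of some phi_i.  The zeros of phi give the move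
   (ii), and the weight q^2 / mu gives (iii), whose equation is the solvability condition of the
   recursion for the coordinates of the marginal vector.  Applied to vectors of smallest degree in a
   submodule the same analysis shows that W is irreducible exactly on PM. *)

Set Implicit Arguments.
Unset Strict Implicit.
Unset Printing Implicit Defensive.

Arguments qa {F} _.
Arguments qb {F} _.
Arguments qc {F} _.
Arguments ql {F} _.
Arguments nzq {F} _.

(** Two degeneracies shape the argument. The central characters and mu determine kappa unless mu^2 =
    q^2 ([kappa_alpha]); in that case a point and its image under (iii) share weight, central
    characters and Casimir value, and only a direct look at the marginal vectors separates them. If
    mu^2 is any power of q^2, the theta*_i are not distinct and the recursion for an eigenvector of
    B cannot be solved by division; then everything is traced to zeros of phi, and (iii) becomes a
    composite of (i) and (ii). The invariant attached to delta comes from evaluating (X - theta_0)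
    ... (X - theta_(d'-1)) at z + z^-1: the value is z^d' + z^-d' minus the sum of t^d' and t^-d'
    with t = a / lambda, so a change of parameters changes the operator by a scalar only. *)

Ltac nz0 := repeat (apply/andP; split); try assumption; try done.
Ltac nz := nz0;
  rewrite ?(oner_eq0, oppr_eq0, invr_eq0, mulf_eq0, expf_eq0, negb_or) /=; nz0.

(** * Parameters and their invariants as symmetric functions *)

Section Quad.
Variables (F : closedFieldType) (q : F).
Hypothesis q0 : q != 0.
Hypothesis q4 : q ^+ 4 != 1.

Lemma q2N : q ^+ 2 + 1 != 0.
Proof. by apply: contra q4 => /eqP h; apply/eqP; rewrite -[RHS]addr0 -(mul0r (q^+2-1)) -h; ring. Qed.
Lemma q2B : q ^+ 2 - 1 != 0.
Proof. by apply: contra q4 => /eqP h; apply/eqP; rewrite -[RHS]addr0 -(mul0r (q^+2+1)) -h; ring. Qed.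
Lemma q4B : q ^+ 4 - 1 != 0.
Proof. by rewrite subr_eq0. Qed.

Implicit Types x y z : quad F.

Definition mu x := qb x / ql x.

(* [alpha], [beta], [gamma] are the values of the central elements; at [Q = q ^+ i], [tA], [tB], [ph]
   are theta_i, theta*_i, phi_i, and [kappa] is the scalar in B A m_0 = theta*_1 A m_0 + kappa m_0. *)
Definition alpha x := (qb x + (qb x)^-1) * (qc x + (qc x)^-1)
  + (qa x + (qa x)^-1) * (ql x * q + (ql x * q)^-1).
Definition beta x := (qc x + (qc x)^-1) * (qa x + (qa x)^-1)
  + (qb x + (qb x)^-1) * (ql x * q + (ql x * q)^-1).
Definition gamma x := (qa x + (qa x)^-1) * (qb x + (qb x)^-1)
  + (qc x + (qc x)^-1) * (ql x * q + (ql x * q)^-1).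
Definition tA x Q := qa x / ql x * Q ^+ 2 + ql x / qa x / Q ^+ 2.
Definition tB x Q := qb x / ql x * Q ^+ 2 + ql x / qb x / Q ^+ 2.
(** The cofactor of Q - Q^-1 in phi. Unlike [ph] it need not vanish at Q = 1, and its value there
    enters every criterion for a marginal vector of weight q^2 / mu. *)
Definition ps x Q := (qa x)^-1 * (qb x)^-1 * ql x * q *
  (Q / (q * ql x) - ql x * q / Q) *
  (Q^-1 - qa x * qb x * qc x / ql x * Q / q) *
  (Q^-1 - qa x * qb x / qc x / ql x * Q / q).
Definition ph x Q := (Q - Q^-1) * ps x Q.
Definition kappa x := ph x q + tA x 1 * (tB x 1 - tB x q).
(** The Casimir element acts on W as (q + q^-1)^2 - [omega x] ([W_casimir]). *)
Definition omega x :=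
  (qa x + (qa x)^-1) * (qb x + (qb x)^-1) * (qc x + (qc x)^-1) * (ql x * q + (ql x * q)^-1)
  + (qa x + (qa x)^-1) ^+ 2 + (qb x + (qb x)^-1) ^+ 2
  + (qc x + (qc x)^-1) ^+ 2 + (ql x * q + (ql x * q)^-1) ^+ 2.

(** The factor theta*_0 - theta*_(-1) equals (q^2 - 1)(mu^2 - q^2) / (q^2 mu), so mu, alpha and
    gamma determine kappa as long as mu^2 != q^2. *)
Lemma kappa_alpha x : nzq x ->
  kappa x * (tB x 1 - tB x q^-1) = (q - q^-1) ^+ 2 * ((q + q^-1) * alpha x - gamma x * tB x 1).
Proof.
case: x => a b c l [] /= a0 b0 c0 l0.
rewrite /kappa /ph /ps /tA /tB /alpha /gamma /=.
field; nz.
Qed.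

(* With mu = nu^2 q, S_4 acts on the orbits [a, b, c, lambda] of given mu by permuting y1, ..., y4,
   whose product is 1. *)
Definition y1 (x : quad F) (nu : F) := qc x * nu / qb x.
Definition y2 (x : quad F) (nu : F) := nu / (qc x * qb x).
Definition y3 (x : quad F) (nu : F) := qa x * qb x / nu.
Definition y4 (x : quad F) (nu : F) := qb x / (qa x * nu).
Definition ee1 x nu := y1 x nu + y2 x nu + y3 x nu + y4 x nu.
Definition ee2 x nu := y1 x nu * y2 x nu + y1 x nu * y3 x nu + y1 x nu * y4 x nu
  + y2 x nu * y3 x nu + y2 x nu * y4 x nu + y3 x nu * y4 x nu.
Definition ee3 x nu := y1 x nu * y2 x nu * y3 x nu + y1 x nu * y2 x nu * y4 x nu
  + y1 x nu * y3 x nu * y4 x nu + y2 x nu * y3 x nu * y4 x nu.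

Section WithNu.
Variables (x : quad F) (nu : F).
Hypotheses (nzx : nzq x) (nu0 : nu != 0) (hmu : mu x = nu ^+ 2 * q).

Lemma ql_nu : ql x = qb x / (nu ^+ 2 * q).
Proof.
rewrite -hmu /mu; case: nzx => a0 b0 c0 l0; field; nz.
Qed.

Lemma gamma_e : gamma x = nu * ee1 x nu + ee3 x nu / nu.
Proof.
rewrite /gamma ql_nu /ee1 /ee3 /y1 /y2 /y3 /y4; case: nzx => a0 b0 c0 l0.
field; nz.
Qed.

Lemma beta_e : beta x = ee2 x nu + nu ^+ 2 + nu ^- 2.
Proof.
rewrite /beta ql_nu /ee2 /y1 /y2 /y3 /y4; case: nzx => a0 b0 c0 l0.
field; nz.
Qed.

(** Together with [gamma_e] this is a linear system for [ee1] and [ee3] of determinant q^2 -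
    q^-2. *)
Lemma kappa_e : kappa x = (q - q^-1) * (ee3 x nu / (q * nu) - q * nu * ee1 x nu).
Proof.
rewrite /kappa /ph /ps /tA /tB ql_nu /ee1 /ee3 /y1 /y2 /y3 /y4; case: nzx => a0 b0 c0 l0.
field; nz.
Qed.

Lemma omega_e : omega x = ee1 x nu * ee3 x nu + (nu ^+ 2 + nu ^- 2) * ee2 x nu + 4%:R.
Proof.
rewrite /omega ql_nu /ee1 /ee2 /ee3 /y1 /y2 /y3 /y4; case: nzx => a0 b0 c0 l0.
field; nz.
Qed.

Lemma ee4 : y1 x nu * y2 x nu * y3 x nu * y4 x nu = 1.
Proof. rewrite /y1 /y2 /y3 /y4; case: nzx => a0 b0 c0 l0; field; nz. Qed.
End WithNu.

(* The coefficients depend only on the central characters, so this bounds the possible values of mu. *)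
Lemma quartic x X : nzq x ->
  X ^+ 4 - beta x * X ^+ 3 + (omega x - 8%:R) * X ^+ 2 - (alpha x * gamma x - 4%:R * beta x) * X
   + (alpha x ^+ 2 + gamma x ^+ 2 - 4%:R * (omega x - 8%:R) - 16%:R) =
  (X - (qb x / (ql x * q) + ql x * q / qb x)) * (X - (qb x * ql x * q + (qb x * ql x * q)^-1))
  * (X - (qa x * qc x + (qa x * qc x)^-1)) * (X - (qa x / qc x + qc x / qa x)).
Proof.
case: x => a b c l [] /= a0 b0 c0 l0; rewrite /omega /alpha /beta /gamma /=.
field; nz.
Qed.
End Quad.

(** * The S_4-orbits through the four numbers y1, ..., y4 *)

Section Approx.
Variables (F : closedFieldType) (q : F).
Hypothesis q0 : q != 0.
Hypothesis q4 : q ^+ 4 != 1.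

Local Notation approx := (@approx F q).
Implicit Types x y z : quad F.

Lemma closed_sqrt (z : F) : exists s, s ^+ 2 = z.
Proof.
have [s hs] := @solve_monicpoly F 2 (fun i => if i is 0%N then z else 0) isT.
by exists s; rewrite hs !big_ord_recl big_ord0 /= expr0 !mulr1 mul0r !addr0.
Qed.

Lemma s4_step_inv x y : s4_step F q x y ->
  [/\ mu x = mu y, beta q x = beta q y, gamma q x = gamma q y & kappa q x = kappa q y].
Proof.
case: x => a b c l; case=> [[/= a0 b0 c0 l0]] [[a1 b1 c1 l1]] /=.
rewrite /mu /beta /gamma /kappa /ph /ps /tA /tB.
case=> [->|->|->|[s hs ->]] /=.
- by split; field; nz.
- by split; field; nz.
- by split; field; nz.
have s0 : s != 0.
  by apply/negP => /eqP s0; move: hs => /esym/eqP; rewrite s0 expr0n !mulf_eq0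
     (negbTE a0) (negbTE b0) (negbTE c0) (negbTE l0) (negbTE q0).
(* Solving s^2 = a b c lambda q for lambda makes the identities rational in a, b, c, s. *)
have -> : l = s ^+ 2 / (a * b * c * q) by rewrite hs; field; nz.
by split; field; nz.
Qed.

Lemma approx_inv x y : approx x y ->
  [/\ mu x = mu y, beta q x = beta q y, gamma q x = gamma q y & kappa q x = kappa q y].
Proof.
elim=> {x y} [x y /s4_step_inv //|x|x y _ [-> -> -> ->]|x y z _ [-> -> -> ->]] //.
Qed.

Lemma approx_refl x : approx x x. Proof. exact: rst_refl. Qed.
Lemma approx_sym x y : approx x y -> approx y x. Proof. exact: rst_sym. Qed.
Lemma approx_trans x y z : approx x y -> approx y z -> approx x z.
Proof. exact: rst_trans. Qed.

Definition ys x nu := (y1 x nu, y2 x nu, y3 x nu, y4 x nu).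

Section Moves.
Variables (nu : F).
Hypotheses (nu0 : nu != 0).

Definition isys x (p : F * F * F * F) :=
  [/\ nzq x, mu x = nu ^+ 2 * q & ys x nu = p].
(** The ordered tuples of y-values over the orbit of [x], all with the same nu. Inverting c
    exchanges y1 and y2, inverting a exchanges y3 and y4, and division by s exchanges y2 and y3. *)
Definition reach x p := exists2 z, approx x z & isys z p.

Lemma reach12 x p1 p2 p3 p4 : reach x (p1, p2, p3, p4) -> reach x (p2, p1, p3, p4).
Proof.
case=> -[a b c l] xz [nz hm [<- <- <- <-]].
have nz' := nz; case: nz' => /= a0 b0 c0 l0.
have nzz : nzq (Quad F a b c^-1 l) by split; rewrite ?invr_eq0.
exists (Quad F a b c^-1 l).
  by apply: approx_trans xz _; apply: rst_step; split=> //; split=> //; apply: Or42.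
split=> //; rewrite /ys /y1 /y2 /y3 /y4 /=.
by congr (_, _, _, _); field; nz.
Qed.

Lemma reach34 x p1 p2 p3 p4 : reach x (p1, p2, p3, p4) -> reach x (p1, p2, p4, p3).
Proof.
case=> -[a b c l] xz [nz hm [<- <- <- <-]].
have nz' := nz; case: nz' => /= a0 b0 c0 l0.
have nzz : nzq (Quad F a^-1 b c l) by split; rewrite ?invr_eq0.
exists (Quad F a^-1 b c l).
  by apply: approx_trans xz _; apply: rst_step; split=> //; split=> //; apply: Or43.
split=> //; rewrite /ys /y1 /y2 /y3 /y4 /=.
by congr (_, _, _, _); field; nz.
Qed.

Lemma reach23 x p1 p2 p3 p4 : reach x (p1, p2, p3, p4) -> reach x (p1, p3, p2, p4).
Proof.
case=> -[a b c l] xz [nz hm [<- <- <- <-]].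
have nz' := nz; case: nz' => /= a0 b0 c0 l0.
have [s hs] := closed_sqrt (a * b * c * l * q).
have s0 : s != 0.
  by apply/negP => /eqP s0; move: hs => /esym/eqP; rewrite s0 expr0n !mulf_eq0
     (negbTE a0) (negbTE b0) (negbTE c0) (negbTE l0) (negbTE q0).
have nzz : nzq (Quad F (a / s) (b / s) (c / s) (l / s)).
  by split; rewrite mulf_neq0 ?invr_eq0.
exists (Quad F (a / s) (b / s) (c / s) (l / s)).
  apply: approx_trans xz _; apply: rst_step; split=> //; split=> //; apply: Or44.
  by exists s.
have hl := ql_nu nz hm; rewrite /= in hl.
have hs' : s ^+ 2 = a * b * c * b / nu ^+ 2 by rewrite hs hl; field; nz.
split=> //.
  by rewrite -hm /mu /=; field; nz.
rewrite /ys /y1 /y2 /y3 /y4 /=.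
congr (_, _, _, _).
- by field; nz.
- have -> : nu / (c / s * (b / s)) = s ^+ 2 * nu / (c * b) by field; nz.
  by rewrite hs'; field; nz.
- have -> : a / s * (b / s) / nu = a * b / nu / s ^+ 2 by field; nz.
  by rewrite hs'; field; nz.
- by field; nz.
Qed.

Lemma reach_self x : nzq x -> mu x = nu ^+ 2 * q -> reach x (ys x nu).
Proof. by move=> h1 h2; exists x => //; apply: approx_refl. Qed.

(** The product y1 y2 = nu^2 / b^2 fixes b up to sign, and a, c, lambda follow from b; the sign is
    the action of -1. *)
Lemma same_ys x z : nzq x -> nzq z -> mu x = nu ^+ 2 * q -> mu z = nu ^+ 2 * q ->
  ys x nu = ys z nu -> approx x z.
Proof.
case: x z => a b c l [a' b' c' l'] nx nz' hx hz.
have := ql_nu nx hx; have := ql_nu nz' hz.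
have [/= a0 b0 c0 l0] := nx; have [/= a1 b1 c1 l1] := nz'.
rewrite /ys /y1 /y2 /y3 /y4 /= => -> -> [h1 h2 h3 h4].
have hb : b ^+ 2 = b' ^+ 2.
  have e : forall u v : F, u != 0 -> v != 0 -> u^-1 = v^-1 -> u = v by move=> u v _ _ /invr_inj.
  apply: (@mulIf _ (nu ^- 2)); first by rewrite invr_eq0 expf_eq0.
  apply: invr_inj.
  have -> : (b ^+ 2 / nu ^+ 2)^-1 = (c * nu / b) * (nu / (c * b)) by field; nz.
  by rewrite h1 h2; field; nz.
have hc : c = (c * nu / b) * b / nu by field; nz.
have ha : a = (a * b / nu) * nu / b by field; nz.
have /eqP := hb; rewrite eqf_sqr => /orP [/eqP eb|/eqP eb].
  rewrite hc ha h1 h3 eb.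
  suff -> : (Quad F (a' * b' / nu * nu / b') b' (c' * nu / b' * b' / nu) (b' / (nu ^+ 2 * q)))
     = Quad F a' b' c' (b' / (nu ^+ 2 * q)) by apply: approx_refl.
  by congr Quad; field; nz.
apply: rst_step; split; first by split; nz.
split; first by split; nz.
by apply: Or41; rewrite hc ha h1 h3 eb; congr Quad; field; nz.
Qed.

(** Both tuples are the roots of one quartic, hence permutations of each other. The roots are
    matched one at a time, each brought into place by adjacent transpositions. *)
Lemma approx_ee x z : nzq x -> nzq z -> mu x = nu ^+ 2 * q -> mu z = nu ^+ 2 * q ->
  ee1 x nu = ee1 z nu -> ee2 x nu = ee2 z nu -> ee3 x nu = ee3 z nu ->
  approx x z.
Proof.
move=> nx nz' hx hz.
rewrite /ee1 /ee2 /ee3.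
have rx := reach_self nx hx; have e4x := ee4 nx nu0; have e4z := ee4 nz' nu0.
have fin : reach x (ys z nu) -> approx x z.
  by case=> w xw [nw hw hys]; apply: approx_trans xw _; apply: same_ys.
move: rx fin e4x e4z; rewrite /ys.
move: (y1 x _) (y2 x _) (y3 x _) (y4 x _) (y1 z _) (y2 z _) (y3 z _) (y4 z _).
move=> p1 p2 p3 p4 z1 z2 z3 z4 rx fin e4x e4z e1 e2 e3.
have hz1 : (z1 - p1) * (z1 - p2) * (z1 - p3) * (z1 - p4) = 0.
  have -> : (z1 - p1) * (z1 - p2) * (z1 - p3) * (z1 - p4) = z1 ^+ 4
    - (p1 + p2 + p3 + p4) * z1 ^+ 3 + (p1 * p2 + p1 * p3 + p1 * p4 + p2 * p3 + p2 * p4 + p3 * p4) * z1 ^+ 2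
    - (p1 * p2 * p3 + p1 * p2 * p4 + p1 * p3 * p4 + p2 * p3 * p4) * z1 + p1 * p2 * p3 * p4 by ring.
  by rewrite e1 e2 e3 e4x -e4z; ring.
have {rx e1 e2 e3 e4x hz1} [p2' [p3' [p4' [rx e1 e2 e3]]]] :
  exists r2 r3 r4, [/\ reach x (z1, r2, r3, r4), r2 + r3 + r4 = z2 + z3 + z4,
    r2 * r3 + r2 * r4 + r3 * r4 = z2 * z3 + z2 * z4 + z3 * z4 &
    r2 * r3 * r4 = z2 * z3 * z4].
  move: hz1 => /eqP; rewrite !mulf_eq0 !subr_eq0.
  have aux r2 r3 r4 : reach x (z1, r2, r3, r4) -> z1 + r2 + r3 + r4 = p1 + p2 + p3 + p4 ->
     z1 * r2 + z1 * r3 + z1 * r4 + r2 * r3 + r2 * r4 + r3 * r4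
      = p1 * p2 + p1 * p3 + p1 * p4 + p2 * p3 + p2 * p4 + p3 * p4 ->
     z1 * r2 * r3 + z1 * r2 * r4 + z1 * r3 * r4 + r2 * r3 * r4 =
     p1 * p2 * p3 + p1 * p2 * p4 + p1 * p3 * p4 + p2 * p3 * p4 ->
   exists r2 r3 r4, [/\ reach x (z1, r2, r3, r4), r2 + r3 + r4 = z2 + z3 + z4,
    r2 * r3 + r2 * r4 + r3 * r4 = z2 * z3 + z2 * z4 + z3 * z4 &
    r2 * r3 * r4 = z2 * z3 * z4].
    rewrite e1 e2 e3 => rr f1 f2 f3; exists r2, r3, r4.
    have g1 : r2 + r3 + r4 = z2 + z3 + z4.
      by apply: (@addrI _ z1); rewrite !addrA f1.
    have g2 : r2 * r3 + r2 * r4 + r3 * r4 = z2 * z3 + z2 * z4 + z3 * z4.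
      apply: (@addrI _ (z1 * (r2 + r3 + r4))); rewrite {2}g1; move: f2 => f2.
      have -> : z1 * (r2 + r3 + r4) + (r2 * r3 + r2 * r4 + r3 * r4) =
        z1 * r2 + z1 * r3 + z1 * r4 + r2 * r3 + r2 * r4 + r3 * r4 by ring.
      by rewrite f2; ring.
    split=> //.
    apply: (@addrI _ (z1 * (r2 * r3 + r2 * r4 + r3 * r4))); rewrite {2}g2.
    have -> : z1 * (r2 * r3 + r2 * r4 + r3 * r4) + r2 * r3 * r4 =
       z1 * r2 * r3 + z1 * r2 * r4 + z1 * r3 * r4 + r2 * r3 * r4 by ring.
    by rewrite f3; ring.
  case/orP => [/orP [/orP [/eqP h|/eqP h]|/eqP h]|/eqP h].
  - by apply: (aux p2 p3 p4); rewrite ?h //; ring.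
  - by apply: (aux p1 p3 p4); rewrite ?h //; try ring; apply: reach12.
  - by apply: (aux p1 p2 p4); rewrite ?h //; try ring; apply: reach12; apply: reach23.
  - by apply: (aux p1 p2 p3); rewrite ?h //; try ring; apply: reach12; apply: reach23; apply: reach34.
have hz2 : (z2 - p2') * (z2 - p3') * (z2 - p4') = 0.
  have -> : (z2 - p2') * (z2 - p3') * (z2 - p4') = z2 ^+ 3
    - (p2' + p3' + p4') * z2 ^+ 2 + (p2' * p3' + p2' * p4' + p3' * p4') * z2 - p2' * p3' * p4' by ring.
  by rewrite e1 e2 e3; ring.
have {rx e1 e2 e3 hz2} [r3 [r4 [rx e1 e2]]] :
  exists r3 r4, [/\ reach x (z1, z2, r3, r4), r3 + r4 = z3 + z4 & r3 * r4 = z3 * z4].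
  move: hz2 => /eqP; rewrite !mulf_eq0 !subr_eq0.
  have aux r3 r4 : reach x (z1, z2, r3, r4) -> z2 + r3 + r4 = p2' + p3' + p4' ->
      z2 * r3 + z2 * r4 + r3 * r4 = p2' * p3' + p2' * p4' + p3' * p4' ->
    exists r3 r4, [/\ reach x (z1, z2, r3, r4), r3 + r4 = z3 + z4 & r3 * r4 = z3 * z4].
    rewrite e1 e2 => rr f1 f2; exists r3, r4.
    have g1 : r3 + r4 = z3 + z4 by apply: (@addrI _ z2); rewrite !addrA f1.
    split=> //.
    apply: (@addrI _ (z2 * (r3 + r4))); rewrite {2}g1.
    have -> : z2 * (r3 + r4) + r3 * r4 = z2 * r3 + z2 * r4 + r3 * r4 by ring.
    by rewrite f2; ring.
  case/orP => [/orP [/eqP h|/eqP h]|/eqP h].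
  - by apply: (aux p3' p4'); rewrite ?h //; ring.
  - by apply: (aux p2' p4'); rewrite ?h //; try ring; apply: reach23.
  - by apply: (aux p2' p3'); rewrite ?h //; try ring; apply: reach23; apply: reach34.
apply: fin.
have : (z3 - r3) * (z3 - r4) = 0.
  have -> : (z3 - r3) * (z3 - r4) = z3 ^+ 2 - (r3 + r4) * z3 + r3 * r4 by ring.
  by rewrite e1 e2; ring.
move=> /eqP; rewrite mulf_eq0 !subr_eq0 => /orP [/eqP h|/eqP h].
  suff -> : z4 = r4 by rewrite h.
  by apply: (@addrI _ z3); rewrite -e1 h.
suff -> : z4 = r3 by rewrite h; apply: reach34.
by apply: (@addrI _ z3); rewrite -e1 h addrC.
Qed.
End Moves.
End Approx.

(** * Complete invariants of the orbits, and the effect of the moves on them *)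

Section Approx2.
Variables (F : closedFieldType) (q : F).
Hypothesis q0 : q != 0.
Hypothesis q4 : q ^+ 4 != 1.
Local Notation approx := (@approx F q).
Implicit Types x y z : quad F.

Lemma mu_neq0 x : nzq x -> mu x != 0.
Proof. by case=> *; rewrite /mu; nz. Qed.

Lemma exists_nu x : nzq x -> exists2 nu, nu != 0 & mu x = nu ^+ 2 * q.
Proof.
move=> nx; have [nu hnu] := closed_sqrt (mu x / q).
have hm : mu x = nu ^+ 2 * q by rewrite hnu divfK.
exists nu => //; apply/eqP => h; have := mu_neq0 nx.
by rewrite hm h expr0n mul0r eqxx.
Qed.

Lemma tB_mu x Q : nzq x -> tB x Q = mu x * Q ^+ 2 + (mu x * Q ^+ 2)^-1.
Proof. by case=> *; rewrite /tB /mu !(invfM, invrK) (mulrC (qb x)^-1). Qed.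

Lemma approx_of_inv x z : nzq x -> nzq z -> mu x = mu z -> beta q x = beta q z ->
  gamma q x = gamma q z -> kappa q x = kappa q z -> approx x z.
Proof.
move=> nx nz' hm hb hg hk; have [nu nu0 hx] := exists_nu nx.
have hz := hx; rewrite hm in hz.
move: hb hg hk; rewrite !(@beta_e _ q q0 _ nu) // !(@gamma_e _ q q0 _ nu) // !(@kappa_e _ q q0 _ nu) //.
move=> hb hg hk; have q2N := q2N q4; have q2B := q2B q4.
have e1 : ee1 x nu = ee1 z nu.
  (* The linear system of [gamma_e] and [kappa_e], solved for [ee1]. *)
  have H w : ee1 w nu = ((nu * ee1 w nu + ee3 w nu / nu) - q / (q - q^-1) *
     ((q - q^-1) * (ee3 w nu / (q * nu) - q * nu * ee1 w nu))) / (nu * (q ^+ 2 + 1)).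
    by field; nz.
  by rewrite H hg hk -H.
have e3 : ee3 x nu = ee3 z nu.
  by apply: (@mulIf _ nu^-1); rewrite ?invr_eq0 //; apply: (@addrI _ (nu * ee1 x nu)); rewrite hg e1.
apply: (@approx_ee F q q0 nu nu0) => //.
by apply: (@addIr _ (nu ^+ 2)); apply: (@addIr _ (nu ^- 2)).
Qed.

(** Off mu^2 = q^2, [kappa_alpha] recovers kappa from alpha. *)
Lemma approx_of_inv' x z : nzq x -> nzq z -> mu x = mu z -> mu x ^+ 2 != q ^+ 2 ->
  alpha q x = alpha q z -> beta q x = beta q z -> gamma q x = gamma q z -> approx x z.
Proof.
move=> nx nz' hm hm2 ha hb hg; apply: approx_of_inv => //.
have := kappa_alpha q0 nx; have := kappa_alpha q0 nz'.
rewrite !tB_mu // hm ha hg => <-; apply: mulIf.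
have hn : mu z != 0 by apply: mu_neq0.
have -> : mu z * 1 ^+ 2 + (mu z * 1 ^+ 2)^-1 - (mu z * q^-1 ^+ 2 + (mu z * q^-1 ^+ 2)^-1)
  = (q ^+ 2 - 1) * (mu z ^+ 2 - q ^+ 2) / (q ^+ 2 * mu z) by field; nz.
have q2B := q2B q4; rewrite hm -subr_eq0 in hm2.
apply: mulf_neq0; first exact: mulf_neq0.
by apply: invr_neq0; apply: mulf_neq0 => //; apply: expf_neq0.
Qed.

Definition move_iii x := Quad F (qa x)^-1 (qb x)^-1 (qc x) ((ql x)^-1 * q ^- 2).

Lemma nzq_iii x : nzq x -> nzq (move_iii x).
Proof. by case=> *; split; rewrite /=; nz. Qed.

Lemma mu_iii x : nzq x -> mu (move_iii x) = q ^+ 2 / mu x.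
Proof. by case=> *; rewrite /mu /=; field; nz. Qed.

Lemma inv_iii x : nzq x -> [/\ alpha q (move_iii x) = alpha q x, beta q (move_iii x) = beta q x,
  gamma q (move_iii x) = gamma q x & omega q (move_iii x) = omega q x].
Proof.
by case=> *; rewrite /alpha /beta /gamma /omega /=; split; field; nz.
Qed.

(** At nu^-1 the y-values of [move_iii x] are the inverses of those of [x] at nu; as their product
    is 1, [ee1] and [ee3] trade places. *)
Lemma ee_iii x nu : nzq x -> nu != 0 -> [/\ ee1 (move_iii x) nu^-1 = ee3 x nu,
  ee2 (move_iii x) nu^-1 = ee2 x nu & ee3 (move_iii x) nu^-1 = ee1 x nu].
Proof.
case=> *; rewrite /ee1 /ee2 /ee3 /y1 /y2 /y3 /y4 /=; split; field; nz.
Qed.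

Lemma iiiK x : nzq x -> move_iii (move_iii x) = x.
Proof. by case: x => a b c l [] /= *; rewrite /move_iii /=; congr Quad; field; nz. Qed.

Lemma approx_nz x z : approx x z -> nzq x -> nzq z.
Proof.
suff H : approx x z -> (nzq x <-> nzq z) by move=> /H [].
elim=> {x z} [x z [h1 [h2 _]]||x z _|x z w _ h1 _ h2] //; try tauto.
Qed.

Lemma approx_iii x z : approx x z -> nzq x -> approx (move_iii x) (move_iii z).
Proof.
move=> xz nx; have nz' := approx_nz xz nx.
have [hm hb hg hk] := approx_inv q0 xz.
have [nu nu0 hx] := exists_nu nx.
have hz := hx; rewrite hm in hz.
have hk' := hk; have hg' := hg; have hb' := hb.
move: hb hg hk; rewrite !(@beta_e _ q q0 _ nu) // !(@gamma_e _ q q0 _ nu) // !(@kappa_e _ q q0 _ nu) //.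
move=> hb hg hk; have q2N := q2N q4; have q2B := q2B q4.
have e1 : ee1 x nu = ee1 z nu.
  have H w : ee1 w nu = ((nu * ee1 w nu + ee3 w nu / nu) - q / (q - q^-1) *
     ((q - q^-1) * (ee3 w nu / (q * nu) - q * nu * ee1 w nu))) / (nu * (q ^+ 2 + 1)).
    by field; nz.
  by rewrite H hg hk -H.
have e3 : ee3 x nu = ee3 z nu.
  by apply: (@mulIf _ nu^-1); rewrite ?invr_eq0 //; apply: (@addrI _ (nu * ee1 x nu)); rewrite hg e1.
have e2 : ee2 x nu = ee2 z nu.
  by apply: (@addIr _ (nu ^+ 2)); apply: (@addIr _ (nu ^- 2)).
have [f1 f2 f3] := ee_iii nx nu0; have [g1 g2 g3] := ee_iii nz' nu0.
apply: (@approx_ee F q q0 nu^-1).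
- by rewrite invr_eq0.
- exact: nzq_iii.
- exact: nzq_iii.
- by rewrite mu_iii // hx; field; nz.
- by rewrite mu_iii // hz; field; nz.
- by rewrite f1 g1.
- by rewrite f2 g2.
- by rewrite f3 g3.
Qed.

(* For mu^2 = q^2 the central characters only see the unordered pair {ee1, ee3} up to scaling, and
   [move_iii] exchanges the two. *)
Lemma approx_degenerate x z : nzq x -> nzq z -> mu x = mu z -> mu x ^+ 2 = q ^+ 2 ->
  beta q x = beta q z -> gamma q x = gamma q z -> omega q x = omega q z ->
  approx x z \/ approx (move_iii x) z.
Proof.
move=> nx nz' hm hm2 hb hg ho; have [nu nu0 hx] := exists_nu nx.
have hz := hx; rewrite hm in hz.
have nu4 : nu ^+ 4 = 1.
  apply: (@mulIf _ (q ^+ 2)); first by rewrite expf_eq0.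
  by rewrite mul1r -[RHS]hm2 hx; ring.
have nuV : nu^-1 = nu ^+ 3 by apply: (mulfI nu0); rewrite mulfV // -nu4; ring.
have nV2 : nu ^- 2 = nu ^+ 2 by rewrite -exprVn nuV -[RHS]mul1r -nu4; ring.
move: hb hg ho; rewrite !(@beta_e _ q q0 _ nu) // !(@gamma_e _ q q0 _ nu) // !(@omega_e _ q q0 _ nu) //.
move=> hb hg ho.
have e2 : ee2 x nu = ee2 z nu.
  by apply: (@addIr _ (nu ^+ 2)); apply: (@addIr _ (nu ^- 2)).
have ep : ee1 x nu * ee3 x nu = ee1 z nu * ee3 z nu.
  by move: ho; rewrite e2 => /addIr /addIr.
have es : nu ^+ 2 * ee1 x nu + ee3 x nu = nu ^+ 2 * ee1 z nu + ee3 z nu.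
  apply: (@mulIf _ nu^-1); first by rewrite invr_eq0.
  have H w : (nu ^+ 2 * ee1 w nu + ee3 w nu) * nu^-1 = nu * ee1 w nu + ee3 w nu / nu.
    by field; nz.
  by rewrite !H.
(* gamma gives the sum and omega the product of nu^2 [ee1] and [ee3], so [ee3 z nu] is a root of the
   quadratic attached to [x]. *)
have : (ee3 z nu - ee3 x nu) * (ee3 z nu - nu ^+ 2 * ee1 x nu) = 0.
  have -> : (ee3 z nu - ee3 x nu) * (ee3 z nu - nu ^+ 2 * ee1 x nu) =
     ee3 z nu ^+ 2 - (nu ^+ 2 * ee1 x nu + ee3 x nu) * ee3 z nu + nu ^+ 2 * (ee1 x nu * ee3 x nu) by ring.
  by rewrite es ep; ring.
have n2 : nu ^+ 2 != 0 by rewrite expf_eq0.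
move=> /eqP; rewrite mulf_eq0 !subr_eq0 => /orP [/eqP h|/eqP h]; [left|right].
  apply: (@approx_ee F q q0 nu) => //.
  by apply: (mulfI n2); apply: (@addIr _ (ee3 x nu)); rewrite es h.
have [f1 f2 f3] := ee_iii nx nu0.
(* Since nu^4 = 1, passing from nu^-1 to nu multiplies every y by nu^2. *)
have f w : [/\ ee1 w nu = nu ^+ 2 * ee1 w nu^-1, ee2 w nu = ee2 w nu^-1 &
   ee3 w nu = nu ^+ 2 * ee3 w nu^-1].
  have hn : nu ^+ 2 * nu^-1 = nu by field; nz.
  have s1 : y1 w nu = nu ^+ 2 * y1 w nu^-1 by rewrite /y1 -{1}hn; ring.
  have s2 : y2 w nu = nu ^+ 2 * y2 w nu^-1 by rewrite /y2 -{1}hn; ring.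
  have hn3 : nu^-1 = nu ^+ 2 * nu by rewrite nuV; ring.
  have s3 : y3 w nu = nu ^+ 2 * y3 w nu^-1 by rewrite /y3 invrK {1}hn3; ring.
  have s4 : y4 w nu = nu ^+ 2 * y4 w nu^-1 by rewrite /y4 !invfM invrK {1}hn3; ring.
  have n4' : nu ^+ 2 * nu ^+ 2 = 1 by rewrite -nu4; ring.
  rewrite /ee1 /ee2 /ee3 s1 s2 s3 s4; split; first by ring.
    rewrite -[RHS]mul1r -n4'; ring.
  rewrite -[RHS]mul1r -n4'; ring.
have [g1 g2 g3] := f (move_iii x).
apply: (@approx_ee F q q0 nu) => //.
- exact: nzq_iii.
- rewrite mu_iii // hx; have -> : q ^+ 2 / (nu ^+ 2 * q) = nu ^- 2 * q by field; nz.
  by rewrite nV2.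
- rewrite g1 f1; apply: (mulfI n2); rewrite mulrA.
  have -> : nu ^+ 2 * nu ^+ 2 = 1 by rewrite -nu4; ring.
  by rewrite mul1r; apply: (@addIr _ (nu ^+ 2 * ee1 x nu)); rewrite [LHS]addrC es h.
- by rewrite g2 f2.
- by rewrite g3 f3 h.
Qed.

(** The six values are the products of two y's: b lambda q = y3 y4, a c = y1 y3, a / c = y2 y3, and
    their inverses. A permutation moves the chosen pair to positions 3 and 4, where its product is b
    lambda q of the new point. *)
Lemma sextic x t : nzq x ->
  [\/ t = qb x * ql x * q, t = (qb x * ql x * q)^-1 | [\/ t = qa x * qc x, t = (qa x * qc x)^-1,
      t = qa x / qc x | t = qc x / qa x]] ->
  exists z, [/\ nzq z, approx x z & qb z * ql z * q = t].
Proof.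
move=> nx; have [nu nu0 hx] := exists_nu nx.
have rx := reach_self nx hx.
have fin p1 p2 p3 p4 t' : reach q nu x (p1, p2, p3, p4) -> p3 * p4 = t' ->
   exists z, [/\ nzq z, approx x z & qb z * ql z * q = t'].
  case=> z xz [nz' hz [_ _ h3 h4]] <-; exists z; split=> //.
  rewrite (ql_nu nz' hz) -h3 -h4 /y3 /y4; case: nz' => *; field; nz.
have hl := ql_nu nx hx.
have r := rx; rewrite /ys in r.
have [a0 b0 c0 l0] := nx.
case=> [->|->|[->|->|->|->]].
- by apply: (fin _ _ _ _ _ r); rewrite /y3 /y4 hl; field; nz.
- apply: (fin (y3 x nu) (y4 x nu) (y1 x nu) (y2 x nu)).
    by apply: reach23; [done..|]; apply: reach12; [done..|]; apply: reach34; [done..|]; apply: reach23.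
  by rewrite /y1 /y2 hl; field; nz.
- apply: (fin (y2 x nu) (y4 x nu) (y1 x nu) (y3 x nu)).
    by apply: reach23; [done..|]; apply: reach34; [done..|]; apply: reach12.
  by rewrite /y1 /y3; field; nz.
- apply: (fin (y1 x nu) (y3 x nu) (y2 x nu) (y4 x nu)); first by apply: reach23.
  by rewrite /y2 /y4; field; nz.
- apply: (fin (y1 x nu) (y4 x nu) (y2 x nu) (y3 x nu)).
    by apply: reach23; [done..|]; apply: reach34.
  by rewrite /y2 /y3; field; nz.
- apply: (fin (y2 x nu) (y3 x nu) (y1 x nu) (y4 x nu)).
    by apply: reach23; [done..|]; apply: reach12.
  by rewrite /y1 /y4; field; nz.
Qed.

(** This is the permutation exchanging (y1, y2) with (y3, y4). *)
Lemma approx_tilde x : nzq x ->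
  approx x (Quad F (qc x) (ql x * q)^-1 (qa x) (qb x * q)^-1).
Proof.
move=> nx; have [a0 b0 c0 l0] := nx.
apply: approx_of_inv => //; first by split; rewrite /=; nz.
- by rewrite /mu /=; field; nz.
- by rewrite /beta /=; field; nz.
- by rewrite /gamma /=; field; nz.
- by rewrite /kappa /ph /ps /tA /tB /=; field; nz.
Qed.

(** As mu is constant on the orbit, the condition on z says that its b lambda q equals mu Q^2 / q.
    The three factors of [ps] vanish when this number is b lambda q, (a c)^-1 or c / a of [x], and
    [sextic] realises each of them. *)
Lemma ps0 x Q : nzq x -> Q != 0 -> ps q x Q = 0 ->
  exists z, [/\ nzq z, approx x z & ql z ^+ 2 * q ^+ 2 = Q ^+ 2].
Proof.
move=> nx Q0; have [a0 b0 c0 l0] := nx.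
have H t : (exists z, [/\ nzq z, approx x z & qb z * ql z * q = t]) ->
   t = mu x * Q ^+ 2 / q -> exists z, [/\ nzq z, approx x z & ql z ^+ 2 * q ^+ 2 = Q ^+ 2].
  case=> z [nz' xz <-] h; exists z; split=> //.
  have [hm _ _ _] := approx_inv q0 xz; have [a1 b1 c1 l1] := nz'.
  have m0 := mu_neq0 nz'.
  have -> : ql z ^+ 2 * q ^+ 2 = (qb z * ql z * q) * q / mu z by rewrite /mu; field; nz.
  by rewrite h hm; field; nz.
rewrite /ps => /eqP; rewrite !mulf_eq0 !invr_eq0 (negbTE a0) (negbTE b0) (negbTE l0) (negbTE q0) /=.
case/orP => [/orP [h|h]|h].
- exists x; split=> //; first exact: approx_refl.
  move: h; rewrite subr_eq0 => /eqP h.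
  have -> : Q ^+ 2 = (Q / (q * ql x)) * (Q * q * ql x) by field; nz.
  by rewrite h; field; nz.
- apply: (H (qa x * qc x)^-1).
    by apply: sextic => //; apply: Or33; apply: Or42.
  move: h; rewrite subr_eq0 => /eqP h.
  have -> : (qa x * qc x)^-1 = Q^-1 * Q / (qa x * qc x) by field; nz.
  by rewrite h /mu; field; nz.
- apply: (H (qc x / qa x)).
    by apply: sextic => //; apply: Or33; apply: Or44.
  move: h; rewrite subr_eq0 => /eqP h.
  have -> : (qc x / qa x) = Q^-1 * Q * qc x / qa x by field; nz.
  by rewrite h /mu; field; nz.
Qed.

Lemma quartic_roots (E1 E2 E3 : F) : exists z1 z2 z3 z4 : F,
  [/\ z1 + z2 + z3 + z4 = E1,
      z1 * z2 + z1 * z3 + z1 * z4 + z2 * z3 + z2 * z4 + z3 * z4 = E2,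
      z1 * z2 * z3 + z1 * z2 * z4 + z1 * z3 * z4 + z2 * z3 * z4 = E3 &
      z1 * z2 * z3 * z4 = 1].
Proof.
have [z1] := @solve_monicpoly F 4 (nth 0 [:: - 1; E3; - E2; E1]) isT.
rewrite !big_ord_recl !big_ord0 /= /bump /= => h1.
pose D2 := E2 - z1 * (E1 - z1); pose D3 := E3 - z1 * D2.
have [z2] := @solve_monicpoly F 3 (nth 0 [:: D3; - D2; E1 - z1]) isT.
rewrite !big_ord_recl !big_ord0 /= /bump /= => h2.
pose G2 := D2 - z2 * (E1 - z1 - z2).
have [z3] := @solve_monicpoly F 2 (nth 0 [:: - G2; E1 - z1 - z2]) isT.
rewrite !big_ord_recl !big_ord0 /= /bump /= => h3.
have {h3}h3 : z3 * (E1 - z1 - z2 - z3) = G2.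
  by transitivity ((E1 - z1 - z2) * z3 - z3 ^+ 2); [ring | rewrite h3; ring].
have {h2}h2 : z2 * G2 = D3.
  transitivity (D2 * z2 - (E1 - z1) * z2 ^+ 2 + z2 ^+ 3); first by rewrite /G2; ring.
  by rewrite h2; ring.
have {h1}h1 : z1 * D3 = 1.
  transitivity (E3 * z1 - E2 * z1 ^+ 2 + E1 * z1 ^+ 3 - z1 ^+ 4); first by rewrite /D3 /D2; ring.
  by rewrite h1; ring.
exists z1, z2, z3, (E1 - z1 - z2 - z3); split; first by ring.
- transitivity (z1 * (E1 - z1) + z2 * (E1 - z1 - z2) + z3 * (E1 - z1 - z2 - z3)); first by ring.
  by rewrite h3 /G2 /D2; ring.
- transitivity (z1 * (z2 * (E1 - z1 - z2)) + z1 * (z3 * (E1 - z1 - z2 - z3)) + z2 * (z3 * (E1 - z1 - z2 - z3))).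
    by ring.
  rewrite h3 h2 /D3.
  transitivity (z1 * (z2 * (E1 - z1 - z2) + G2 - D2) + E3); first by ring.
  by rewrite /G2; ring.
by rewrite -!mulrA h3 h2 h1.
Qed.

Lemma exists_quad (m b g k : F) : m != 0 ->
  exists2 x, nzq x & [/\ mu x = m, beta q x = b, gamma q x = g & kappa q x = k].
Proof.
move=> m0; have [nu hnu] := closed_sqrt (m / q).
have hm : m = nu ^+ 2 * q by rewrite hnu divfK.
have nu0 : nu != 0 by apply: contraNneq m0 => h; rewrite hm h expr0n mul0r.
have q2N := q2N q4; have q2B := q2B q4.
pose E1 := (g - q / (q - q^-1) * k) / (nu * (q ^+ 2 + 1)).
pose E3 := nu * (g - nu * E1).
pose E2 := b - nu ^+ 2 - nu ^- 2.
have [z1 [z2 [z3 [z4 [s1 s2 s3 s4]]]]] := quartic_roots E1 E2 E3.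
have z0 : [&& z1 != 0, z2 != 0, z3 != 0 & z4 != 0].
  have : z1 * z2 * z3 * z4 != 0 by rewrite s4 oner_neq0.
  by rewrite !mulf_eq0 !negb_or => /andP [/andP [/andP [-> ->] ->] ->].
case/and4P: z0 => n1 n2 n3 n4.
have [u hu] := closed_sqrt (z3 * z4).
have u0 : u != 0.
  by apply/eqP => h; move: hu => /esym/eqP; rewrite h expr0n mulf_eq0 (negbTE n3) (negbTE n4).
(* The inverse of the passage to the y's: u = b / nu satisfies u^2 = y3 y4, and lambda follows from
   mu = nu^2 q. *)
pose x := Quad F (z3 / u) (u * nu) (u * z1) (u / (nu * q)).
have nx : nzq x by rewrite /x; split; rewrite /=; nz.
have hx : mu x = nu ^+ 2 * q by rewrite /mu /x /=; field; nz.
have e_1 : y1 x nu = z1 by rewrite /y1 /=; field; nz.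
have e_2 : y2 x nu = z2.
  rewrite /y2 /=; have -> : nu / (u * z1 * (u * nu)) = 1 / (z1 * u ^+ 2) by field; nz.
  by rewrite hu -s4; field; nz.
have e_3 : y3 x nu = z3 by rewrite /y3 /=; field; nz.
have e_4 : y4 x nu = z4.
  rewrite /y4 /=; have -> : u * nu / (z3 / u * nu) = u ^+ 2 / z3 by field; nz.
  by rewrite hu; field; nz.
have t1 : ee1 x nu = E1 by rewrite /ee1 e_1 e_2 e_3 e_4.
have t2 : ee2 x nu = E2 by rewrite /ee2 e_1 e_2 e_3 e_4.
have t3 : ee3 x nu = E3 by rewrite /ee3 e_1 e_2 e_3 e_4.
exists x => //; split; first by rewrite hx hm.
- by rewrite (beta_e q0 nx nu0 hx) t2 /E2; ring.
- by rewrite (gamma_e q0 nx nu0 hx) t3 t1 /E3; field; nz.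
- rewrite (kappa_e q0 nx nu0 hx) t3 t1 /E3 /E1; field; nz.
Qed.
Lemma approx_alpha_omega x z : approx x z -> alpha q x = alpha q z /\ omega q x = omega q z.
Proof.
elim=> {x z} [x z|x|x y _ [-> ->]|x y z _ [-> ->] _ [-> ->]] //.
case: x => a b c l; case=> [[/= a0 b0 c0 l0]] [_] /=.
rewrite /alpha /omega.
case=> [->|->|->|[s hs ->]] /=.
- by split; field; nz.
- by split; field; nz.
- by split; field; nz.
have s0 : s != 0.
  by apply/negP => /eqP s0; move: hs => /esym/eqP; rewrite s0 expr0n !mulf_eq0
     (negbTE a0) (negbTE b0) (negbTE c0) (negbTE l0) (negbTE q0).
have -> : l = s ^+ 2 / (a * b * c * q) by rewrite hs; field; nz.
by split; field; nz.
Qed.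
End Approx2.

(** * Reduction of vector identities to scalar ones *)

Section Coefficients.
Variables (F : fieldType) (n : nat).
Implicit Types (u v : 'cV[F]_n).
Definition cf (i : 'I_n) v : F := v i 0.
Lemma cfP u v : (forall i, cf i u = cf i v) -> u = v.
Proof. by move=> h; apply/colP => i; apply: h. Qed.
Lemma cfD i u v : cf i (u + v) = cf i u + cf i v. Proof. by rewrite /cf mxE. Qed.
Lemma cfN i u : cf i (- u) = - cf i u. Proof. by rewrite /cf mxE. Qed.
Lemma cfZ i a u : cf i (a *: u) = a * cf i u. Proof. by rewrite /cf mxE. Qed.
Lemma cf0 i : cf i 0 = 0. Proof. by rewrite /cf mxE. Qed.
Lemma mulmxZ (A : 'M[F]_n) a v : A *m (a *: v) = a *: (A *m v).
Proof. by rewrite scalemxAr. Qed.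
Definition cfE := (cfD, cfN, cfZ, cf0).
Definition mlin := (mulmxDr, mulmxN, mulmxZ, mulmx0).
End Coefficients.

(** * Scalar central elements, and the relations between A and B alone *)

Section Module.
Variables (F : closedFieldType) (q : F).
Hypothesis q0 : q != 0.
Hypothesis q4 : q ^+ 4 != 1.
Local Notation kq := (@kq F q).
Let q2N := q2N q4.
Let q2B := q2B q4.
Let q4B := q4B q4.
Implicit Types x y z : quad F.
Variable n : nat.
Implicit Types (A B C : 'M[F]_n) (u v w : 'cV[F]_n).

Definition srel A B C (a b c : F) :=
  [/\ A + kq *: (q *: (B *m C) - q^-1 *: (C *m B)) = (a / (q + q^-1))%:M,
      B + kq *: (q *: (C *m A) - q^-1 *: (A *m C)) = (b / (q + q^-1))%:M &
      C + kq *: (q *: (A *m B) - q^-1 *: (B *m A)) = (c / (q + q^-1))%:M].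

Lemma kqE : kq = q ^+ 2 / (q ^+ 4 - 1).
Proof. by rewrite /kq; field; nz. Qed.

(** The Askey-Wilson relations, obtained by eliminating C through the third central element. They
    are stated on vectors so that they rewrite inside iterated matrix-vector products. *)
Definition rel_BAA A B (b c : F) := forall w,
  B *m (A *m (A *m w)) = (q ^+ 2 + q ^- 2) *: (A *m (B *m (A *m w))) - A *m (A *m (B *m w))
   - (q ^+ 2 - q ^- 2) ^+ 2 *: (B *m w) - ((q - q^-1) ^+ 2 * c) *: (A *m w)
   + ((q ^+ 2 - q ^- 2) * (q - q^-1) * b) *: w.
Definition rel_ABB A B (a c : F) := forall w,
  A *m (B *m (B *m w)) = (q ^+ 2 + q ^- 2) *: (B *m (A *m (B *m w))) - B *m (B *m (A *m w))
   - (q ^+ 2 - q ^- 2) ^+ 2 *: (A *m w) - ((q - q^-1) ^+ 2 * c) *: (B *m w)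
   + ((q ^+ 2 - q ^- 2) * (q - q^-1) * a) *: w.
Definition rel_C A B C (c : F) := forall w,
  C *m w = (c / (q + q^-1)) *: w - kq *: (q *: (A *m (B *m w)) - q^-1 *: (B *m (A *m w))).

Lemma mulscal (a : F) w : a%:M *m w = a *: w.
Proof. by rewrite mul_scalar_mx. Qed.

Lemma mx_ext A B : (forall w, A *m w = B *m w) -> A = B.
Proof.
move=> h; apply/matrixP => i j.
by have := congr1 (fun mvec : 'cV_n => mvec i 0) (h (delta_mx j 0)); rewrite -!colE !mxE.
Qed.

Lemma scalemxAlv (a : F) A w : (a *: A) *m w = a *: (A *m w).
Proof. by rewrite scalemxAl. Qed.

Ltac vec := rewrite ?(mulmxDl, mulNmx, mulscal, scalemxAlv, mlin) -?mulmxA.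
Ltac vlin := let i := fresh "i" in apply: cfP => i; rewrite ?cfE ?kqE.
Ltac nq := have -> : (q + q^-1) = (q ^+ 2 + 1) / q by field; nz.

Lemma srel_C A B C a b c : srel A B C a b c -> rel_C A B C c.
Proof.
case=> _ _ h w; have := congr1 (fun mvec => mvec *m w) h; vec => h'.
by rewrite -h'; vlin; ring.
Qed.

Lemma srel_BAA A B C a b c : srel A B C a b c -> rel_BAA A B b c.
Proof.
move=> h; have hc := srel_C h; case: h => _ h _ w.
have := congr1 (fun mvec => mvec *m w) h; vec; rewrite !hc; vec => h'.
apply: cfP => i; move: (congr1 (cf i) h'); rewrite !cfE kqE.
set X := cf i (B *m (A *m (A *m w))).
move=> hh.
have -> : X = ((b / (q + q^-1) * cf i w) - (cf i (B *m w) + q ^+ 2 / (q ^+ 4 - 1) *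
       (q * (c / (q + q^-1) * cf i (A *m w) - q ^+ 2 / (q ^+ 4 - 1) *
         (q * cf i (A *m (B *m (A *m w))) - q^-1 * 0)) -
        q^-1 * (c / (q + q^-1) * cf i (A *m w) - q ^+ 2 / (q ^+ 4 - 1) * (q * cf i (A *m (A *m (B *m w)))
         - q^-1 * cf i (A *m (B *m (A *m w)))))))) / ((q ^+ 2 / (q ^+ 4 - 1)) ^+ 2).
  by rewrite -hh; nq; field; nz.
nq; field; nz.
Qed.

Lemma srel_ABB A B C a b c : srel A B C a b c -> rel_ABB A B a c.
Proof.
move=> h; have hc := srel_C h; case: h => h _ _ w.
have := congr1 (fun mvec => mvec *m w) h; vec; rewrite !hc; vec => h'.
apply: cfP => i; move: (congr1 (cf i) h'); rewrite !cfE kqE.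
set X := cf i (A *m (B *m (B *m w))).
move=> hh.
have -> : X = ((a / (q + q^-1) * cf i w) - (cf i (A *m w) + q ^+ 2 / (q ^+ 4 - 1) *
       (q * (c / (q + q^-1) * cf i (B *m w) - q ^+ 2 / (q ^+ 4 - 1) *
         (q * cf i (B *m (A *m (B *m w))) - q^-1 * cf i (B *m (B *m (A *m w))))) -
        q^-1 * (c / (q + q^-1) * cf i (B *m w) - q ^+ 2 / (q ^+ 4 - 1) * (q * 0
         - q^-1 * cf i (B *m (A *m (B *m w)))))))) / ((q ^+ 2 / (q ^+ 4 - 1)) ^+ 2).
  by rewrite -hh; nq; field; nz.
nq; field; nz.
Qed.

Lemma srel_of A B C a b c : rel_BAA A B b c -> rel_ABB A B a c -> rel_C A B C c -> srel A B C a b c.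
Proof.
move=> r1 r2 rc; split; apply: mx_ext => w; vec; rewrite !rc; vec.
- by rewrite r2; vlin; nq; field; nz.
- by rewrite r1; vlin; nq; field; nz.
- by vlin; nq; field; nz.
Qed.

End Module.

(** * The action on the chain m_i, and the Casimir element *)

Section Verma.
Variables (F : closedFieldType) (q : F).
Hypothesis q0 : q != 0.
Hypothesis q4 : q ^+ 4 != 1.
Local Notation kq := (@kq F q).
Let q2N := q2N q4.
Let q2B := q2B q4.
Let q4B := q4B q4.
Implicit Types x y z : quad F.
Variable n : nat.
Implicit Types (A B C : 'M[F]_n) (u v w : 'cV[F]_n).

Ltac vec := rewrite ?(mulmxDl, mulNmx, mulscal, scalemxAlv, mlin) -?mulmxA.
Ltac vlin := let i := fresh "i" in apply: cfP => i; rewrite ?cfE ?(kqE q0 q4).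

(** [m0], [m1], [m2] are consecutive m_i with Q = q^i at [m0]; [w] stands for phi_i m_(i-1), so that
    i = 0 is covered. The relation expresses B A^2 m_i, and with it B m_(i+2), through known
    terms. *)
Lemma verma_step A B x Q m0 w m1 m2 : nzq x -> Q != 0 -> rel_BAA q A B (beta q x) (gamma q x) ->
  A *m m0 = m1 + tA x Q *: m0 -> A *m m1 = m2 + tA x (q * Q) *: m1 ->
  A *m w = tA x (Q / q) *: w + ph q x Q *: m0 ->
  B *m m0 = tB x Q *: m0 + w -> B *m m1 = tB x (q * Q) *: m1 + ph q x (q * Q) *: m0 ->
  B *m m2 = tB x (q * (q * Q)) *: m2 + ph q x (q * (q * Q)) *: m1.
Proof.
move=> [a0 b0 c0 l0] Q0 r1 A0 A1 Aw B0 B1.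
have -> : B *m m2 = B *m (A *m (A *m m0)) - (tA x (q * Q) + tA x Q) *: (B *m m1) -
   (tA x Q ^+ 2) *: (B *m m0).
  rewrite A0; vec; rewrite A1 A0; vec; vlin; ring.
rewrite r1 A0 B0; vec; rewrite ?A1 ?B1 ?B0 ?A0 ?Aw; vec; rewrite ?A1 ?B1 ?B0 ?A0 ?Aw; vec.
rewrite ?A1 ?B1 ?B0 ?A0 ?Aw; vec.
case: x a0 b0 c0 l0 r1 A0 A1 Aw B0 B1 => a b c l /= a0 b0 c0 l0 *.
vlin; rewrite /tA /tB /ph /ps /beta /gamma /=.
field; nz.
Qed.

Lemma verma_BAA A B x Q m0 w m1 m2 : nzq x -> Q != 0 ->
  A *m m0 = m1 + tA x Q *: m0 -> A *m m1 = m2 + tA x (q * Q) *: m1 ->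
  A *m w = tA x (Q / q) *: w + ph q x Q *: m0 ->
  B *m m0 = tB x Q *: m0 + w -> B *m m1 = tB x (q * Q) *: m1 + ph q x (q * Q) *: m0 ->
  B *m m2 = tB x (q * (q * Q)) *: m2 + ph q x (q * (q * Q)) *: m1 ->
  B *m (A *m (A *m m0)) = (q ^+ 2 + q ^- 2) *: (A *m (B *m (A *m m0))) - A *m (A *m (B *m m0))
   - (q ^+ 2 - q ^- 2) ^+ 2 *: (B *m m0) - ((q - q^-1) ^+ 2 * gamma q x) *: (A *m m0)
   + ((q ^+ 2 - q ^- 2) * (q - q^-1) * beta q x) *: m0.
Proof.
move=> [a0 b0 c0 l0] Q0 A0 A1 Aw B0 B1 B2.
do 3 (rewrite ?B2 ?A1 ?B1 ?B0 ?A0 ?Aw; vec).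
case: x a0 b0 c0 l0 A0 A1 Aw B0 B1 B2 => a b c l /= a0 b0 c0 l0 *.
vlin; rewrite /tA /tB /ph /ps /beta /gamma /=.
field; nz.
Qed.

Lemma verma_ABB A B x Q m0 w w' m1 : nzq x -> Q != 0 ->
  A *m m0 = m1 + tA x Q *: m0 ->
  A *m w = tA x (Q / q) *: w + ph q x Q *: m0 ->
  A *m w' = tA x (Q / q ^+ 2) *: w' + ph q x (Q / q) *: w ->
  B *m m0 = tB x Q *: m0 + w -> B *m m1 = tB x (q * Q) *: m1 + ph q x (q * Q) *: m0 ->
  B *m w = tB x (Q / q) *: w + w' ->
  A *m (B *m (B *m m0)) = (q ^+ 2 + q ^- 2) *: (B *m (A *m (B *m m0))) - B *m (B *m (A *m m0))
   - (q ^+ 2 - q ^- 2) ^+ 2 *: (A *m m0) - ((q - q^-1) ^+ 2 * gamma q x) *: (B *m m0)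
   + ((q ^+ 2 - q ^- 2) * (q - q^-1) * alpha q x) *: m0.
Proof.
move=> [a0 b0 c0 l0] Q0 A0 Aw Aw' B0 B1 Bw.
do 3 (rewrite ?Bw ?B1 ?B0 ?A0 ?Aw ?Aw'; vec).
case: x a0 b0 c0 l0 A0 Aw Aw' B0 B1 Bw => a b c l /= a0 b0 c0 l0 *.
vlin; rewrite /tA /tB /ph /ps /alpha /gamma /=.
field; nz.
Qed.

(* The Casimir element: it commutes with A, and its value on W is read off from m_0. *)
Definition casimir A B C (a b c : F) : 'M[F]_n :=
  q *: (A *m (B *m C)) + q ^+ 2 *: (A *m A) + q ^- 2 *: (B *m B) + q ^+ 2 *: (C *m C)
  - (q * a) *: A - (q^-1 * b) *: B - (q * c) *: C.

Lemma casimir_A A B C a b c w : srel q A B C a b c -> casimir A B C a b c *m (A *m w) = A *m (casimir A B C a b c *m w).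
Proof.
case=> ha hb hc; rewrite /casimir; vec.
(* Three rules that bring monomials into the order A, B, C. *)
have HBA u : B *m (A *m u) = q ^+ 2 *: (A *m (B *m u)) - (q / kq) *: ((c / (q + q^-1)) *: u - C *m u).
  have := congr1 (fun mvec => mvec *m u) hc; vec => h'; rewrite -h'; vlin; field; nz.
have HCB u : C *m (B *m u) = q ^+ 2 *: (B *m (C *m u)) - (q / kq) *: ((a / (q + q^-1)) *: u - A *m u).
  have := congr1 (fun mvec => mvec *m u) ha; vec => h'; rewrite -h'; vlin; field; nz.
have HCA u : C *m (A *m u) = q ^- 2 *: (A *m (C *m u)) + (q^-1 / kq) *: ((b / (q + q^-1)) *: u - B *m u).
  have := congr1 (fun mvec => mvec *m u) hb; vec => h'; rewrite -h'; vlin; field; nz.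
do 6 (rewrite ?(HBA, HCA, HCB); vec).
have -> : (q + q^-1) = (q ^+ 2 + 1) / q by field; nz.
vlin; field; nz.
Qed.

(* The relations satisfied by m_0: marginality in the strong form that determines [kappa]. *)
Definition smv A B x v :=
  B *m v = tB x 1 *: v /\ B *m (A *m v) = tB x q *: (A *m v) + kappa q x *: v.

Fixpoint chain A x v i : 'cV[F]_n :=
  if i is j.+1 then A *m chain A x v j - tA x (q ^+ j) *: chain A x v j else v.

Lemma ph1 x : ph q x 1 = 0.
Proof. by rewrite /ph invr1 subrr mul0r. Qed.

Lemma chainA A x v i : A *m chain A x v i = chain A x v i.+1 + tA x (q ^+ i) *: chain A x v i.
Proof. by rewrite /= subrK. Qed.

(** [smv] is the claim for indices 0 and 1, and [verma_step] passes from two consecutive indices to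
    the next one. *)
Lemma chainB A B x v : nzq x -> rel_BAA q A B (beta q x) (gamma q x) -> smv A B x v ->
  forall i, B *m chain A x v i = tB x (q ^+ i) *: chain A x v i + ph q x (q ^+ i) *: chain A x v i.-1.
Proof.
move=> nx r1 [h1 h2].
have b0 : B *m chain A x v 0 = tB x (q ^+ 0) *: chain A x v 0 + ph q x (q ^+ 0) *: chain A x v 0.-1.
  by rewrite /= expr0 h1 ph1 scale0r addr0.
have b1 : B *m chain A x v 1 = tB x (q ^+ 1) *: chain A x v 1 + ph q x (q ^+ 1) *: chain A x v 0.
  by rewrite /= expr0 expr1; vec; rewrite h1 h2 /kappa; vlin; ring.
suff H i : B *m chain A x v i = tB x (q ^+ i) *: chain A x v i + ph q x (q ^+ i) *: chain A x v i.-1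
   /\ B *m chain A x v i.+1 = tB x (q ^+ i.+1) *: chain A x v i.+1 + ph q x (q ^+ i.+1) *: chain A x v i.
  by move=> i; have [] := H i.
elim: i => [|i [ih1 ih2]]; first by split.
split=> //.
have := @verma_step A B x (q ^+ i) (chain A x v i) (ph q x (q ^+ i) *: chain A x v i.-1)
  (chain A x v i.+1) (chain A x v i.+2) nx (expf_neq0 _ q0) r1.
rewrite -!exprS; apply=> //.
- exact: chainA.
- exact: chainA.
- case: i ih1 ih2 => [|i] _ _; first by rewrite expr0 ph1 !scale0r scaler0 mulmx0 add0r.
  rewrite mulmxZ /= -/(chain A x v i.+1); have -> : q ^+ i.+1 / q = q ^+ i by rewrite exprS; field; nz.
  by rewrite (chainA A x v i); vlin; ring.
Qed.

Lemma casimir_smv A B C x v : nzq x -> srel q A B C (alpha q x) (beta q x) (gamma q x) -> smv A B x v ->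
  casimir A B C (alpha q x) (beta q x) (gamma q x) *m v = ((q + q^-1) ^+ 2 - omega q x) *: v.
Proof.
move=> nx sr hv; have r1 := srel_BAA q0 q4 sr; have rc := srel_C q0 q4 sr.
have hb := chainB nx r1 hv.
have ha i := chainA A x v i.
have B0 : B *m v = tB x (q ^+ 0) *: v + ph q x (q ^+ 0) *: v := hb 0%N.
have := hb 2%N; rewrite -[chain A x v 2.-1]/(chain A x v 1).
have := hb 1%N; rewrite -[chain A x v 1.-1]/v.
have := ha 1%N.
have : A *m v = chain A x v 1 + tA x (q ^+ 0) *: v := ha 0%N.
move: B0 (chain A x v 1) (chain A x v 2) => B0 m1 m2.
rewrite expr0 expr1 in B0 *; rewrite ph1 scale0r addr0 in B0 => A0 A1 B1 B2.
rewrite /casimir; vec; rewrite !rc; vec.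
do 4 (rewrite ?rc ?B2 ?B1 ?B0 ?A1 ?A0; vec).
case: nx => a0 b0 c0 l0.
have -> : (q + q^-1) = (q ^+ 2 + 1) / q by field; nz.
vlin; rewrite /tA /tB /ph /ps /alpha /beta /gamma /omega.
field; nz.
Qed.

End Verma.

(** * q^2 as a primitive d'-th root of unity *)

Section Root.
Variables (F : closedFieldType) (q : F) (d : nat).
Hypothesis hq : d.-primitive_root q.
Hypothesis hd : d \notin [:: 1%N; 2%N; 4%N].
Local Notation p := (dprime d).

Lemma root_q0 : q != 0.
Proof. by apply/negP => /eqP h; have := prim_expr_order hq; rewrite h expr0n; case: d hq => // d' _ /eqP; rewrite eq_sym oner_eq0. Qed.

Lemma d_gt0 : (0 < d)%N. Proof. exact: prim_order_gt0 hq. Qed.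

Lemma dprime_gt2 : (2 < p)%N.
Proof.
have := d_gt0; move: hd; rewrite /dprime !inE !negb_or.
by case: d => [|[|[|[|[|[|k]]]]]] //= _ _; case: ifP => //= _; rewrite !ltnS.
Qed.

Lemma dprime_gt0 : (0 < p)%N. Proof. exact: ltn_trans dprime_gt2. Qed.

Lemma q2_eq1 i : (q ^+ (2 * i) == 1) = (p %| i)%N.
Proof.
rewrite -(prim_order_dvd hq) /dprime; case: ifP => hodd.
  by rewrite Gauss_dvdr // coprimen2.
by rewrite -{1}[d]odd_double_half hodd add0n -mul2n dvdn_pmul2l.
Qed.

Lemma prim_q2 : p.-primitive_root (q ^+ 2).
Proof.
apply/andP; split; first exact: dprime_gt0.
apply/forallP => i; rewrite unity_rootE -exprM q2_eq1; apply/eqP.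
apply/idP/eqP => [|->]; last by rewrite dvdnn.
by move=> h; apply/eqP; rewrite eqn_leq ltn_ord dvdn_leq.
Qed.

Lemma q2p : q ^+ (2 * p) = 1.
Proof. by apply/eqP; rewrite q2_eq1. Qed.

Lemma root_q4 : q ^+ 4 != 1.
Proof.
by rewrite (q2_eq1 2); apply/negP => /(dvdn_leq (isT : 0 < 2)%N); rewrite leqNgt dprime_gt2.
Qed.

Lemma q2_eq i j : (q ^+ (2 * i) == q ^+ (2 * j)) = (i == j %[mod p])%N.
Proof. by rewrite !exprM (eq_prim_root_expr prim_q2). Qed.

Lemma q2_mod i : q ^+ (2 * (i %% p)%N) = q ^+ (2 * i).
Proof. by rewrite !exprM (prim_expr_mod prim_q2). Qed.

Lemma q2_inv i : exists j, (q ^+ (2 * i))^-1 = q ^+ (2 * j).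
Proof.
exists (i * p.-1)%N; have q0 := root_q0.
apply: (mulfI (expf_neq0 (2 * i) q0)).
rewrite mulfV ?expf_neq0 // -exprD -mulnDr -mulnS prednK ?dprime_gt0 //.
by apply/esym/eqP; rewrite q2_eq1 dvdn_mull.
Qed.

End Root.

(** * The matrices of W satisfy the defining relations *)

Section Matrices.
Variables (F : closedFieldType) (q : F) (d : nat).
Hypothesis hq : d.-primitive_root q.
Hypothesis hd : d \notin [:: 1%N; 2%N; 4%N].
Local Notation p := (dprime d).
Local Notation WA := (@WA F q d).
Local Notation WB := (@WB F q d).
Local Notation WC := (@WC F q d).
Let q0 := root_q0 hq.
Let q4 := root_q4 hq hd.
Let p0 := dprime_gt0 hq hd.
Implicit Types (x y : quint F).
Implicit Types (u v w : 'cV[F]_p).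

Definition ev i : 'cV[F]_p := \col_j ((j : nat) == i)%:R.

Lemma thetaE x i : theta F q x i = tA x.1 (q ^+ i).
Proof. by rewrite /theta /tA -!exprM mulnC. Qed.

Lemma thetasE x i : thetas F q x i = tB x.1 (q ^+ i).
Proof. by rewrite /thetas /tB -!exprM mulnC. Qed.

Lemma phiE x i : nzq x.1 -> phi F q x i = ph q x.1 (q ^+ i).
Proof.
case: x => -[a b c l] dl [] /= a0 b0 c0 l0.
rewrite /phi /ph /ps !expfzDr // exprN1 -invr_expz expr1z /=.
have qi : q ^+ i != 0 by rewrite expf_neq0.
by rewrite -exprnP; field; nz.
Qed.

Lemma mul_ev (A : 'M[F]_p) i (h : (i < p)%N) : A *m ev i = col (Ordinal h) A.
Proof.
rewrite colE; congr (_ *m _); apply/colP => j; rewrite !mxE andbT.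
by rewrite -val_eqE.
Qed.

Lemma WA_ev x i : (i < p)%N ->
  WA x *m ev i = tA x.1 (q ^+ i) *: ev i + ev i.+1 + ((i == p.-1)%:R * x.2) *: ev 0.
Proof.
move=> h; rewrite (mul_ev _ h); apply/colP => j; rewrite !mxE thetaE /= -val_eqE /=.
by rewrite mulrC -!mulrA; congr (_ + _ + _); case: (_ == p.-1); case: (_ == 0%N);
   rewrite /= ?mulr0 ?mulr1 ?mul0r ?mul1r.
Qed.

Lemma WB_ev x i : nzq x.1 -> (i < p)%N ->
  WB x *m ev i = tB x.1 (q ^+ i) *: ev i + ph q x.1 (q ^+ i) *: ev i.-1.
Proof.
move=> nx h; rewrite (mul_ev _ h); apply/colP => j; rewrite !mxE thetasE phiE //= -val_eqE /=.
rewrite mulrC; congr (_ + _); case: i h => [|i] h.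
  by rewrite expr0 ph1 mulr0 mul0r.
by rewrite eqSS mulrC.
Qed.

Lemma ev_ge i : (p <= i)%N -> ev i = 0.
Proof. by move=> h; apply/colP => j; rewrite !mxE; case: eqP => // e; move: (ltn_ord j); rewrite e ltnNge h. Qed.

Lemma ev_sum v : v = \sum_(j < p) v j 0 *: ev j.
Proof.
apply/colP => i; rewrite summxE (bigD1 i) //= !mxE eqxx mulr1 big1 ?addr0 //.
by move=> j ne; rewrite !mxE val_eqE eq_sym (negbTE ne) mulr0.
Qed.

Lemma ev_ext (A B : 'M[F]_p) : (forall i, (i < p)%N -> A *m ev i = B *m ev i) -> A = B.
Proof.
move=> h; apply: mx_ext => w; rewrite (ev_sum w) !mulmx_sumr.
by apply: eq_bigr => j _; rewrite !mulmxZ h.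
Qed.

(* The image of m_i in W for every i, using m_(p + i) = delta m_i. *)
Definition mvec x i : 'cV[F]_p := locked (x.2 ^+ (i %/ p)%N *: ev (i %% p)%N).

Lemma mvec_lt x i : (i < p)%N -> mvec x i = ev i.
Proof. by move=> h; rewrite /mvec -lock divn_small // modn_small // expr0 scale1r. Qed.

Lemma tA_mod (x : quad F) i : tA x (q ^+ (i %% p)%N) = tA x (q ^+ i).
Proof. by rewrite /tA -!exprM !(mulnC _ 2) (q2_mod hq hd). Qed.
Lemma tB_mod (x : quad F) i : tB x (q ^+ (i %% p)%N) = tB x (q ^+ i).
Proof. by rewrite /tB -!exprM !(mulnC _ 2) (q2_mod hq hd). Qed.
(** q^d' may be -1, so periodicity modulo d' rests on [ph] being even in Q: it is a constant times
    four odd factors. *)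
Lemma ph_mod (x : quad F) i : nzq x -> ph q x (q ^+ (i %% p)%N) = ph q x (q ^+ i).
Proof.
case=> a0 b0 c0 l0; have qi : q ^+ i != 0 by rewrite expf_neq0.
have H Q : Q != 0 -> ph q x Q = (qa x)^-1 * (qb x)^-1 * ql x * q * (Q ^+ 2 - 1) *
  ((q * ql x)^-1 - ql x * q / Q ^+ 2) * (1 - qa x * qb x * qc x / ql x * Q ^+ 2 / q) *
  (1 / Q ^+ 2 - qa x * qb x / qc x / ql x / q).
  by move=> Q0; rewrite /ph /ps; field; nz.
rewrite !H ?expf_neq0 // -!exprM !(mulnC _ 2) (q2_mod hq hd) //.
Qed.

Lemma mvec_A x i : WA x *m mvec x i = mvec x i.+1 + tA x.1 (q ^+ i) *: mvec x i.
Proof.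
have hm : (i %% p < p)%N by rewrite ltn_pmod.
rewrite /mvec -!lock mulmxZ WA_ev // tA_mod.
have [e|ne] := eqVneq (i %% p)%N p.-1.
  have hi : i.+1 = ((i %/ p).+1 * p + 0)%N.
    by rewrite {1}(divn_eq i p) e mulSn addn0 -addnS prednK // addnC.
  rewrite hi divnMDl // div0n addn0 modnMDl mod0n e prednK // (ev_ge (leqnn p)).
  by rewrite mul1r exprSr; apply/colP => j; rewrite !mxE; ring.
have hm1 : ((i %% p).+1 < p)%N.
  rewrite ltn_neqAle hm andbT; apply: contra ne => /eqP h.
  by apply/eqP; apply: succn_inj; rewrite h (prednK p0).
have hi : i.+1 = ((i %/ p) * p + (i %% p).+1)%N by rewrite addnS -divn_eq.
rewrite hi divnMDl // (divn_small hm1) addn0 modnMDl (modn_small hm1).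
by rewrite mul0r; apply/colP => j; rewrite !mxE; ring.
Qed.

Lemma mvec_B x i : nzq x.1 -> WB x *m mvec x i = tB x.1 (q ^+ i) *: mvec x i + ph q x.1 (q ^+ i) *: mvec x i.-1.
Proof.
move=> nx; have hm : (i %% p < p)%N by rewrite ltn_pmod.
have [e|ne] := posnP (i %% p)%N.
  have -> : ph q x.1 (q ^+ i) = 0 by rewrite -ph_mod // e expr0 ph1.
  by rewrite /mvec -!lock mulmxZ WB_ev // tB_mod e expr0 ph1; apply/colP => j; rewrite !mxE; ring.
have hi : i.-1 = ((i %/ p) * p + (i %% p).-1)%N.
  by rewrite {1}(divn_eq i p) -(prednK ne) addnS.
have hm1 : ((i %% p).-1 < p)%N by apply: leq_ltn_trans hm; apply: leq_pred.
rewrite /mvec -!lock hi divnMDl // (divn_small hm1) addn0 modnMDl (modn_small hm1).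
rewrite mulmxZ WB_ev // tB_mod ph_mod //.
by apply/colP => j; rewrite !mxE; ring.
Qed.

(** The vectors below m_i carry their coefficients: for i = 0 and i = 1 the truncated predecessor is
    a wrong index, but phi_0 = 0 kills the term. *)
Lemma W_rel x i : nzq x.1 -> (i < p)%N -> let w := ph q x.1 (q ^+ i) *: mvec x i.-1 in
  let w' := ph q x.1 (q ^+ i / q) *: (ph q x.1 (q ^+ i) *: mvec x i.-2) in
  [/\ WA x *m w = tA x.1 (q ^+ i / q) *: w + ph q x.1 (q ^+ i) *: mvec x i,
      WA x *m w' = tA x.1 (q ^+ i / q ^+ 2) *: w' + ph q x.1 (q ^+ i / q) *: w &
      WB x *m w = tB x.1 (q ^+ i / q) *: w + w'].
Proof.
move=> nx hi w w'; rewrite /w' /w.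
case: i hi {w w'} => [|[|i]] hi; rewrite ?expr0 ?expr1 ?(divff q0) ?ph1 ?(scale0r, scaler0, mulmx0, addr0) //=.
  split=> //.
  - by rewrite mulmxZ mvec_A expr0; apply/colP => j; rewrite !mxE; ring.
  - by rewrite mulmxZ mvec_B // expr0 ph1; apply/colP => j; rewrite !mxE; ring.
have e1 : q ^+ i.+2 / q = q ^+ i.+1 by rewrite exprSr mulfK.
have e2 : q ^+ i.+2 / q ^+ 2 = q ^+ i by rewrite -addn2 exprD mulfK // expf_neq0.
rewrite e1 e2; split.
- by rewrite mulmxZ mvec_A; apply/colP => j; rewrite !mxE; ring.
- by rewrite mulmxZ mulmxZ mvec_A; apply/colP => j; rewrite !mxE; ring.
- by rewrite mulmxZ mvec_B //; apply/colP => j; rewrite !mxE; ring.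
Qed.

Ltac vec := rewrite ?(mulmxDl, mulNmx, mulscal, scalemxAlv, mlin) -?mulmxA.

Lemma W_BAA x : nzq x.1 -> rel_BAA q (WA x) (WB x) (beta q x.1) (gamma q x.1).
Proof.
move=> nx.
suff H : WB x *m (WA x *m WA x) = (q ^+ 2 + q ^- 2) *: (WA x *m (WB x *m WA x)) - WA x *m (WA x *m WB x)
   - (q ^+ 2 - q ^- 2) ^+ 2 *: WB x - ((q - q^-1) ^+ 2 * gamma q x.1) *: WA x
   + ((q ^+ 2 - q ^- 2) * (q - q^-1) * beta q x.1)%:M.
  by move=> w; have := congr1 (fun X => X *m w) H; vec.
apply: ev_ext => i hi; vec; rewrite -(mvec_lt x hi).
have [h1 h2 h3] := W_rel nx hi.
apply: (verma_BAA q0 nx (expf_neq0 i q0) (mvec_A _ _) _ h1 (mvec_B _ nx)).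
- by rewrite -exprS; apply: mvec_A.
- by rewrite -exprS; apply: (mvec_B i.+1).
- by rewrite -!exprS; apply: (mvec_B i.+2).
Qed.

Lemma W_ABB x : nzq x.1 -> rel_ABB q (WA x) (WB x) (alpha q x.1) (gamma q x.1).
Proof.
move=> nx.
suff H : WA x *m (WB x *m WB x) = (q ^+ 2 + q ^- 2) *: (WB x *m (WA x *m WB x)) - WB x *m (WB x *m WA x)
   - (q ^+ 2 - q ^- 2) ^+ 2 *: WA x - ((q - q^-1) ^+ 2 * gamma q x.1) *: WB x
   + ((q ^+ 2 - q ^- 2) * (q - q^-1) * alpha q x.1)%:M.
  by move=> w; have := congr1 (fun X => X *m w) H; vec.
apply: ev_ext => i hi; vec; rewrite -(mvec_lt x hi).
have [h1 h2 h3] := W_rel nx hi.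
apply: (verma_ABB q0 nx (expf_neq0 i q0) (mvec_A _ _) h1 h2 (mvec_B _ nx) _ h3).
by rewrite -exprS; apply: (mvec_B i.+1).
Qed.

Lemma W_srel x : nzq x.1 -> srel q (WA x) (WB x) (WC x) (alpha q x.1) (beta q x.1) (gamma q x.1).
Proof.
move=> nx; apply: srel_of => //; first exact: W_BAA; first exact: W_ABB.
move=> w; rewrite /WC; vec; congr (_ *: _ - _).
  congr (_ / _); case: x nx => -[a b c l] dl [] /= a0 b0 c0 l0.
  by rewrite /gammaW /gamma /= invfM.
Qed.

Lemma W_smv x : nzq x.1 -> smv q (WA x) (WB x) x.1 (ev 0).
Proof.
move=> nx; rewrite -(mvec_lt x p0); split.
  by rewrite mvec_B // expr0 ph1 scale0r addr0.
rewrite mvec_A mulmxDr (mvec_B 1 nx) [WB x *m (_ *: _)]mulmxZ (mvec_B 0 nx) expr0 expr1 ph1 /kappa.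
by apply/colP => j; rewrite !mxE; ring.
Qed.

Lemma srel_module n (A B C : 'M[F]_n) a b c : srel q A B C a b c -> is_module q A B C.
Proof.
by case=> e1 e2 e3; rewrite /is_module e1 e2 e3; split; split; rewrite mul_scalar_mx mul_mx_scalar.
Qed.

End Matrices.

(** * Submodules, Schur's lemma and isomorphisms *)

Section Modules.
Variables (F : closedFieldType).
Variable n : nat.
Implicit Types (A B C X U P : 'M[F]_n) (u v w : 'cV[F]_n).

Definition inV U v := (v^T <= U)%MS.

Lemma inV_A U A : (U *m A^T <= U)%MS -> forall v, inV U v -> inV U (A *m v).
Proof.
by move=> h v hv; rewrite /inV trmx_mul (submx_trans _ h) // submxMr.
Qed.

Lemma inV_inv U A : (forall v, inV U v -> inV U (A *m v)) -> (U *m A^T <= U)%MS.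
Proof.
move=> h; apply/row_subP => i; rewrite row_mul.
have := h (row i U)^T; rewrite /inV trmx_mul trmxK; apply; exact: row_sub.
Qed.

Lemma inV_D U u v : inV U u -> inV U v -> inV U (u + v).
Proof. by rewrite /inV raddfD /=; apply: addmx_sub. Qed.
Lemma inV_Z U a v : inV U v -> inV U (a *: v).
Proof. by rewrite /inV linearZ /=; apply: scalemx_sub. Qed.
Lemma inV_B U u v : inV U u -> inV U v -> inV U (u - v).
Proof. by move=> hu hv; apply: inV_D => //; rewrite -scaleN1r; apply: inV_Z. Qed.
Lemma inV_0 U : inV U 0.
Proof. by rewrite /inV trmx0 sub0mx. Qed.

Lemma inV_full U : (forall v, inV U v) -> row_full U.
Proof.
move=> h; rewrite -sub1mx; apply/row_subP => i.
by have := h (row i 1%:M)^T; rewrite /inV trmxK.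
Qed.

Lemma full_inV U v : row_full U -> inV U v.
Proof. exact: submx_full. Qed.

Lemma inV_neq0 U : U != 0 -> exists2 v, v != 0 & inV U v.
Proof.
case/rowV0Pn => r hr r0; exists r^T; last by rewrite /inV trmxK.
by apply: contraNneq r0 => h; rewrite -(trmxK r) h trmx0.
Qed.

Definition inv_space A B C U :=
  [/\ (U *m A^T <= U)%MS, (U *m B^T <= U)%MS & (U *m C^T <= U)%MS].

Definition generates A B C v := forall U, inv_space A B C U -> inV U v -> row_full U.

Lemma irr_generates A B C v : irreducible A B C -> v != 0 -> generates A B C v.
Proof.
move=> [_ h] v0 U [hA hB hC] hv; have [U0|//] := h U hA hB hC.
by move: hv; rewrite /inV U0 submx0 => /eqP /(congr1 trmx); rewrite trmxK trmx0 => /eqP; rewrite (negbTE v0).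
Qed.

Lemma ker_invariant X A : X *m A = A *m X -> (kermx X^T *m A^T <= kermx X^T)%MS.
Proof.
by move=> h; apply/sub_kermxP; rewrite -mulmxA -trmx_mul h trmx_mul mulmxA mulmx_ker mul0mx.
Qed.

Lemma eigen_exists X : (0 < n)%N -> exists a, exists2 v : 'cV[F]_n, v != 0 & X *m v = a *: v.
Proof.
case: n X => // n' X _.
have : size (char_poly X^T) != 1%N by rewrite size_char_poly.
case/closed_rootP => a; rewrite -eigenvalue_root_char => /eigenvalueP [u hu u0].
exists a; exists u^T; first by apply: contraNneq u0 => h; rewrite -(trmxK u) h trmx0.
by rewrite -[X]trmxK -trmx_mul hu linearZ.
Qed.

(** For an eigenvalue a of X, the kernel of X - a is a nonzero submodule. *)
Lemma schur A B C X : irreducible A B C -> X *m A = A *m X -> X *m B = B *m X -> X *m C = C *m X ->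
  exists a, X = a%:M.
Proof.
move=> irr hA hB hC; have [n0 h] := irr; have [a [v v0 hv]] := eigen_exists X n0.
exists a; apply/eqP; rewrite -subr_eq0; apply/eqP.
have hc Y : X *m Y = Y *m X -> (X - a%:M) *m Y = Y *m (X - a%:M).
  by move=> e; rewrite mulmxBl mulmxBr e mul_scalar_mx mul_mx_scalar.
have : row_full (kermx (X - a%:M)^T).
  apply: (irr_generates irr v0).
  by split; apply: ker_invariant; apply: hc.
  by apply/sub_kermxP; rewrite -trmx_mul mulmxBl hv mul_scalar_mx subrr trmx0.
rewrite -sub1mx => /sub_kermxP; rewrite mul1mx => /(congr1 trmx); by rewrite trmxK trmx0.
Qed.

Lemma iso_sym A B C A' B' C' : mod_iso A B C A' B' C' -> mod_iso A' B' C' A B C.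
Proof.
case=> P uP [hA hB hC]; exists (invmx P); first by rewrite unitmx_inv.
have H X X' : P *m X = X' *m P -> invmx P *m X' = X *m invmx P.
  by move=> e; rewrite -[X in _ *m X = _](mulmxK uP) -e -!mulmxA mulKmx // mulmxA.
by split; apply: H.
Qed.

Lemma iso_refl A B C : mod_iso A B C A B C.
Proof. by exists 1%:M; rewrite ?unitmx1 // !mul1mx !mulmx1. Qed.

Lemma iso_trans A B C A' B' C' A'' B'' C'' : mod_iso A B C A' B' C' ->
  mod_iso A' B' C' A'' B'' C'' -> mod_iso A B C A'' B'' C''.
Proof.
case=> P uP [hA hB hC] [Q uQ [kA kB kC]]; exists (Q *m P); first by rewrite unitmx_mul uQ.
by split; rewrite -mulmxA ?hA ?hB ?hC !mulmxA ?kA ?kB ?kC.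
Qed.

Lemma iso_irr A B C A' B' C' : mod_iso A B C A' B' C' -> irreducible A B C -> irreducible A' B' C'.
Proof.
case=> P uP [hA hB hC] [n0 h]; split=> // U uA uB uC.
pose U' := U *m (invmx P)^T.
have uPT : (invmx P)^T \in unitmx by rewrite unitmx_tr unitmx_inv.
have H X X' : P *m X = X' *m P -> (U *m X'^T <= U)%MS -> (U' *m X^T <= U')%MS.
  move=> e hU; rewrite /U' -mulmxA -trmx_mul.
  have -> : X *m invmx P = invmx P *m X' by rewrite -[X' in RHS](mulmxK uP) -e -!mulmxA mulKmx // mulmxA.
  by rewrite trmx_mul mulmxA submxMr.
have [U0|fU] := h U' (H _ _ hA uA) (H _ _ hB uB) (H _ _ hC uC).
  by left; apply: (can_inj (mulmxK uPT)); rewrite mul0mx.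
by right; move: fU; rewrite /row_full /U' mxrankMfree // row_free_unit.
Qed.

Variable q : F.
Hypothesis q0 : q != 0.
Hypothesis q4 : q ^+ 4 != 1.

Lemma iso_srel A B C A' B' C' a b c : mod_iso A B C A' B' C' ->
  srel q A B C a b c -> srel q A' B' C' a b c.
Proof.
case=> P uP [hA hB hC] [e1 e2 e3].
have H X X' s : P *m X = X' *m P -> X = s%:M -> X' = s%:M.
  move=> e eX; apply: (can_inj (mulmxK uP)); rewrite -e eX.
  by rewrite mul_scalar_mx mul_mx_scalar.
split; [apply: H e1|apply: H e2|apply: H e3];
  rewrite !(mulmxDr, mulmxDl, mulmxN, mulNmx) -!(scalemxAr, scalemxAl) !(mulmxDr, mulmxDl, mulmxN, mulNmx)
   -!(scalemxAr, scalemxAl) !mulmxA ?hA ?hB ?hC -!mulmxA ?hA ?hB ?hC //.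
Qed.

Lemma srel_inj A B C a b c a' b' c' : (0 < n)%N -> srel q A B C a b c -> srel q A B C a' b' c' ->
  [/\ a = a', b = b' & c = c'].
Proof.
move=> n0 [e1 e2 e3] [f1 f2 f3].
have qq : q + q^-1 != 0.
  have -> : q + q^-1 = (q ^+ 2 + 1) / q by field; nz.
  by rewrite mulf_neq0 ?invr_eq0 // (q2N q4).
have H (s t : F) : (s / (q + q^-1))%:M = (t / (q + q^-1))%:M :> 'M[F]_n -> s = t.
  move=> /matrixP /(_ (Ordinal n0) (Ordinal n0)); rewrite !mxE eqxx !mulr1n.
  by apply: mulIf; rewrite invr_eq0.
by split; apply: H; rewrite -?e1 -?e2 -?e3 -?f1 -?f2 -?f3.
Qed.

End Modules.

(** * The d'-step operator in A, and the universal property of W *)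

Section Chain.
Variables (F : closedFieldType) (q : F) (d : nat).
Hypothesis hq : d.-primitive_root q.
Hypothesis hd : d \notin [:: 1%N; 2%N; 4%N].
Local Notation p := (dprime d).
Local Notation WA := (@WA F q d).
Local Notation WB := (@WB F q d).
Local Notation WC := (@WC F q d).
Local Notation mvec := (@mvec F d).
Local Notation ev := (@ev F d).
Let q0 := root_q0 hq.
Let q4 := root_q4 hq hd.
Let p0 := dprime_gt0 hq hd.
Let q2N := q2N q4.
Let q2B := q2B q4.
Let q4B := q4B q4.

Lemma poly_ext (f g : {poly F}) : (forall w, f.[w] = g.[w]) -> f = g.
Proof.
move=> h; apply/eqP; rewrite -subr_eq0; apply/negPn/negP => /closed_nonrootP [w].
by rewrite /root hornerD hornerN h subrr eqxx.
Qed.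

Lemma joukowski (w : F) : exists2 z, z != 0 & w = z + z^-1.
Proof.
have [z] := @solve_monicpoly F 2 (nth 0 [:: - 1; w]) isT.
rewrite !big_ord_recl !big_ord0 /= /bump /= => h.
have z0 : z != 0.
  apply/negP => /eqP z0; move: h; rewrite z0 ?addn0 expr1 mulr0 !addr0 expr0 mulr1 expr0n /= => /eqP.
  by rewrite eq_sym oppr_eq0 oner_eq0.
exists z => //; apply: (mulIf z0).
rewrite mulrDl mulVf //; transitivity (z ^+ 2 + 1); last by ring.
by rewrite h; ring.
Qed.

Lemma prod_prim (z t : F) : t != 0 -> \prod_(j < p) (z - t * (q ^+ 2) ^+ j) = z ^+ p - t ^+ p.
Proof.
move=> t0; have := factor_Xn_sub_1 (prim_q2 hq hd) => /(congr1 (fun f : {poly F} => f.[z / t])).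
rewrite big_mkord horner_prod !hornerE expr_div_n => e.
have -> : z ^+ p - t ^+ p = (z ^+ p / t ^+ p - 1) * t ^+ p.
  by rewrite mulrBl mul1r divfK // expf_neq0.
rewrite -e -[X in _ * t ^+ X](card_ord p) -prodr_const -big_split /=.
by apply: eq_bigr => j _; rewrite !hornerE mulrBl divfK // mulrC.
Qed.

Definition theta_cst (x : quad F) := qa x ^+ p / ql x ^+ p + ql x ^+ p / qa x ^+ p.
Definition theta_poly (x : quad F) := \prod_(j < p) ('X - (tA x (q ^+ j))%:P).

(** With t_j = (a / lambda) q^(2j), the factor z + z^-1 - theta_j equals (z - t_j)(z^-1 - t_j) / (-
    t_j), and the t_j are all the d'-th roots of (a / lambda)^d'. *)
Lemma theta_poly_horner x z : nzq x -> z != 0 -> (theta_poly x).[z + z^-1] = z ^+ p + z ^- p - theta_cst x.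
Proof.
case=> a0 b0 c0 l0 z0; rewrite horner_prod /theta_cst -!expr_div_n /tA.
have hinv : ql x / qa x = (qa x / ql x)^-1 by rewrite invf_div.
have t0 : qa x / ql x != 0 by rewrite mulf_neq0 ?invr_eq0.
rewrite hinv; move: (qa x / ql x) t0 {hinv} => t t0.
have z1 : z^-1 != 0 by rewrite invr_eq0.
transitivity (\prod_(j < p) ((z - t * (q ^+ 2) ^+ j) * (z^-1 - t * (q ^+ 2) ^+ j) / (0 - t * (q ^+ 2) ^+ j))).
  apply: eq_bigr => j _; rewrite hornerD hornerN hornerX hornerC sub0r.
  have hj : q ^+ j != 0 by rewrite expf_neq0.
  have -> : (q ^+ 2) ^+ j = (q ^+ j) ^+ 2 by rewrite -!exprM mulnC.
  move: (q ^+ j) hj => Q Q0; field; nz.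
rewrite big_split /= big_split /= !prod_prim // prodfV prod_prim // expr0n.
rewrite (negbTE (lt0n_neq0 p0)) /= !exprVn.
have tp : t ^+ p != 0 by rewrite expf_neq0.
have zp : z ^+ p != 0 by rewrite expf_neq0.
by field; rewrite oppr_eq0 tp zp.
Qed.

(** Both sides take the value z^d' + z^-d' at z + z^-1, and every element of the field has the form
    z + z^-1. *)
Lemma theta_poly_eq x y : nzq x -> nzq y -> theta_poly x + (theta_cst x)%:P = theta_poly y + (theta_cst y)%:P.
Proof.
move=> nx ny; apply: poly_ext => w; have [z z0 ->] := joukowski w.
by rewrite !hornerD !hornerC !theta_poly_horner // !subrK.
Qed.

Lemma chain_poly n (A : 'M[F]_n.+1) x v i :
  chain q A x v i = horner_mx A (\prod_(j < i) ('X - (tA x (q ^+ j))%:P)) *m v.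
Proof.
elim: i => [|i ih]; first by rewrite big_ord0 rmorph1 mul1mx.
rewrite big_ord_recr /= mulrC rmorphM -mulmxA -ih rmorphB /= horner_mx_X horner_mx_C.
by rewrite mulmxBl mul_scalar_mx.
Qed.

Lemma chain_p n (A : 'M[F]_n) x y v : nzq x -> nzq y ->
  chain q A x v p + theta_cst x *: v = chain q A y v p + theta_cst y *: v.
Proof.
move=> nx ny; case: n A v => [|n] A v; first by rewrite [LHS]flatmx0 [RHS]flatmx0.
rewrite !chain_poly -!(mul_scalar_mx _ v) -!mulmxDl -!(horner_mx_C A) -!rmorphD.
by rewrite -!/(theta_poly _) (theta_poly_eq nx ny).
Qed.

Lemma chain_dinv n (A : 'M[F]_n) (x y : quint F) v : nzq x.1 -> nzq y.1 -> dinv F d x = dinv F d y ->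
  chain q A x.1 v p = x.2 *: v -> chain q A y.1 v p = y.2 *: v.
Proof.
case: x y => [x dx] [y dy] /= nx ny hd' hx.
apply: (@addIr _ (theta_cst y *: v)); rewrite -(chain_p _ _ nx ny) hx -!scalerDl; congr (_ *: _).
case: x y nx ny hd' {hx} => [a b c l] [a' b' c' l'] _ _.
by rewrite /dinv /theta_cst /= !addrA.
Qed.

(** What a module must satisfy, besides containing a vector as in [smv], in order to receive a map
    from W. *)
Definition hasdata n (A B C : 'M[F]_n) (x : quint F) :=
  srel q A B C (alpha q x.1) (beta q x.1) (gamma q x.1) /\ (forall v, chain q A x.1 v p = x.2 *: v).

Lemma hasdata_eq n (A B C : 'M[F]_n) x y : nzq x.1 -> nzq y.1 ->
  alpha q x.1 = alpha q y.1 -> beta q x.1 = beta q y.1 -> gamma q x.1 = gamma q y.1 -> dinv F d x = dinv F d y ->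
  hasdata A B C x -> hasdata A B C y.
Proof.
move=> nx ny ea eb eg ed [h1 h2]; split; first by rewrite -ea -eb -eg.
by move=> v; apply: chain_dinv (h2 v).
Qed.

Lemma chainD n (A : 'M[F]_n) x u v i : chain q A x (u + v) i = chain q A x u i + chain q A x v i.
Proof.
elim: i => //= i ->; rewrite mulmxDr scalerDr opprD addrACA //.
Qed.
Lemma chainZ n (A : 'M[F]_n) x a v i : chain q A x (a *: v) i = a *: chain q A x v i.
Proof.
elim: i => //= i ->; rewrite mulmxZ scalerBr !scalerA mulrC //.
Qed.
Lemma chainAC n (A : 'M[F]_n) x v i : chain q A x (A *m v) i = A *m chain q A x v i.
Proof.
by elim: i => //= i ->; rewrite mulmxDr mulmxN mulmxZ.
Qed.

Lemma chain_mvec x i : chain q (WA x) x.1 (ev 0) i = mvec x i.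
Proof.
elim: i => [|i ih] /=; first by rewrite mvec_lt.
by rewrite ih (mvec_A hq hd) addrK.
Qed.

Lemma mvec_p x : mvec x p = x.2 *: ev 0.
Proof. by rewrite /mvec -lock divnn p0 modnn expr1. Qed.

Lemma W_hasdata x : nzq x.1 -> hasdata (WA x) (WB x) (WC x) x.
Proof.
move=> nx; split; first exact: (W_srel hq hd nx).
have hM i : chain q (WA x) x.1 (mvec x i) p = x.2 *: mvec x i.
  elim: i => [|i ih]; first by rewrite (mvec_lt x p0) chain_mvec mvec_p.
  have -> : mvec x i.+1 = WA x *m mvec x i + (- tA x.1 (q ^+ i)) *: mvec x i.
    by rewrite (mvec_A hq hd) scaleNr addrK.
  by rewrite chainD chainZ chainAC ih mulmxZ scalerDr !scalerA (mulrC x.2).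
move=> v; rewrite (ev_sum v).
elim/big_rec: _ => [|j u _ ih].
  have -> : (0 : 'cV[F]_p) = 0 *: ev 0 by rewrite scale0r.
  by rewrite chainZ !scale0r scaler0.
by rewrite chainD ih chainZ -(mvec_lt x (ltn_ord j)) hM scalerDr !scalerA (mulrC x.2).
Qed.

Lemma W_generates x : nzq x.1 -> generates (WA x) (WB x) (WC x) (ev 0).
Proof.
move=> nx U [hA _ _] hv; apply: inV_full => v; rewrite (ev_sum v).
have hM i : inV U (mvec x i).
  elim: i => [|i ih]; first by rewrite mvec_lt.
  have -> : mvec x i.+1 = WA x *m mvec x i + (- tA x.1 (q ^+ i)) *: mvec x i.
    by rewrite (mvec_A hq hd) scaleNr addrK.
  by apply: inV_D; [apply: inV_A|apply: inV_Z].
elim/big_rec: _ => [|j u _ ih]; first exact: inV_0.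
by apply: inV_D => //; apply: inV_Z; rewrite -(mvec_lt x (ltn_ord j)).
Qed.

(** The map sends m_i to the i-th chain vector, and the value delta of the d'-step operator makes it
    respect m_d' = delta m_0. Its image is a submodule containing [v], so it is onto, and both
    dimensions are d'. *)
Lemma verma_iso (A B C : 'M[F]_p) x v : nzq x.1 -> hasdata A B C x -> smv q A B x.1 v ->
  generates A B C v -> exists2 P : 'M[F]_p, P \in unitmx &
    [/\ P *m WA x = A *m P, P *m WB x = B *m P, P *m WC x = C *m P &
        forall i, (i < p)%N -> P *m ev i = chain q A x.1 v i].
Proof.
move=> nx [sr hp] hv hgen; have r1 := srel_BAA q0 q4 sr; have rc := srel_C q0 q4 sr.
have hB := chainB q0 nx r1 hv.
pose P : 'M[F]_p := \matrix_(j, i) chain q A x.1 v i j 0.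
have Pev i : (i < p)%N -> P *m ev i = chain q A x.1 v i.
  by move=> hi; rewrite (mul_ev P hi); apply/colP => j; rewrite !mxE.
have PA : P *m WA x = A *m P.
  apply: ev_ext => i hi; rewrite -!mulmxA WA_ev // !mulmxDr !mulmxZ (Pev _ hi) (Pev _ p0) chainA.
  have [e|ne] := eqVneq i p.-1.
    rewrite mul1r ev_ge ?mulmx0 ?addr0; last by rewrite e prednK.
    rewrite addrC; congr (_ + _); rewrite -(hp v) e prednK //.
  rewrite mul0r scale0r addr0 Pev 1?addrC //.
  rewrite ltn_neqAle hi andbT; apply: contra ne => /eqP h.
  by apply/eqP; apply: succn_inj; rewrite h (prednK p0).
have PB : P *m WB x = B *m P.
  apply: ev_ext => i hi; rewrite -!mulmxA (WB_ev hq) // mulmxDr !mulmxZ Pev // Pev ?hB //.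
  by apply: leq_ltn_trans hi; apply: leq_pred.
have PC : P *m WC x = C *m P.
  have rw := srel_C q0 q4 (W_srel hq hd nx).
  apply: mx_ext => w; rewrite -!mulmxA rw rc !mulmxDr !mulmxN !mulmxZ !mulmxDr !mulmxN !mulmxZ.
  by rewrite !(mulmxA P) PA PB -!mulmxA !(mulmxA P) PA PB -!mulmxA.
exists P => //; rewrite -unitmx_tr -row_full_unit.
apply: hgen; last by rewrite /inV -[v]/(chain q A x.1 v 0) -(Pev _ p0) trmx_mul submxMl.
by split; rewrite -trmx_mul -?PA -?PB -?PC trmx_mul submxMl.
Qed.

Lemma mx_iso_of (A B C : 'M[F]_p) x v : nzq x.1 -> hasdata A B C x -> smv q A B x.1 v ->
  generates A B C v -> mod_iso (WA x) (WB x) (WC x) A B C.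
Proof. by move=> h1 h2 h3 h4; have [P uP [? ? ? _]] := verma_iso h1 h2 h3 h4; exists P. Qed.

Lemma smv_eq n (A B : 'M[F]_n) x y v : nzq x -> nzq y -> mu x = mu y -> kappa q x = kappa q y ->
  smv q A B x v -> smv q A B y v.
Proof. by move=> nx ny em ek; rewrite /smv !tB_mu // em ek. Qed.

(** In [rel_ABB] at [v] the terms in A v cancel; what remains is the equation of [kappa_alpha] for
    an abstract marginal vector. *)
Lemma kappa_unique n (A B : 'M[F]_n) (a c m k : F) (v : 'cV[F]_n) : m != 0 -> rel_ABB q A B a c -> v != 0 ->
  B *m v = (m + m^-1) *: v -> B *m (A *m v) = (m * q ^+ 2 + (m * q ^+ 2)^-1) *: (A *m v) + k *: v ->
  k * ((m + m^-1) - (m / q ^+ 2 + (m / q ^+ 2)^-1)) = (q - q^-1) ^+ 2 * ((q + q^-1) * a - c * (m + m^-1)).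
Proof.
move=> m0 r2 v0 h1 h2; have := r2 v.
rewrite !(h1, mlin, h2) => e.
have [i hi] : exists i, cf i v != 0.
  apply/existsP; apply: contraNT v0 => /existsPn h; apply/eqP; apply: cfP => i; rewrite cf0.
  by apply/eqP; rewrite -[_ == _]negbK.
have := congr1 (cf i) e; rewrite !cfE => {}e.
apply: (mulIf hi); set X := cf i v in e *; set Y := cf i (A *m v) in e *.
apply/eqP; rewrite -subr_eq0; apply/eqP.
transitivity ((m + m^-1) * ((m + m^-1) * Y) - ((q ^+ 2 + q ^- 2) * ((m + m^-1) * ((m * q ^+ 2 + (m * q ^+ 2)^-1) * Y + k * X)) -
   ((m * q ^+ 2 + (m * q ^+ 2)^-1) * ((m * q ^+ 2 + (m * q ^+ 2)^-1) * Y + k * X) + k * ((m + m^-1) * X)) -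
   (q ^+ 2 - q ^- 2) ^+ 2 * Y - (q - q^-1) ^+ 2 * c * ((m + m^-1) * X) +
   (q ^+ 2 - q ^- 2) * (q - q^-1) * a * X)).
  by field; nz.
by rewrite -e subrr.
Qed.

(** [exists_quad] prescribes mu, beta, gamma and kappa. The value of alpha is then forced:
    [kappa_unique] and [kappa_alpha] express it in the same way through the other data. *)
Lemma smv_exists n (A B C : 'M[F]_n) (a b c m k : F) (v : 'cV[F]_n) : srel q A B C a b c -> v != 0 -> m != 0 ->
  B *m v = (m + m^-1) *: v -> B *m (A *m v) = (m * q ^+ 2 + (m * q ^+ 2)^-1) *: (A *m v) + k *: v ->
  exists x, [/\ nzq x, mu x = m, kappa q x = k, smv q A B x v & [/\ alpha q x = a, beta q x = b & gamma q x = c]].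
Proof.
move=> sr v0 m0 h1 h2; have r2 := srel_ABB q0 q4 sr.
have := kappa_unique m0 r2 v0 h1 h2.
have [x nx [xm xb xg xk]] := exists_quad q0 q4 b c k m0.
have := kappa_alpha q0 nx; rewrite !tB_mu // xm xg xk expr1n mulr1 exprVn => -> /(mulfI _) e.
exists x; split=> //; first by rewrite /smv !tB_mu // xm xk expr1n mulr1.
split=> //; have qq : q + q^-1 != 0.
  have -> : q + q^-1 = (q ^+ 2 + 1) / q by field; nz.
  by rewrite mulf_neq0 ?invr_eq0.
apply: (mulfI qq); apply: (@addIr _ (- (c * (m + m^-1)))); apply: e.
rewrite expf_eq0 /= ; have -> : q - q^-1 = (q ^+ 2 - 1) / q by field; nz.
by rewrite mulf_neq0 ?invr_eq0.
Qed.

End Chain.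

(** * Coordinates in W *)

Section Coord.
Variables (F : closedFieldType) (q : F) (d : nat).
Hypothesis hq : d.-primitive_root q.
Hypothesis hd : d \notin [:: 1%N; 2%N; 4%N].
Local Notation p := (dprime d).
Local Notation WA := (@WA F q d).
Local Notation WB := (@WB F q d).
Local Notation ev := (@ev F d).
Let q0 := root_q0 hq.
Let q4 := root_q4 hq hd.
Let p0 := dprime_gt0 hq hd.
Let q2N := q2N q4.
Let q2B := q2B q4.
Let q4B := q4B q4.
Implicit Types (x y z : quint F) (u v w : 'cV[F]_p).

(** Coordinates indexed by all naturals, 0 from d' on, so that recursions may mention i + 1
    freely. *)
Definition co v (i : nat) : F := \sum_(j < p) ((j : nat) == i)%:R * v j 0.

Lemma co_ord v (j : 'I_p) : co v j = v j 0.
Proof.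
rewrite /co (bigD1 j) //= eqxx mul1r big1 ?addr0 // => k ne.
by rewrite val_eqE (negbTE ne) mul0r.
Qed.

Lemma co_ge v i : (p <= i)%N -> co v i = 0.
Proof.
move=> h; rewrite /co big1 // => j _; case: eqP => [e|_]; last by rewrite mul0r.
by move: (ltn_ord j); rewrite e ltnNge h.
Qed.

Lemma coD u v i : co (u + v) i = co u i + co v i.
Proof. by rewrite /co -big_split /=; apply: eq_bigr => j _; rewrite mxE mulrDr. Qed.
Lemma coZ a v i : co (a *: v) i = a * co v i.
Proof. by rewrite /co mulr_sumr; apply: eq_bigr => j _; rewrite mxE mulrCA. Qed.
Lemma coN v i : co (- v) i = - co v i.
Proof. by rewrite -scaleN1r coZ mulN1r. Qed.
Lemma co0 i : co 0 i = 0.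
Proof. by rewrite -(scale0r (0 : 'cV[F]_p)) coZ mul0r. Qed.
Definition coE := (coD, coZ, coN, co0).

Lemma co_ext u v : (forall i, (i < p)%N -> co u i = co v i) -> u = v.
Proof. by move=> h; apply/colP => j; rewrite -!co_ord h. Qed.

Lemma co_eq0 v : (forall i, (i < p)%N -> co v i = 0) -> v = 0.
Proof. by move=> h; apply: co_ext => i hi; rewrite co0 h. Qed.

Lemma co_ev i j : (j < p)%N -> co (ev i) j = (j == i)%:R.
Proof. by move=> h; rewrite -[j]/(nat_of_ord (Ordinal h)) co_ord mxE. Qed.

Lemma co_WB x v i : nzq x.1 -> (i < p)%N ->
  co (WB x *m v) i = tB x.1 (q ^+ i) * co v i + ph q x.1 (q ^+ i.+1) * co v i.+1.
Proof.
move=> nx hi; rewrite -[i]/(nat_of_ord (Ordinal hi)) co_ord mxE /co !mulr_sumr -big_split /=.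
apply: eq_bigr => j _; rewrite mxE thetasE (phiE hq) //= -val_eqE /=.
rewrite mulrDl; congr (_ + _).
  by rewrite eq_sym; case: eqP => [->|]; rewrite ?mul0r ?mulr0 // !mul1r.
by rewrite eq_sym; case: eqP => [->|]; rewrite ?mul0r ?mulr0 // !mul1r.
Qed.

Lemma co_WA x v i : (i < p)%N ->
  co (WA x *m v) i = tA x.1 (q ^+ i) * co v i + (if i is j.+1 then co v j else x.2 * co v p.-1).
Proof.
move=> hi; rewrite -[X in co _ X]/(nat_of_ord (Ordinal hi)) co_ord mxE.
have -> : (if i is j.+1 then co v j else x.2 * co v p.-1) =
   \sum_(j < p) ((i == j.+1)%:R + ((nat_of_ord j == p.-1) && (i == 0%N))%:R * x.2) * v j 0.
  case: i hi => [|i] hi; rewrite /co ?mulr_sumr; apply: eq_bigr => j _.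
    by rewrite andbT add0r mulrCA mulrA.
  by rewrite andbF mul0r addr0 eqSS eq_sym.
rewrite /co mulr_sumr -big_split /=.
apply: eq_bigr => j _; rewrite mxE thetaE /= -val_eqE /= -addrA mulrDl; congr (_ + _).
by rewrite eq_sym; case: eqP => [->|]; rewrite ?mul0r ?mulr0 // !mul1r.
Qed.

Lemma tB_S (x : quad F) i : tB x (q ^+ (p + i)) = tB x (q ^+ i).
Proof. by rewrite -(tB_mod hq hd) modnDl (tB_mod hq hd). Qed.

Lemma ph_p (x : quad F) : nzq x -> ph q x (q ^+ p) = 0.
Proof. by move=> nx; rewrite -(ph_mod hq hd) // modnn expr0 ph1. Qed.

Lemma tB_eq (x : quad F) (Q R : F) : nzq x -> Q != 0 -> R != 0 -> tB x Q = tB x R ->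
  Q ^+ 2 = R ^+ 2 \/ mu x ^+ 2 * Q ^+ 2 * R ^+ 2 = 1.
Proof.
move=> nx Q0 R0; rewrite !tB_mu //; have m0 := mu_neq0 nx; move: (mu x) m0 => m m0 h.
have : (Q ^+ 2 - R ^+ 2) * (m ^+ 2 * Q ^+ 2 * R ^+ 2 - 1) = 0.
  transitivity (m * Q ^+ 2 * R ^+ 2 * ((m * Q ^+ 2 + (m * Q ^+ 2)^-1) - (m * R ^+ 2 + (m * R ^+ 2)^-1))).
    by field; nz.
  by rewrite h subrr mulr0.
by move=> /eqP; rewrite mulf_eq0 !subr_eq0 => /orP [/eqP ->|/eqP ->]; [left|right].
Qed.

Lemma q2X_eq i j : (i < p)%N -> (j < p)%N -> (q ^+ i) ^+ 2 = (q ^+ j) ^+ 2 -> i = j.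
Proof.
by move=> hi hj; rewrite -!exprM !(mulnC _ 2) => /eqP; rewrite (q2_eq hq hd) !modn_small // => /eqP.
Qed.

Lemma q2X_eq1 i : (q ^+ i) ^+ 2 = 1 -> (p %| i)%N.
Proof. by rewrite -exprM mulnC => /eqP; rewrite (q2_eq1 hq). Qed.

(* In the m_0-coordinate of B A v = theta*_(r+1) A v + k v the coefficient of [co v 0] is the left-hand side. *)
Lemma bracketC (x : quad F) (Q : F) : nzq x -> Q != 0 -> mu x ^+ 2 * Q ^+ 2 = q ^+ 2 ->
  tB x Q - tB x (Q / q) != 0 ->
  (tB x 1 - tB x (q * Q)) * tA x 1 + ph q x q + tA x q * (tB x Q - tB x 1)
   - ((tB x Q - tB x (q * Q)) * (tA x Q + ph q x Q / (tB x Q - tB x (Q / q))) + ph q x (q * Q))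
  = (q ^+ 2 - q ^- 2) * ps q x 1.
Proof.
case: x => a b c l [] /= a0 b0 c0 l0 Q0 hm.
have : b = l * q / Q \/ b = - (l * q / Q).
  have /eqP : b ^+ 2 = (l * q / Q) ^+ 2.
    rewrite !exprMn -hm /mu /=; field; nz.
  by rewrite eqf_sqr => /orP [/eqP|/eqP]; [left|right].
rewrite /tB /tA /ph /ps /=.
case=> -> h.
  have h' : Q ^+ 2 - 1 != 0.
    apply: contra h => /eqP e; apply/eqP.
    transitivity ((q ^+ 2 - 1) * (Q ^+ 2 - 1) / (q * Q)); first by field; nz.
    by rewrite e mulr0 mul0r.
  have -> : l * q / Q / l * Q ^+ 2 + l / (l * q / Q) / Q ^+ 2 -
     (l * q / Q / l * (Q / q) ^+ 2 + l / (l * q / Q) / (Q / q) ^+ 2) = (q ^+ 2 - 1) * (Q ^+ 2 - 1) / (q * Q).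
    by field; nz.
  by field; nz.
have h' : Q ^+ 2 - 1 != 0.
  apply: contra h => /eqP e; apply/eqP.
  transitivity (- ((q ^+ 2 - 1) * (Q ^+ 2 - 1) / (q * Q))); first by field; nz.
  by rewrite e mulr0 mul0r oppr0.
have -> : - (l * q / Q) / l * Q ^+ 2 + l / - (l * q / Q) / Q ^+ 2 -
   (- (l * q / Q) / l * (Q / q) ^+ 2 + l / - (l * q / Q) / (Q / q) ^+ 2) = - ((q ^+ 2 - 1) * (Q ^+ 2 - 1) / (q * Q)).
  by field; nz.
by field; nz.
Qed.

End Coord.

(** * Marginal vectors of weight q^2 / mu *)

Section DualWeight.
Variables (F : closedFieldType) (q : F) (d : nat).
Hypothesis hq : d.-primitive_root q.
Hypothesis hd : d \notin [:: 1%N; 2%N; 4%N].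
Local Notation p := (dprime d).
Local Notation WA := (@WA F q d).
Local Notation WB := (@WB F q d).
Let q0 := root_q0 hq.
Let q4 := root_q4 hq hd.
Let p0 := dprime_gt0 hq hd.
Let q2N := q2N q4.
Let q2B := q2B q4.
Let q4B := q4B q4.
Implicit Types (x y z : quint F) (u v w : 'cV[F]_p).

Lemma ph_eq0 (x : quad F) i : (0 < i < p)%N -> (ph q x (q ^+ i) == 0) = (ps q x (q ^+ i) == 0).
Proof.
case/andP=> i0 ip; rewrite /ph mulf_eq0 orb_idl //.
have qi : q ^+ i != 0 by rewrite expf_neq0.
rewrite subr_eq0 => /eqP e; have : (p %| i)%N.
  by apply: (q2X_eq1 hq); rewrite expr2 {1}e mulVf.
by move/(dvdn_leq i0); rewrite leqNgt ip.
Qed.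

Lemma eig_rec x v i j : nzq x.1 -> WB x *m v = tB x.1 (q ^+ i) *: v -> (j < p)%N ->
  (tB x.1 (q ^+ i) - tB x.1 (q ^+ j)) * co v j = ph q x.1 (q ^+ j.+1) * co v j.+1.
Proof.
move=> nx h hj; have := congr1 (fun t => co t j) h; rewrite (co_WB hq) // coZ mulrBl => <-.
by rewrite addrAC subrr add0r.
Qed.

(** Since phi_s = 0, the coordinates below s satisfy a closed triangular homogeneous system with
    diagonal entries theta*_i - theta*_j. *)
Lemma eig_zero_below x v i s : nzq x.1 -> WB x *m v = tB x.1 (q ^+ i) *: v -> (0 < s <= p)%N ->
  ph q x.1 (q ^+ s) = 0 -> (forall j, (j < s)%N -> tB x.1 (q ^+ i) != tB x.1 (q ^+ j)) ->
  forall j, (j < s)%N -> co v j = 0.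
Proof.
move=> nx h /andP [s0 sp] hs hne.
have H k : (k < s)%N -> co v (s.-1 - k) = 0.
  elim: k => [|k ih] hk.
    have hj : (s.-1 < s)%N by rewrite prednK.
    have := eig_rec nx h (leq_trans hj sp); rewrite prednK // hs mul0r subn0 => /eqP.
    by rewrite mulf_eq0 subr_eq0 (negbTE (hne _ hj)) => /eqP.
  have hj : (s.-1 - k.+1 < s)%N by rewrite -{2}(prednK s0) ltnS leq_subr.
  have := eig_rec nx h (leq_trans hj sp).
  have -> : (s.-1 - k.+1).+1 = (s.-1 - k)%N by rewrite subnSK // -ltnS prednK.
  rewrite ih ?(ltnW hk) // mulr0 => /eqP.
  by rewrite mulf_eq0 subr_eq0 (negbTE (hne _ hj)) => /eqP.
move=> j hj; have := H (s.-1 - j)%N; rewrite subKn; last by rewrite -ltnS prednK.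
by apply; apply: (leq_ltn_trans (leq_subr _ _)); rewrite prednK.
Qed.

(** The hypothesis reads mu q^(2r) = q^2 / mu; a coincidence of theta*_r with theta*_j, j < r, would
    then give q^(2(j+1)) = 1. *)
Lemma thetas_neq_below (x : quad F) r : nzq x -> (0 < r < p)%N -> mu x ^+ 2 * (q ^+ r) ^+ 2 = q ^+ 2 ->
  forall j, (j < r)%N -> tB x (q ^+ r) != tB x (q ^+ j).
Proof.
move=> nx /andP [r0 rp] hm j hj; apply/eqP => /(tB_eq nx (expf_neq0 _ q0) (expf_neq0 _ q0)) [].
  by move/(q2X_eq hq hd rp (ltn_trans hj rp)) => e; move: hj; rewrite e ltnn.
rewrite hm -exprMn -exprS => /(q2X_eq1 hq) /(dvdn_leq (ltn0Sn j)).
by rewrite leqNgt (leq_ltn_trans hj rp).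
Qed.

(** The m_r-coordinate of the second equation yields k. The m_0-coordinate then becomes [bracketC]
    times [co v 0], which is nonzero: going down from r, the recursion multiplies by the nonzero
    phi_r, ..., phi_1. *)
Lemma ps1_eq0_of_weight x v r k : nzq x.1 -> (0 < r < p)%N -> mu x.1 ^+ 2 * (q ^+ r) ^+ 2 = q ^+ 2 ->
  co v r = 1 -> (forall j, (r < j)%N -> co v j = 0) ->
  WB x *m v = tB x.1 (q ^+ r) *: v ->
  WB x *m (WA x *m v) = tB x.1 (q ^+ r.+1) *: (WA x *m v) + k *: v ->
  (forall s, (0 < s <= r)%N -> ps q x.1 (q ^+ s) != 0) -> ps q x.1 1 = 0.
Proof.
move=> nx rr hm v1 vgt hB hBA hps; case/andP: (rr) => r0 rp.
have hne := thetas_neq_below nx rr hm.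
have hph s : (0 < s <= r)%N -> ph q x.1 (q ^+ s) != 0.
  case/andP=> s0 sr; rewrite ph_eq0 ?hps ?s0 ?sr //=; exact: leq_ltn_trans sr rp.
have v0 : co v 0 != 0.
  have H j : (j <= r)%N -> co v (r - j) != 0.
    elim: j => [|j ih] hj; first by rewrite subn0 v1 oner_neq0.
    have hlt : (r - j.+1 < r)%N by rewrite ltn_subrL r0.
    have := eig_rec nx hB (ltn_trans hlt rp); rewrite subnSK // => e.
    have : ph q x.1 (q ^+ (r - j)) * co v (r - j) != 0.
      by rewrite mulf_neq0 ?ih ?hph ?(ltnW hj) // subn_gt0 hj leq_subr.
    by rewrite -e mulf_eq0 negb_or => /andP [].
  by rewrite -(subnn r); apply: H.
have e1 := eig_rec nx hB p0; rewrite expr0 expr1 in e1.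
have r1p : (r.-1 < p)%N by apply: leq_ltn_trans rp; apply: leq_pred.
have e2 := eig_rec nx hB r1p; rewrite prednK // v1 mulr1 in e2.
have h1p : (1 < p)%N by apply: leq_trans (dprime_gt2 hq hd).
have c0 := congr1 (fun t => co t 0%N) hBA; have cr := congr1 (fun t => co t r) hBA.
rewrite coD !coZ (co_WB hq _ nx p0) (co_WA _ _ _ p0) (co_WA _ _ _ h1p) in c0.
rewrite coD !coZ (co_WB hq _ nx rp) (co_WA _ _ _ rp) in cr.
(* The wrap-around term: for r < d' - 1 the last coordinate of [v] is 0, and for r = d' - 1 the two
   values of theta* agree. *)
have vp : (tB x.1 1 - tB x.1 (q ^+ r.+1)) * (x.2 * co v p.-1) = 0.
  have := rp; rewrite leq_eqVlt => /orP [/eqP e|h].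
    by rewrite e -(addn0 p) (tB_S hq hd) expr0 subrr mul0r.
  by rewrite vgt ?mulr0 // -ltnS prednK.
rewrite expr0 expr1 in c0.
have qr0 : q ^+ r != 0 by rewrite expf_neq0.
have hd0 : tB x.1 (q ^+ r) - tB x.1 (q ^+ r / q) != 0.
  have -> : q ^+ r / q = q ^+ r.-1 by rewrite -{1}(prednK r0) exprSr mulfK.
  by rewrite subr_eq0; apply: hne; rewrite prednK.
have hr1 : q ^+ r / q = q ^+ r.-1 by rewrite -{1}(prednK r0) exprSr mulfK.
have hbr := bracketC hq hd nx qr0 hm hd0.
apply/eqP; have : (q ^+ 2 - q ^- 2) * ps q x.1 1 = 0.
  rewrite -hbr hr1.
  have hv1 : co v r.-1 = ph q x.1 (q ^+ r) / (tB x.1 (q ^+ r) - tB x.1 (q ^+ r.-1)).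
    by rewrite -e2 mulrC mulKf // -hr1.
  rewrite -hv1 -!exprS.
  have hk : k = (tB x.1 (q ^+ r) - tB x.1 (q ^+ r.+1)) * (tA x.1 (q ^+ r) + co v r.-1) + ph q x.1 (q ^+ r.+1).
    have cr' : (if r is j.+1 then co v j else x.2 * co v p.-1) = co v r.-1 by case: (r) r0.
    move: cr; rewrite cr' v1.
    have -> : ph q x.1 (q ^+ r.+1) * co (WA x *m v) r.+1 = ph q x.1 (q ^+ r.+1).
      have := rp; rewrite leq_eqVlt => /orP [/eqP e|h].
        by rewrite e (ph_p hq hd) // mul0r.
      by rewrite co_WA // vgt // v1 mulr0 add0r mulr1.
    move=> cr; apply: (@addIr _ (tB x.1 (q ^+ r.+1) * (tA x.1 (q ^+ r) * 1 + co v r.-1))).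
    rewrite mulr1 in cr *; rewrite addrC -[k in LHS]mulr1 -cr; ring.
  rewrite -hk; apply: (mulfI v0); rewrite mulr0.
  transitivity ((tB x.1 1 * (tA x.1 1 * co v 0 + x.2 * co v p.-1) + ph q x.1 q * (tA x.1 q * co v 1 + co v 0))
     - (tB x.1 (q ^+ r.+1) * (tA x.1 1 * co v 0 + x.2 * co v p.-1) + k * co v 0)
     - (tB x.1 1 - tB x.1 (q ^+ r.+1)) * (x.2 * co v p.-1)
     + tA x.1 q * ((tB x.1 (q ^+ r) - tB x.1 1) * co v 0 - ph q x.1 q * co v 1)).
    by ring.
  by rewrite e1 c0 vp; ring.
have -> : q ^+ 2 - q ^- 2 = (q ^+ 4 - 1) / q ^+ 2 by field; nz.
move=> /eqP; rewrite mulf_eq0 => /orP [|//].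
by rewrite mulf_eq0 (negbTE q4B) invr_eq0 expf_eq0 (negbTE q0).
Qed.

End DualWeight.

(** * The Casimir value and the possible weights *)

Section Casimir.
Variables (F : closedFieldType) (q : F) (d : nat).
Hypothesis hq : d.-primitive_root q.
Hypothesis hd : d \notin [:: 1%N; 2%N; 4%N].
Local Notation p := (dprime d).
Local Notation approx := (@approx F q).
Local Notation WA := (@WA F q d).
Local Notation WB := (@WB F q d).
Local Notation WC := (@WC F q d).
Local Notation mvec := (@mvec F d).
Local Notation ev := (@ev F d).
Let q0 := root_q0 hq.
Let q4 := root_q4 hq hd.
Let p0 := dprime_gt0 hq hd.
Let q2N := q2N q4.
Let q2B := q2B q4.
Let q4B := q4B q4.
Implicit Types (x y z : quint F) (u v w : 'cV[F]_p).

Definition move_ii (x : quad F) := Quad F (qa x)^-1 (qb x) (qc x) ((ql x)^-1 * q ^- 2).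
Definition dual_quad (x : quad F) := Quad F (qc x) (ql x * q)^-1 (qa x) (qb x * q)^-1.

Lemma nzq_ii (x : quad F) : nzq x -> nzq (move_ii x).
Proof. by case=> *; split; rewrite /=; nz. Qed.
Lemma nzq_tild (x : quad F) : nzq x -> nzq (dual_quad x).
Proof. by case=> *; split; rewrite /=; nz. Qed.
Lemma mu_ii (x : quad F) : nzq x -> mu (move_ii x) = qb x * ql x * q ^+ 2.
Proof. by case=> *; rewrite /mu /=; field; nz. Qed.
Lemma inv_ii (x : quad F) : nzq x -> [/\ alpha q (move_ii x) = alpha q x, beta q (move_ii x) = beta q x,
  gamma q (move_ii x) = gamma q x & omega q (move_ii x) = omega q x].
Proof. by case=> *; rewrite /alpha /beta /gamma /omega /=; split; field; nz. Qed.

(** For Q = q^i the hypothesis makes phi_i vanish, so m_i is itself a marginal vector; its data are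
    those of [move_ii x]. *)
Lemma kappa_ii (x : quad F) Q : nzq x -> Q != 0 -> ql x ^+ 2 * q ^+ 2 = Q ^+ 2 ->
  [/\ tB x Q = tB (move_ii x) 1, tB x (q * Q) = tB (move_ii x) q &
   ph q x (q * Q) + tA x Q * (tB x Q - tB x (q * Q)) = kappa q (move_ii x)].
Proof.
case: x => a b c l [] /= a0 b0 c0 l0 Q0 h.
have hb Q' : Q' != 0 -> ph q (Quad F a b c l) Q' = a^-1 * b^-1 * l * q * (Q' ^+ 2 - 1) *
  ((q * l)^-1 - l * q / Q' ^+ 2) * (1 - a * b * c / l * Q' ^+ 2 / q) *
  (1 / Q' ^+ 2 - a * b / c / l / q).
  by move=> Q0'; rewrite /ph /ps /=; field; nz.
have qQ : q * Q != 0 by rewrite mulf_neq0.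
rewrite /kappa !hb // /tA /tB /= exprMn -h.
rewrite /ph /ps /=; split; field; nz.
Qed.

Lemma W_casimir x v : nzq x.1 ->
  casimir q (WA x) (WB x) (WC x) (alpha q x.1) (beta q x.1) (gamma q x.1) *m v = ((q + q^-1) ^+ 2 - omega q x.1) *: v.
Proof.
move=> nx; have sr := W_srel hq hd nx.
have hM i : casimir q (WA x) (WB x) (WC x) (alpha q x.1) (beta q x.1) (gamma q x.1) *m mvec x i = ((q + q^-1) ^+ 2 - omega q x.1) *: mvec x i.
  elim: i => [|i ih].
    by rewrite (mvec_lt x p0); apply: casimir_smv => //; apply: W_smv.
  have -> : mvec x i.+1 = WA x *m mvec x i + (- tA x.1 (q ^+ i)) *: mvec x i.
    by rewrite (mvec_A hq hd) scaleNr addrK.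
  rewrite mulmxDr (casimir_A q0 q4 _ sr) ih [casimir _ _ _ _ _ _ _ *m (_ *: _)]mulmxZ ih mulmxZ scalerDr !scalerA.
  by rewrite (mulrC (- _)).
move: (casimir _ _ _ _ _ _ _) hM => O hM; rewrite (ev_sum v) mulmx_sumr scaler_sumr.
apply: eq_bigr => j _; rewrite mulmxZ -(mvec_lt x (ltn_ord j)) hM !scalerA.
by congr (_ *: _); rewrite mulrC.
Qed.

Lemma omega_eq x X u : nzq x.1 -> nzq X -> alpha q X = alpha q x.1 -> beta q X = beta q x.1 -> gamma q X = gamma q x.1 ->
  smv q (WA x) (WB x) X u -> u != 0 -> omega q X = omega q x.1.
Proof.
move=> nx nX ea eb eg hu u0; have sr := W_srel hq hd nx.
have := W_casimir u nx; rewrite -ea -eb -eg in sr *.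
rewrite (casimir_smv q0 q4 nX sr hu) => /eqP; rewrite -subr_eq0 -scalerBl scaler_eq0 (negbTE u0) orbF.
rewrite subr_eq0 => /eqP e; apply: oppr_inj; exact: (@addrI _ ((q + q^-1) ^+ 2)).
Qed.

Lemma sum_inv_eq (s t : F) : s != 0 -> t != 0 -> s + s^-1 = t + t^-1 -> s = t \/ s = t^-1.
Proof.
move=> s0 t0 h; have : (s - t) * (s - t^-1) = 0.
  transitivity (s * ((s + s^-1) - (t + t^-1))); first by field; nz.
  by rewrite h subrr mulr0.
by move=> /eqP; rewrite mulf_eq0 !subr_eq0 => /orP [/eqP|/eqP]; [left|right].
Qed.

(** In the y's of [x] the roots of [quartic] are nu^2 + nu^-2 and the three sums y_i y_j + y_k y_l,
    the roots of the resolvent cubic. Hence mu_X / q is nu^2, nu^-2 or a product of two y's. *)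
Lemma quartic_cases (X x : quad F) : nzq X -> nzq x -> alpha q X = alpha q x -> beta q X = beta q x ->
  gamma q X = gamma q x -> omega q X = omega q x ->
  [\/ mu X = mu x, mu X = q ^+ 2 / mu x |
   exists z : quad F, [/\ nzq z, approx x z & qb z * ql z * q = mu X / q]].
Proof.
move=> nX nx ea eb eg eo.
have mX := mu_neq0 nX; have mx := mu_neq0 nx.
have := quartic q0 (mu X / q + q / mu X) nX; rewrite ea eb eg eo (quartic q0 _ nx).
have -> : qb X / (ql X * q) + ql X * q / qb X = mu X / q + q / mu X.
  by case: nX => *; rewrite /mu; field; nz.
rewrite subrr !mul0r => /eqP; rewrite !mulf_eq0 !subr_eq0.
have qi : q / mu X = (mu X / q)^-1 by field; nz.
have m1 : mu X / q != 0 by rewrite mulf_neq0 ?invr_eq0.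
have [a0 b0 c0 l0] := nx.
case/orP => [/orP [/orP [/eqP h|/eqP h]|/eqP h]|/eqP h]; rewrite qi in h.
- have h' : mu X / q + (mu X / q)^-1 = mu x / q + (mu x / q)^-1.
    by rewrite h /mu; field; nz.
  have m2 : mu x / q != 0 by rewrite mulf_neq0 ?invr_eq0.
  have [e|e] := sum_inv_eq m1 m2 h'.
    by apply: Or31; apply: (mulIf _ e); rewrite invr_eq0.
  apply: Or32; rewrite -[LHS](divfK q0) e; field; nz.
- apply: Or33; apply: sextic => //.
  have m2 : qb x * ql x * q != 0 by rewrite !mulf_neq0.
  by have [e|e] := sum_inv_eq m1 m2 h; [apply: Or31|apply: Or32].
- apply: Or33; apply: sextic => //.
  have m2 : qa x * qc x != 0 by rewrite mulf_neq0.
  by have [e|e] := sum_inv_eq m1 m2 h; apply: Or33; [apply: Or41|apply: Or42].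
- apply: Or33; apply: sextic => //.
  have m2 : qa x / qc x != 0 by rewrite mulf_neq0 ?invr_eq0.
  rewrite -(invf_div (qa x)) in h.
  by have [e|e] := sum_inv_eq m1 m2 h; apply: Or33; [apply: Or43|apply: Or44; rewrite e invf_div].
Qed.

Lemma approx_data x z : approx x.1 z.1 -> dinv F d x = dinv F d z -> nzq x.1 ->
  nzq z.1 /\ hasdata q d (WA z) (WB z) (WC z) x /\ smv q (WA z) (WB z) x.1 (ev 0).
Proof.
move=> xz ed nx; have nz' := approx_nz xz nx; split=> //.
have [em eb eg ek] := approx_inv q0 xz.
have hx := kappa_alpha q0 nx; have hz := kappa_alpha q0 nz'.
have ea : alpha q x.1 = alpha q z.1.
  have qq : (q - q^-1) ^+ 2 * (q + q^-1) != 0.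
    have -> : (q - q^-1) ^+ 2 * (q + q^-1) = (q ^+ 2 - 1) ^+ 2 * (q ^+ 2 + 1) / q ^+ 3 by field; nz.
    by nz.
  apply: (mulfI qq); move: hx hz; rewrite !tB_mu // em eg ek => -> /eqP.
  rewrite !mulrBr => /eqP /addIr; by rewrite !mulrA.
have [h1 h2] := W_hasdata hq hd nz'.
split; first by apply: (hasdata_eq hq hd nz' nx) (W_hasdata hq hd nz').
by apply: (smv_eq nz' nx) (W_smv hq hd nz').
Qed.

(** [move_ii] inverts a and lambda q; followed by [move_iii], only an inversion of b remains.
    [dual_quad] puts (lambda q)^-1 in the place of b and b^-1 in the place of lambda q, so that
    inversion is again a [move_ii] up to S_4. *)
Lemma approx_iii_ii (z : quad F) : nzq z -> approx (move_iii q (move_ii z)) (move_ii (dual_quad z)).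
Proof.
move=> nz'; have n1 := nzq_ii (nzq_tild nz'); apply: approx_sym.
apply: approx_trans (approx_tilde q0 q4 n1) _.
apply: rst_step; split; first by apply: nzq_tild.
split; first by apply: nzq_iii q0 _ (nzq_ii nz').
apply: Or42; case: z nz' {n1} => a b c l [] /= *; rewrite /move_iii /=.
by congr Quad; field; nz.
Qed.

Lemma co_chain x (z : quint F) i : (i < p)%N ->
  co (chain q (WA z) x.1 (ev 0) i) i = 1 /\ forall j, (i < j)%N -> co (chain q (WA z) x.1 (ev 0) i) j = 0.
Proof.
elim: i => [|i ih] hi.
  split; first by rewrite co_ev.
  move=> j hj; have [h|h] := ltnP j p; last by rewrite co_ge.
  by rewrite /= co_ev // eqn0Ngt hj.
have [ih1 ih2] := ih (ltnW hi).
split=> [|j hj] /=.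
  by rewrite !coE co_WA // ih2 // mulr0 add0r ih1 mulr0 subr0.
have [h|h] := ltnP j p; last by rewrite co_ge.
rewrite !coE co_WA // (ih2 j (ltnW hj)) !mulr0 subr0 add0r.
by case: j hj {h} => // j hj; rewrite ih2.
Qed.

(** The isomorphism sends m_i to a monic polynomial of degree i in A applied to m_0, so it is
    unitriangular and keeps the top coordinate of a vector. *)
Lemma iso_tri x z : nzq x.1 -> approx x.1 z.1 -> dinv F d x = dinv F d z ->
  exists2 Q : 'M[F]_p, Q \in unitmx & [/\ Q *m WA x = WA z *m Q, Q *m WB x = WB z *m Q, Q *m WC x = WC z *m Q &
    forall v i, (forall j, (i < j)%N -> co v j = 0) -> co (Q *m v) i = co v i].
Proof.
move=> nx xz ed; have [nz' [hda hs]] := approx_data xz ed nx.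
have [Q uQ [QA QB QC Qev]] := verma_iso hq hd nx hda hs (W_generates hq hd nz').
exists Q => //; split=> // v i hv.
have [hi|hi] := ltnP i p; last by rewrite !co_ge.
rewrite {1}(ev_sum v) mulmx_sumr.
have -> : forall (f : 'I_p -> 'cV[F]_p), co (\sum_(j < p) f j) i = \sum_(j < p) co (f j) i.
  move=> f; rewrite -[i]/(nat_of_ord (Ordinal hi)) co_ord summxE.
  by apply: eq_bigr => j _; rewrite co_ord.
rewrite (bigD1 (Ordinal hi)) //= big1 ?addr0.
  by rewrite mulmxZ Qev // coZ -co_ord; have [-> _] := co_chain x z hi; rewrite mulr1.
move=> j; rewrite -val_eqE /= => ne; rewrite mulmxZ Qev // coZ -co_ord.
have [lt|gt|e] := ltngtP j i; last by rewrite e eqxx in ne.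
  by have [_ ->] := co_chain x z (ltn_ord j); rewrite // mulr0.
by rewrite hv // mul0r.
Qed.

Lemma iso_pmS4 x z : simeq_pmS4 F q d x z -> mod_iso (WA x) (WB x) (WC x) (WA z) (WB z) (WC z).
Proof.
case=> nx [_ [xz ed]]; have [nz' [hda hs]] := approx_data xz ed nx.
exact: (mx_iso_of hq hd nx hda hs (W_generates hq hd nz')).
Qed.

Lemma pm_lift x (z : quad F) : nzq x.1 -> approx x.1 z -> exists dz, simeq_pmS4 F q d x (z, dz) /\ simeq_pmS4 F q d (z, dz) x.
Proof.
move=> nx xz; have nz' := approx_nz xz nx.
exists (dinv F d x - (qa z ^+ p / ql z ^+ p + ql z ^+ p / qa z ^+ p)).
have e : dinv F d x = dinv F d (z, dinv F d x - (qa z ^+ p / ql z ^+ p + ql z ^+ p / qa z ^+ p)).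
  by move: (dinv F d x) => D; case: z xz nz' => a b c l _ _ /=; rewrite -addrA subrK.
split; split=> //; split=> //; split=> //; exact: rst_sym.
Qed.

End Casimir.

(** * Vectors of smallest degree in a submodule *)

Section TopVectors.
Variables (F : closedFieldType) (q : F) (d : nat).
Hypothesis hq : d.-primitive_root q.
Hypothesis hd : d \notin [:: 1%N; 2%N; 4%N].
Local Notation p := (dprime d).
Local Notation approx := (@approx F q).
Local Notation WA := (@WA F q d).
Local Notation WB := (@WB F q d).
Local Notation WC := (@WC F q d).
Local Notation mvec := (@mvec F d).
Let q0 := root_q0 hq.
Let q4 := root_q4 hq hd.
Let p0 := dprime_gt0 hq hd.
Let q2N := q2N q4.
Let q2B := q2B q4.
Let q4B := q4B q4.
Implicit Types (x y z : quint F) (u v w : 'cV[F]_p).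

(* [u] is a vector of smallest top index [i] in the submodule [U], so [u] is a marginal vector. *)
Definition mintop x i (k : F) u (U : 'M[F]_p) :=
  [/\ inv_space (WA x) (WB x) (WC x) U, inV U u, co u i = 1 /\ (forall j, (i < j)%N -> co u j = 0),
      forall w, inV U w -> (forall j, (i <= j)%N -> co w j = 0) -> w = 0 &
      WB x *m u = tB x.1 (q ^+ i) *: u /\
      WB x *m (WA x *m u) = tB x.1 (q ^+ i.+1) *: (WA x *m u) + k *: u].

(** B u - theta*_i u, and B A u - theta*_(i+1) A u after removal of its m_i-term by a multiple of u,
    lie in [U] with degree below i; minimality makes both vanish. *)
Lemma mintop_make x i u U : nzq x.1 -> (i < p)%N -> inv_space (WA x) (WB x) (WC x) U -> inV U u ->
  co u i = 1 -> (forall j, (i < j)%N -> co u j = 0) ->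
  (forall w, inV U w -> (forall j, (i <= j)%N -> co w j = 0) -> w = 0) -> exists k, mintop x i k u U.
Proof.
move=> nx hi hU hu u1 ugt hmin; have [hA hB hC] := hU.
have e1 : WB x *m u = tB x.1 (q ^+ i) *: u.
  apply/eqP; rewrite -subr_eq0; apply/eqP; apply: hmin.
    by apply: inV_B; [apply: inV_A|apply: inV_Z].
  move=> j hj; have [h|h] := ltnP j p; last by rewrite co_ge.
  rewrite !coE (co_WB hq) // (ugt j.+1) // mulr0 addr0.
  move: hj; rewrite leq_eqVlt => /orP [/eqP <-|hj]; first by rewrite subrr.
  by rewrite ugt // !mulr0 subrr.
pose k := co (WB x *m (WA x *m u) - tB x.1 (q ^+ i.+1) *: (WA x *m u)) i.
exists k; split=> //; split=> //.
apply/eqP; rewrite -subr_eq0 opprD addrA; apply/eqP; apply: hmin.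
  have hAu : inV U (WA x *m u) by apply: inV_A.
  by apply: inV_B; [apply: inV_B; [apply: inV_A|apply: inV_Z]|apply: inV_Z].
move=> j; rewrite leq_eqVlt => /orP [/eqP <-|hj].
  by rewrite coD coN coZ u1 mulr1 subrr.
have [h|h] := ltnP j p; last by rewrite co_ge.
have hA1 j' : (i.+1 < j')%N -> co (WA x *m u) j' = 0.
  move=> hj'; have [h'|h'] := ltnP j' p; last by rewrite co_ge.
  by rewrite co_WA //; case: j' hj' {h'} => // j' hj'; rewrite !ugt ?mulr0 ?addr0 // ltnW.
rewrite !coE (co_WB hq) // (ugt j) // mulr0 subr0 (hA1 j.+1) // mulr0 addr0.
move: hj; rewrite leq_eqVlt => /orP [/eqP <-|hj]; first by rewrite subrr.
by rewrite hA1 // !mulr0 subrr.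
Qed.

(** The vectors A^t u with i + t < d' have degree i + t and m_0-coordinate 0, and by minimality they
    span [U]. Applying A to the last one produces delta in the m_0-coordinate. *)
Lemma mintop_delta x i k u U : nzq x.1 -> (0 < i < p)%N -> mintop x i k u U -> co u 0 = 0 -> x.2 = 0.
Proof.
move=> nx /andP [i0 ip] [[hA _ _] hu [u1 ugt] hmin _] u0.
pose ut t : 'cV[F]_p := iter t (mulmx (WA x)) u.
have H t : (i + t < p)%N -> [/\ inV U (ut t), co (ut t) (i + t) = 1,
    forall j, (i + t < j)%N -> co (ut t) j = 0 & co (ut t) 0 = 0].
  elim: t => [|t ih] ht; first by rewrite addn0; split.
  have ht' : (i + t < p)%N by apply: ltn_trans ht; rewrite addnS.
  have [i1 i2 i3 i4] := ih ht'; rewrite /ut /= -/(ut t); split.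
  - exact: inV_A.
  - rewrite addnS co_WA; last by rewrite -addnS.
    by rewrite i3 ?leqnn // mulr0 add0r i2.
  - move=> j hj; have [h|h] := ltnP j p; last by rewrite co_ge.
    rewrite co_WA //; rewrite addnS in hj; rewrite i3 ?(ltnW hj) // mulr0 add0r.
    by case: j hj {h} => // j hj; rewrite i3.
  - rewrite co_WA // i4 mulr0 add0r i3 ?mulr0 //.
    by rewrite -ltnS prednK // -addnS.
have hall t : (i + t <= p)%N -> forall w, inV U w -> (forall j, (i + t <= j)%N -> co w j = 0) -> co w 0 = 0.
  elim: t => [|t ih] ht w hw hj.
    by rewrite (hmin w) ?co0 // => j; rewrite -{1}(addn0 i); apply: hj.
  rewrite addnS in ht; have [i1 i2 i3 i4] := H t ht.
  have := ih (ltnW ht) (w - co w (i + t) *: ut t).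
  rewrite !coE i4 mulr0 subr0; apply.
    by apply: inV_B => //; apply: inV_Z.
  move=> j; rewrite leq_eqVlt => /orP [/eqP <-|h]; first by rewrite !coE i2 mulr1 subrr.
  by rewrite !coE i3 // mulr0 subr0 hj // addnS.
have hp : (i + (p.-1 - i) = p.-1)%N by rewrite subnKC // -ltnS prednK.
have hlt : (i + (p.-1 - i) < p)%N by rewrite hp prednK.
have [i1 i2 i3 i4] := H _ hlt.
have := hall (p - i)%N; rewrite subnKC ?(ltnW ip) // => /(_ (leqnn p) (WA x *m ut (p.-1 - i)%N)).
rewrite co_WA // i4 mulr0 add0r -[X in co _ X]hp i2 mulr1; apply.
  exact: inV_A.
by move=> j hj; rewrite co_ge.
Qed.

Lemma mintop_transport x z i k u U : nzq x.1 -> (i < p)%N -> approx x.1 z.1 -> dinv F d x = dinv F d z ->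
  mintop x i k u U -> exists u' U', mintop z i k u' U'.
Proof.
move=> nx ip xz ed [[hA hB hC] hu [u1 ugt] hmin [e1 e2]].
have nz' := approx_nz xz nx; have [em _ _ _] := approx_inv q0 xz.
have [Q uQ [QA QB QC Qco]] := iso_tri hq hd nx xz ed.
exists (Q *m u), (U *m Q^T).
have inQ w : inV U w -> inV (U *m Q^T) (Q *m w).
  by rewrite /inV trmx_mul => h; apply: submxMr.
have Qin w : inV (U *m Q^T) w -> exists2 w', inV U w' & w = Q *m w'.
  rewrite /inV => /submxP [D hD]; exists (D *m U)^T; first by rewrite trmxK submxMl.
  by apply: trmx_inj; rewrite trmx_mul trmxK hD mulmxA.
have inv1 X Y : (U *m X^T <= U)%MS -> Q *m X = Y *m Q -> (U *m Q^T *m Y^T <= U *m Q^T)%MS.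
  by move=> hX e; rewrite -mulmxA -trmx_mul -e trmx_mul mulmxA submxMr.
have Qgt v j : (forall l, (j < l)%N -> co v l = 0) -> forall l, (j < l)%N -> co (Q *m v) l = 0.
  by move=> hv l hl; rewrite Qco ?hv // => l' hl'; apply: hv; apply: ltn_trans hl'.
split.
- by split; [apply: (inv1 _ _ hA QA)|apply: (inv1 _ _ hB QB)|apply: (inv1 _ _ hC QC)].
- exact: inQ.
- by split; [rewrite Qco|apply: Qgt].
- move=> w /Qin [w' hw' ->] hj.
  rewrite (hmin w') ?mulmx0 //.
  have H l : forall j, (p - l <= j)%N -> (i <= j)%N -> co w' j = 0.
    elim: l => [|l ih] j h1 h2; first by rewrite co_ge // -(subn0 p).
    rewrite -(hj j h2) Qco // => j' hj'; apply: ih; last by apply: leq_trans (ltnW hj').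
    by rewrite leq_subLR in h1; rewrite leq_subLR; apply: leq_trans h1 _; rewrite addSnnS leq_add2l.
  by move=> j h; apply: (H p) => //; rewrite subnn.
- split.
    by rewrite mulmxA -QB -mulmxA e1 mulmxZ !tB_mu // em.
  have -> : WA z *m (Q *m u) = Q *m (WA x *m u) by rewrite !mulmxA QA.
  by rewrite mulmxA -QB -mulmxA e2 mulmxDr !mulmxZ !tB_mu // em.
Qed.

End TopVectors.

(** * W is irreducible exactly on PM *)

Section Irreducibility.
Variables (F : closedFieldType) (q : F) (d : nat).
Hypothesis hq : d.-primitive_root q.
Hypothesis hd : d \notin [:: 1%N; 2%N; 4%N].
Local Notation p := (dprime d).
Local Notation approx := (@approx F q).
Local Notation WA := (@WA F q d).
Local Notation WB := (@WB F q d).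
Local Notation WC := (@WC F q d).
Local Notation mvec := (@mvec F d).
Local Notation ev := (@ev F d).
Let q0 := root_q0 hq.
Let q4 := root_q4 hq hd.
Let p0 := dprime_gt0 hq hd.
Let q2N := q2N q4.
Let q2B := q2B q4.
Let q4B := q4B q4.
Local Notation move_ii := (@move_ii F q).
Local Notation dual_quad := (@dual_quad F q).
Local Notation inPM := (@inPM F q d).
Implicit Types (x y z : quint F) (u v w : 'cV[F]_p).

Lemma ph_zero_of (x : quad F) i : nzq x -> ql x ^+ 2 * q ^+ 2 = (q ^+ i) ^+ 2 -> ph q x (q ^+ i) = 0.
Proof.
move=> [a0 b0 c0 l0] h; have qi : q ^+ i != 0 by rewrite expf_neq0.
rewrite /ph /ps; have -> : q ^+ i / (q * ql x) - ql x * q / q ^+ i = 0.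
  transitivity (((q ^+ i) ^+ 2 - ql x ^+ 2 * q ^+ 2) / (q * ql x * q ^+ i)).
    by move: (q ^+ i) qi => Q Q0; field; nz.
  by rewrite h subrr mul0r.
by rewrite mulr0 !mul0r mulr0.
Qed.

Lemma q_even_exp i : q ^ (2 * i%:Z) = (q ^+ i) ^+ 2.
Proof.
have -> : (2 * i%:Z)%R = Posz (2 * i) by rewrite PoszM.
by rewrite -exprnP mulnC exprM.
Qed.

Lemma lam_setP (z : F) i : (i.+1 < p)%N -> z = (q ^+ i) ^+ 2 -> lam_set F q d z.
Proof.
move=> h ->; exists i; last by rewrite q_even_exp.
by rewrite leq_subRL ?(ltnW (dprime_gt2 hq hd)) // add2n.
Qed.

Lemma lam_set_elim (z : F) : lam_set F q d z -> exists2 i, (i.+1 < p)%N & z = (q ^+ i) ^+ 2.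
Proof.
case=> i hi ->; exists i; last by rewrite q_even_exp.
by move: hi; rewrite leq_subRL ?(ltnW (dprime_gt2 hq hd)) // add2n.
Qed.

Lemma PM_transport x z : inPM x -> simeq_pmS4 F q d x z -> inPM z.
Proof.
case=> nx h [_ [nz' [xz ed]]]; split=> // y [ny [_ [yz eyz]]]; apply: h.
split=> //; split=> //; split; last by rewrite eyz ed.
by apply: approx_trans yz _; apply: approx_sym.
Qed.

Lemma PM_no_zero x i : inPM x -> (0 < i < p)%N -> ql x.1 ^+ 2 * q ^+ 2 = (q ^+ i) ^+ 2 -> x.2 != 0.
Proof.
case=> nx h /andP [i0 ip] e.
have hx : simeq_pmS4 F q d x x by split=> //; split=> //; split=> //; apply: approx_refl.
have [//|hn] := h x hx.
case: hn; apply: (@lam_setP _ i.-1); first by rewrite prednK.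
apply: (@mulIf _ (q ^+ 2)); first by rewrite expf_eq0.
by rewrite e -exprMn -exprSr prednK.
Qed.

Lemma mintop_smv x i k u U : nzq x.1 -> mintop q x i k u U ->
  exists X, [/\ nzq X, mu X = mu x.1 * (q ^+ i) ^+ 2, kappa q X = k, omega q X = omega q x.1 &
    [/\ alpha q X = alpha q x.1, beta q X = beta q x.1 & gamma q X = gamma q x.1]].
Proof.
move=> nx [_ _ [u1 _] _ [e1 e2]].
have u0 : u != 0 by apply/eqP => h; move: u1; rewrite h co0 => /eqP; rewrite eq_sym oner_eq0.
have m0 : mu x.1 * (q ^+ i) ^+ 2 != 0 by rewrite mulf_neq0 ?expf_neq0 // mu_neq0.
have hS : mu x.1 * (q ^+ i.+1) ^+ 2 = mu x.1 * (q ^+ i) ^+ 2 * q ^+ 2 by rewrite (exprS q i); ring.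
rewrite !tB_mu // hS in e1 e2.
have [X [nX mX kX sX [aX bX gX]]] := smv_exists hq hd (W_srel hq hd nx) u0 m0 e1 e2.
by exists X; split=> //; apply: omega_eq sX u0.
Qed.

(* The image of m_i satisfies the same equations as [u], which forces u = m_i. *)
Lemma mintop_zero x i k u U : nzq x.1 -> (0 < i < p)%N -> mintop q x i k u U ->
  ql x.1 ^+ 2 * q ^+ 2 = (q ^+ i) ^+ 2 -> k = kappa q (move_ii x.1) -> x.2 = 0.
Proof.
move=> nx hi hm hl hk; apply: (mintop_delta hq hd nx hi hm).
have [i0 ip] := andP hi; have [_ _ [u1 ugt] _ [e1 e2]] := hm.
have qi : q ^+ i != 0 by rewrite expf_neq0.
have [_ _ kk] := kappa_ii hq nx qi hl; rewrite -exprS in kk.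
have php : ph q x.1 (q ^+ i) = 0 by apply: ph_zero_of.
pose m := mvec x i.
have m1 : WB x *m m = tB x.1 (q ^+ i) *: m.
  by rewrite /m (mvec_B hq hd) // php scale0r addr0.
have m2 : WB x *m (WA x *m m) = tB x.1 (q ^+ i.+1) *: (WA x *m m) + k *: m.
  rewrite /m (mvec_A hq hd) mulmxDr mulmxZ (mvec_B hq hd i.+1 nx) m1 /= hk -kk.
  by apply/colP => j; rewrite !mxE; ring.
have mE : m = ev i by rewrite /m mvec_lt.
suff : u - m = 0.
  move=> /eqP; rewrite subr_eq0 => /eqP ->; rewrite mE co_ev //.
  by move: i0; case: (i).
set w := u - m.
have w1 : WB x *m w = tB x.1 (q ^+ i) *: w by rewrite /w mulmxBr e1 m1 scalerBr.
have w2 : WB x *m (WA x *m w) = tB x.1 (q ^+ i.+1) *: (WA x *m w) + k *: w.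
  by rewrite /w !mulmxBr e2 m2 !scalerBr opprD addrACA.
have wge j : (i <= j)%N -> co w j = 0.
  move=> hj; have [h|h] := ltnP j p; last by rewrite co_ge.
  rewrite /w mE !coE co_ev //; move: hj; rewrite leq_eqVlt => /orP [/eqP <-|hj].
    by rewrite u1 eqxx subrr.
  by rewrite ugt // gtn_eqF // subr0.
(* If j < i were the degree of w, the two equations would give theta*_i = theta*_j and theta*_(i+1)
   = theta*_(j+1), which together force q^4 = 1. *)
have H l : forall j, (i - l <= j)%N -> co w j = 0.
  elim: l => [|l ih] j hj; first by apply: wge; rewrite subn0 in hj.
  have [h|h] := leqP (i - l) j; first exact: ih.
  have ej : j.+1 = (i - l)%N.
    apply/eqP; rewrite eqn_leq h /=.
    by rewrite leq_subLR in hj; rewrite leq_subLR; apply: leq_trans hj _; rewrite addSnnS.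
  have ji : (j < i)%N by rewrite ej leq_subr.
  have jp := ltn_trans ji ip.
  apply/eqP; apply/negPn/negP => wj.
  have wS : forall j', (j < j')%N -> co w j' = 0 by move=> j' hj'; apply: ih; rewrite -ej.
  have f1 := eig_rec hq nx w1 jp; rewrite (wS j.+1) // mulr0 in f1.
  have g1 : tB x.1 (q ^+ i) = tB x.1 (q ^+ j).
    by move/eqP: f1; rewrite mulf_eq0 (negbTE wj) orbF subr_eq0 => /eqP.
  have jp1 : (j.+1 < p)%N by apply: leq_ltn_trans ip.
  have := congr1 (fun t => co t j.+1) w2.
  rewrite coD !coZ (co_WB hq _ nx jp1) (co_WA _ _ _ jp1) (wS j.+1) // mulr0 add0r.
  have -> : co (WA x *m w) j.+2 = 0.
    have [h2|h2] := ltnP j.+2 p; last by rewrite co_ge.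
    by rewrite co_WA // !wS // mulr0 addr0.
  rewrite !mulr0 !addr0 => /(mulIf wj) g2.
  have := tB_eq nx (expf_neq0 i q0) (expf_neq0 j q0) g1.
  have := tB_eq nx (expf_neq0 j.+1 q0) (expf_neq0 i.+1 q0) g2.
  case.
    move=> h3; have : (q ^+ j) ^+ 2 = (q ^+ i) ^+ 2.
      by apply: (mulfI (expf_neq0 2 q0)); rewrite -!exprMn -!exprS.
    by move/(q2X_eq hq hd jp ip) => e; rewrite e ltnn in ji.
  move=> h2 [/(q2X_eq hq hd ip jp) e|h3]; first by rewrite e ltnn in ji.
  move/eqP: q4; apply; rewrite -h2 -[LHS]mul1r -h3 (exprS q i) (exprS q j); ring.
by apply: co_eq0 => j _; apply: (H i); rewrite subnn.
Qed.

(** The vector [u] has the weight and central characters of [move_ii z]. If these determine kappa,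
    [mintop_zero] gives delta = 0, against PM. In the degenerate case kappa may be that of
    [move_iii (move_ii z)], and [dual_quad z] takes the place of [z]. *)
Lemma mintop_sextic x i k u U (z : quad F) : inPM x -> (0 < i < p)%N -> mintop q x i k u U ->
  nzq z -> approx x.1 z -> qb z * ql z * q = mu x.1 * (q ^+ i) ^+ 2 / q -> False.
Proof.
move=> hx hi hm nz' xz hz; have nx := hx.1.
have [em _ _ _] := approx_inv q0 xz.
have finish (y : quad F) : nzq y -> approx x.1 y -> ql y ^+ 2 * q ^+ 2 = (q ^+ i) ^+ 2 ->
    k = kappa q (move_ii y) -> False.
  move=> ny xy hl hk; have [dy [h1 h2]] := pm_lift d nx xy.
  have [u' [U' hm']] := mintop_transport hq hd (z := (y, dy)) nx (andP hi).2 xy h1.2.2.2 hm.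
  have := mintop_zero (x := (y, dy)) ny hi hm' hl hk.
  have := PM_no_zero (PM_transport hx h1) hi hl.
  by move=> /= /eqP.
have hl : ql z ^+ 2 * q ^+ 2 = (q ^+ i) ^+ 2.
  case: (nz') => a0 b0 c0 l0; rewrite em /mu in hz.
  transitivity ((qb z * ql z * q) * ql z * q / qb z); first by field; nz.
  by rewrite hz; field; nz.
have [X [nX mX kX oX [aX bX gX]]] := mintop_smv nx hm.
have mii : mu (move_ii z) = mu X by rewrite (mu_ii hq) // mX em; rewrite expr2 mulrA hz em divfK.
have [ia ib ig io] := inv_ii hq nz'; have [_ eb eg _] := approx_inv q0 xz.
have [ea eo] := approx_alpha_omega q0 xz.
have nii := nzq_ii hq nz'.
rewrite -ea -aX in ia; rewrite -eb -bX in ib; rewrite -eg -gX in ig; rewrite -eo -oX in io.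
have [hdeg|hgen] := eqVneq (mu (move_ii z) ^+ 2) (q ^+ 2); last first.
  have /(approx_inv q0) [_ _ _ e] := approx_of_inv' q0 q4 nii nX mii hgen ia ib ig.
  by apply: (finish z) => //; rewrite e kX.
have [/(approx_inv q0) [_ _ _ e]|h] := approx_degenerate q0 nii nX mii hdeg ib ig io.
  by apply: (finish z) => //; rewrite e kX.
have /(approx_inv q0) [_ _ _ e] := approx_trans (approx_sym (approx_iii_ii hq hd nz')) h.
apply: (finish (dual_quad z)).
- exact: (nzq_tild hq nz').
- by apply: approx_trans xz _; apply: approx_tilde.
- rewrite -hl /=; case: (nz') => a0 b0 c0 l0.
  have hh : (qb z * ql z * q) ^+ 2 = 1.
    apply: (@mulIf _ (q ^+ 2)); first by rewrite expf_eq0.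
    by rewrite mul1r -[RHS]hdeg (mu_ii hq) //; ring.
  by rewrite -[RHS]divr1 -hh; field; nz.
- by rewrite e kX.
Qed.

(** The weight mu q^(2i) of [u] is not mu, as 0 < i < d'. If it is q^2 / mu, then [ps x (q^s)]
    vanishes for some s <= i: s = 0 leads back to [mintop_sextic], and s > 0 makes the
    m_0-coordinate of [u] vanish after an S_4 move, so that delta = 0. *)
Lemma mintop_false x i k u U : inPM x -> (0 < i < p)%N -> mintop q x i k u U -> False.
Proof.
move=> hx hi hm; have nx := hx.1; have m0 := mu_neq0 nx.
have [i0 ip] := andP hi.
have qi : q ^+ i != 0 by rewrite expf_neq0.
have [X [nX mX kX oX [aX bX gX]]] := mintop_smv nx hm.
have [e|e|[z [nz' xz hz]]] := quartic_cases hq nX nx aX bX gX oX.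
- have : (q ^+ i) ^+ 2 = 1 by apply: (mulfI m0); rewrite mulr1 -mX e.
  by move/(q2X_eq1 hq)/(dvdn_leq i0); rewrite leqNgt ip.
- have hmu : mu x.1 ^+ 2 * (q ^+ i) ^+ 2 = q ^+ 2.
    by rewrite expr2 -mulrA -mX e mulrC divfK.
  have [_ _ [u1 ugt] _ [e1 e2]] := hm.
  have [ps1|ps1] := eqVneq (ps q x.1 1) 0.
    have [z [nz' xz hz]] := ps0 q0 nx (oner_neq0 F) ps1.
    have [em _ _ _] := approx_inv q0 xz.
    have [z' [nz'' zz' hz']] : exists z' : quad F,
      [/\ nzq z', approx z z' & qb z' * ql z' * q = (qb z * ql z * q)^-1].
      by apply: (sextic q0 nz'); apply: Or32.
    apply: (mintop_sextic hx hi hm nz'' (approx_trans xz zz')).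
    rewrite hz' -mX e em; case: (nz') => *.
    have -> : (qb z * ql z * q)^-1 = q / (mu z * (ql z ^+ 2 * q ^+ 2)) by rewrite /mu; field; nz.
    by rewrite hz expr1n mulr1; have mz := mu_neq0 nz'; field; nz.
  have : [exists s : 'I_p, (0 < s <= i)%N && (ps q x.1 (q ^+ s) == 0)].
    apply: contraNT ps1 => /existsPn hn; apply/eqP.
    apply: (ps1_eq0_of_weight hq hd nx hi hmu u1 ugt e1 e2) => s hs.
    have sp : (s < p)%N by case/andP: hs => _ /leq_ltn_trans; apply.
    by have := hn (Ordinal sp); rewrite hs.
  case/existsP => s /andP [/andP [s0 si] /eqP hs].
  have hsp : (0 < s < p)%N by rewrite s0 ltn_ord.
  have [z [nz' xz hz]] := ps0 q0 nx (expf_neq0 s q0) hs.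
  have [em _ _ _] := approx_inv q0 xz.
  have [dz [h1 h2]] := pm_lift d nx xz.
  have [u' [U' hm']] := mintop_transport hq hd (z := (z, dz)) nx ip xz h1.2.2.2 hm.
  have := PM_no_zero (PM_transport hx h1) hsp hz => /eqP; apply.
  apply: (mintop_delta hq hd (x := (z, dz)) nz' hi hm').
  have [_ _ _ _ [f1 _]] := hm'.
  have qs : q ^+ s != 0 by rewrite expf_neq0.
  apply: (eig_zero_below hq (x := (z, dz)) nz' f1 (s := s)).
  + by rewrite s0 ltnW.
  + exact: ph_zero_of.
  + move=> j hj; apply: (thetas_neq_below hq hd nz' hi); last exact: leq_trans hj si.
    by rewrite -em.
  + exact: s0.
- by apply: (mintop_sextic hx hi hm nz' xz); rewrite hz mX.
Qed.

Lemma PM_no_sub x U : inPM x -> inv_space (WA x) (WB x) (WC x) U -> ~~ row_full U ->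
  forall n w, inV U w -> (forall j, (n <= j)%N -> co w j = 0) -> w = 0.
Proof.
move=> hx hU nf; have nx := hx.1; elim=> [|i ih] w hw hj.
  by apply: co_eq0 => j _; apply: hj.
have [wi|wi] := eqVneq (co w i) 0.
  by apply: ih => // j; rewrite leq_eqVlt => /orP [/eqP <-|] //; apply: hj.
exfalso; have ip : (i < p)%N by rewrite ltnNge; apply: contra wi => h; rewrite co_ge.
pose u := (co w i)^-1 *: w.
have hu : inV U u by apply: inV_Z.
have u1 : co u i = 1 by rewrite coZ mulVf.
have ugt j : (i < j)%N -> co u j = 0 by move=> h; rewrite coZ (hj j) // mulr0.
have [k hm] := mintop_make hq nx ip hU hu u1 ugt ih.
case: (posnP i) => [i0|i0]; last by apply: (@mintop_false x i k u U) => //; rewrite i0.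
move/negP: nf; apply; apply: (W_generates hq hd nx) => //.
have <- : u = ev 0; last by [].
apply: co_ext => j hjp; rewrite co_ev //.
case: j hjp => [|j] hjp; first by rewrite -{1}i0 u1.
by rewrite ugt // i0.
Qed.

Lemma PM_irr x : inPM x -> irreducible (WA x) (WB x) (WC x).
Proof.
move=> hx; split=> // U hA hB hC.
have [f|nf] := boolP (row_full U); [by right|left].
apply/eqP/negPn/negP => /inV_neq0 [v v0 hv]; move/eqP: v0; apply.
apply: (PM_no_sub hx _ nf (n := p) hv) => // j hj; by rewrite co_ge.
Qed.

(** If delta = 0 and lambda^2 = q^(2i), the m_j with j > i span a submodule: phi_(i+1) = 0 stops B,
    and delta = 0 stops A from returning to m_0. *)
Lemma irr_PM x : nzq x.1 -> irreducible (WA x) (WB x) (WC x) -> inPM x.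
Proof.
move=> nx irr; split=> // y hyx.
have [y0|] := eqVneq y.2 0; last by left.
right=> /lam_set_elim [i ip hl].
have hy := hyx.1.
have irr' : irreducible (WA y) (WB y) (WC y).
  by apply: iso_irr irr; apply: iso_sym; apply: iso_pmS4.
have php : ph q y.1 (q ^+ i.+1) = 0.
  by apply: (ph_zero_of hy); rewrite // hl -exprMn -exprSr.
(* The projection to the coordinates 0, ..., i; its kernel is the span of the m_j with j > i. *)
pose E : 'M[F]_p := \matrix_(j, k) ((j == k) && (k <= i)%N)%:R.
have inU w : inV (kermx E) w <-> (forall j, (j <= i)%N -> co w j = 0).
  rewrite /inV; split.
    move=> /sub_kermxP h j hj.
    have hjp : (j < p)%N by apply: leq_ltn_trans hj (ltnW ip).
    have := congr1 (fun X : 'rV_p => X 0 (Ordinal hjp)) h; rewrite !mxE.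
    rewrite (bigD1 (Ordinal hjp)) //= !mxE eqxx hj mulr1 big1 ?addr0.
      by rewrite -co_ord.
    by move=> k ne; rewrite !mxE (negbTE ne) mulr0.
  move=> h; apply/sub_kermxP/rowP => k; rewrite !mxE big1 // => j _; rewrite !mxE.
  case: eqP => [->|_]; last by rewrite mulr0.
  by case: leqP => hk; rewrite ?mulr0 // -co_ord h ?mul0r.
have UA : (kermx E *m (WA y)^T <= kermx E)%MS.
  apply: inV_inv => w /inU hw; apply/inU => j hj.
  have hjp : (j < p)%N by apply: leq_ltn_trans hj (ltnW ip).
  rewrite co_WA // hw // mulr0 add0r; case: j hj {hjp} => [|j] hj; first by rewrite y0 mul0r.
  by rewrite hw // ltnW.
have UB : (kermx E *m (WB y)^T <= kermx E)%MS.
  apply: inV_inv => w /inU hw; apply/inU => j hj.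
  have hjp : (j < p)%N by apply: leq_ltn_trans hj (ltnW ip).
  rewrite (co_WB hq) // hw // mulr0 add0r.
  move: hj; rewrite leq_eqVlt => /orP [/eqP ->|hj]; first by rewrite php mul0r.
  by rewrite hw // mulr0.
have UC : (kermx E *m (WC y)^T <= kermx E)%MS.
  have rc := srel_C q0 q4 (W_srel hq hd hy).
  apply: inV_inv => w hw; rewrite rc.
  have wA : inV (kermx E) (WA y *m w) by apply: inV_A.
  have wB : inV (kermx E) (WB y *m w) by apply: inV_A.
  apply: inV_B; first exact: inV_Z.
  by apply: inV_Z; apply: inV_B; apply: inV_Z; apply: inV_A.
have [U0|fU] := irr'.2 _ UA UB UC.
  have : inV (kermx E) (ev i.+1).
    by apply/inU => j hj; rewrite co_ev ?(leq_ltn_trans hj (ltnW ip)) // ltn_eqF.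
  rewrite U0 /inV submx0 => /eqP /(congr1 (fun X : 'rV_p => X 0 (Ordinal ip))) /eqP.
  by rewrite !mxE eqxx oner_eq0.
have /inU /(_ 0%N isT) := full_inV (ev 0) fU.
by rewrite co_ev // => /eqP; rewrite oner_eq0.
Qed.
End Irreducibility.

(** * The vectors behind the moves (ii) and (iii) *)

Section Moves.
Variables (F : closedFieldType) (q : F) (d : nat).
Hypothesis hq : d.-primitive_root q.
Hypothesis hd : d \notin [:: 1%N; 2%N; 4%N].
Local Notation p := (dprime d).
Local Notation WA := (@WA F q d).
Local Notation WB := (@WB F q d).
Local Notation WC := (@WC F q d).
Local Notation mvec := (@mvec F d).
Let q0 := root_q0 hq.
Let q4 := root_q4 hq hd.
Let p0 := dprime_gt0 hq hd.
Let q2N := q2N q4.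
Let q2B := q2B q4.
Let q4B := q4B q4.
Local Notation move_ii := (@move_ii F q).
Local Notation move_iii := (@move_iii F q).
Local Notation inPM := (@inPM F q d).
Implicit Types (x y z : quint F) (u v w : 'cV[F]_p).

Lemma smv_ii x i : nzq x.1 -> ql x.1 ^+ 2 * q ^+ 2 = (q ^+ i) ^+ 2 ->
  smv q (WA x) (WB x) (move_ii x.1) (mvec x i).
Proof.
move=> nx hl; have qi : q ^+ i != 0 by rewrite expf_neq0.
have [b1 b2 kk] := kappa_ii hq nx qi hl; rewrite -exprS in b2 kk.
have php := ph_zero_of hq nx hl.
rewrite /smv -b1 -b2 -kk.
have m1 : WB x *m mvec x i = tB x.1 (q ^+ i) *: mvec x i.
  by rewrite (mvec_B hq hd) // php scale0r addr0.
split=> //; rewrite (mvec_A hq hd) mulmxDr mulmxZ (mvec_B hq hd i.+1 nx) m1 /=.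
by apply/colP => j; rewrite !mxE; ring.
Qed.

Lemma q2pE : (q ^+ 2) ^+ p = 1.
Proof. by rewrite -exprM (q2p hq). Qed.

Lemma dinv_ii (a b b' c l : F) dl : a != 0 -> l != 0 ->
  dinv F d (Quad F a^-1 b' c (l^-1 * q ^- 2), dl) = dinv F d (Quad F a b c l, dl).
Proof.
move=> a0 l0; rewrite /dinv !exprMn !exprVn q2pE invr1 mulr1 !invrK.
by rewrite -!addrA; congr (_ + _); rewrite addrC; congr (_ + _); rewrite mulrC.
Qed.

Lemma mvec_neq0 x i : (i < p)%N -> mvec x i != 0.
Proof.
move=> hi; apply/eqP => h; have := @co_ev F d i i hi; rewrite -(mvec_lt x hi) h co0 eqxx => /eqP.
by rewrite eq_sym oner_eq0.
Qed.

Lemma ii_iso x i : inPM x -> (i < p)%N -> ql x.1 ^+ 2 * q ^+ 2 = (q ^+ i) ^+ 2 ->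
  let y := (move_ii x.1, x.2) in mod_iso (WA y) (WB y) (WC y) (WA x) (WB x) (WC x) /\ inPM y.
Proof.
move=> hx ip hl y; have nx := hx.1; have ny := nzq_ii hq nx.
have irr := PM_irr hq hd hx.
have ed : dinv F d x = dinv F d y.
  rewrite /y; case: (x) nx => -[a b c l] dl [] /= a0 b0 c0 l0.
  by symmetry; apply: dinv_ii.
have [ea eb eg _] := inv_ii hq nx.
have hda := hasdata_eq hq hd (y := y) nx ny (esym ea) (esym eb) (esym eg) ed (W_hasdata hq hd nx).
have iso := mx_iso_of hq hd (x := y) ny hda (smv_ii nx hl) (irr_generates irr (mvec_neq0 x ip)).
split=> //; apply: (irr_PM hq hd) => //.
by apply: iso_irr irr; apply: iso_sym.
Qed.

Lemma tB_pred (x : quad F) : tB x (q ^+ p.-1) = tB x q^-1.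
Proof.
have e : (q ^+ p.-1) ^+ 2 = q^-1 ^+ 2.
  apply: (mulfI (expf_neq0 2 q0)).
  rewrite -exprMn -exprS prednK // -exprM mulnC (q2p hq) -exprMn mulfV ?expr1n //.
by rewrite /tB e.
Qed.

Lemma tB_iii (x : quad F) : nzq x -> tB (move_iii x) 1 = tB x q^-1 /\ tB (move_iii x) q = tB x (q ^- 2).
Proof.
by case=> *; rewrite /tB /move_iii /=; split; field; nz.
Qed.

(** The weight q^2 / mu belongs to the eigenvalue theta*_(-1) = theta*_(d'-1) of B. These are the
    ratios in the recursion for its eigenvector, and [top_co] gives the coordinates when that of
    m_(d'-1) is 1. *)
Definition cf_ratio (x : quad F) l := ph q x (q ^+ l.+1) / (tB x q^-1 - tB x (q ^+ l)).
Definition top_co (x : quad F) j := \prod_(j <= l < p.-1) cf_ratio x l.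

(* All theta*_i, 0 <= i < p, are then distinct. *)
Definition generic (x : quad F) := forall k, mu x ^+ 2 != (q ^+ k) ^+ 2.

Lemma generic_ne (x : quad F) i j : nzq x -> generic x -> (i < p)%N -> (j < p)%N -> i != j ->
  tB x (q ^+ i) - tB x (q ^+ j) != 0.
Proof.
move=> nx hg ip jp ne; rewrite subr_eq0; apply/eqP.
case/(tB_eq nx (expf_neq0 i q0) (expf_neq0 j q0)).
  by move/(q2X_eq hq hd ip jp) => e; rewrite e eqxx in ne.
move=> h; have [k hk] := q2_inv hq hd (i + j)%N.
move/eqP: (hg k); apply.
rewrite -exprM mulnC -hk; apply: (mulIf (expf_neq0 (2 * (i + j)) q0)).
by rewrite mulVf ?expf_neq0 // -h mulnDr exprD mulrA !(mulnC 2) !exprM.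
Qed.

Lemma generic_ne_top (x : quad F) j : nzq x -> generic x -> (j < p.-1)%N ->
  tB x q^-1 - tB x (q ^+ j) != 0.
Proof.
move=> nx hg hj; rewrite -tB_pred; apply: generic_ne => //.
- by rewrite prednK.
- by apply: leq_trans hj _; rewrite leq_pred.
- by rewrite gtn_eqF.
Qed.

(** Collects the terms in [co v 0] of the m_0-coordinate of the marginality equation for
    [move_iii x]. *)
Lemma bracketK (x : quad F) : nzq x ->
  kappa q (move_iii x) - (tB x 1 - tB x (q ^- 2)) * tA x 1 - ph q x q - tA x q * (tB x q^-1 - tB x 1)
  = - ((q ^+ 2 - q ^- 2) * ps q x 1).
Proof.
case=> *; rewrite /kappa /ph /ps /tA /tB /move_iii /=; field; nz.
Qed.

Lemma top_coE x v : nzq x.1 -> generic x.1 -> WB x *m v = tB x.1 q^-1 *: v ->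
  forall j, (j < p)%N -> co v j = top_co x.1 j * co v p.-1.
Proof.
move=> nx hg hv j hj.
rewrite -tB_pred in hv.
have H k : (k < p)%N -> co v (p.-1 - k) = top_co x.1 (p.-1 - k) * co v p.-1.
  elim: k => [|k ih] hk; first by rewrite subn0 /top_co big_geq // mul1r.
  have hlt : (p.-1 - k.+1 < p.-1)%N by rewrite ltn_subrL /= -ltnS (prednK p0) (leq_ltn_trans _ hk).
  have hltp : (p.-1 - k.+1 < p)%N by apply: leq_trans hlt (leq_pred _).
  have := eig_rec hq nx hv hltp; have hS : (p.-1 - k.+1).+1 = (p.-1 - k)%N.
    by rewrite subnSK // -ltnS prednK.
  have ih' := ih (ltnW hk).
  rewrite /top_co big_ltn // -/(top_co _ _) /cf_ratio hS ih' tB_pred => e.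
  rewrite -mulrA [LHS](_ : _ = (tB x.1 q^-1 - tB x.1 (q ^+ (p.-1 - k.+1)))^-1 *
     ((tB x.1 q^-1 - tB x.1 (q ^+ (p.-1 - k.+1))) * co v (p.-1 - k.+1))).
    by rewrite e; ring.
  by rewrite mulrA mulVf ?mul1r // generic_ne_top.
have := H (p.-1 - j)%N; rewrite subKn; last by rewrite -ltnS prednK.
by apply; apply: leq_ltn_trans (leq_subr _ _) _; rewrite prednK.
Qed.

End Moves.

(** * Products over d'-th roots of unity *)

Section Products.
Variables (F : closedFieldType) (q : F) (d : nat).
Hypothesis hq : d.-primitive_root q.
Hypothesis hd : d \notin [:: 1%N; 2%N; 4%N].
Local Notation p := (dprime d).
Let q0 := root_q0 hq.
Let q4 := root_q4 hq hd.
Let p0 := dprime_gt0 hq hd.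
Let q2N := q2N q4.
Let q2B := q2B q4.
Let q4B := q4B q4.
Implicit Types (x y z : quint F) (u v w : 'cV[F]_p).

(* The two sides of the equation in (iii), up to a common nonzero factor, are the products evaluated
   in [den_formula] and [num_formula]. *)
Definition iii_rhs (x : quad F) : F :=
  (qa x ^+ p * qb x ^+ p)^-1 * (ql x ^+ (2 * p) - 1) *
  (qa x ^+ p * qb x ^+ p * qc x ^+ p / ql x ^+ p * q ^+ p - 1) *
  (qa x ^+ p * qb x ^+ p / qc x ^+ p / ql x ^+ p * q ^+ p - 1).

(** The value at 1 of (X^d' - 1) / (X - 1), which is d' as an element of F. *)
Definition q2_prod : F := \prod_(l < p.-1) (1 - (q ^+ 2) ^+ l.+1).

Lemma q2_prod_neq0 : q2_prod != 0.
Proof.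
apply/prodf_neq0 => l _; rewrite subr_eq0 eq_sym -exprM (q2_eq1 hq).
apply/negP => /(dvdn_leq (ltn0Sn l)); rewrite leqNgt.
by rewrite -[X in (_ < X)%N](prednK p0) ltnS ltn_ord.
Qed.

Lemma qp2 : q ^+ p * q ^+ p = 1.
Proof. by rewrite -exprD addnn -mul2n (q2p hq). Qed.

Lemma prod_const (c : F) : \prod_(l < p) c = c ^+ p.
Proof. by rewrite prodr_const card_ord. Qed.

Lemma split_p (f : nat -> F) : \prod_(l < p) f l = (\prod_(l < p.-1) f l) * f p.-1.
Proof. by move: p0; case: p => // n _; rewrite big_ord_recr. Qed.

Lemma split_p0 (f : nat -> F) : \prod_(l < p) f l = f 0%N * \prod_(l < p.-1) f l.+1.
Proof. by move: p0; case: p => // n _; rewrite big_ord_recl. Qed.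

Lemma prod_qpow : (\prod_(l < p) (q ^+ 2) ^+ l) ^+ 2 = 1.
Proof.
have := prod_prim hq hd 0 (oner_neq0 F).
rewrite expr0n (negbTE (lt0n_neq0 p0)) /= sub0r expr1n.
under eq_bigr do rewrite sub0r mul1r -mulN1r.
rewrite big_split /= prod_const => e.
have e2 : ((- 1) ^+ p) ^+ 2 = 1 :> F by rewrite -exprM mulnC exprM sqrrN expr1n expr1n.
by rewrite -[LHS]mul1r -{1}e2 -exprMn e sqrrN expr1n.
Qed.

(** Up to a monomial, theta*_(-1) - theta*_l is (1 - q^(2l+2))(1 - q^2 / (mu^2 q^(2l))). The factor
    theta*_0 - theta*_(-2) supplies the index l = d' - 1 of the second family, which [prod_prim]
    then evaluates. *)
Lemma den_formula (x : quad F) : nzq x ->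
  (tB x 1 - tB x (q ^- 2)) * \prod_(l < p.-1) (tB x q^-1 - tB x (q ^+ l)) =
  (q ^+ 2 - q ^- 2) * q2_prod * (mu x ^+ p - mu x ^- p).
Proof.
move=> nx; have m0 := mu_neq0 nx.
pose f l := (q ^+ 2 - mu x ^+ 2 * (q ^+ 2) ^+ l) / (0 - mu x ^+ 2 * (q ^+ 2) ^+ l).
have m2 : mu x ^+ 2 != 0 by rewrite expf_neq0.
have hf : \prod_(l < p) f l = 1 - (mu x ^+ p) ^- 2.
  rewrite /f big_split /= prodfV !(prod_prim hq hd) // (q2pE hq) expr0n (negbTE (lt0n_neq0 p0)) /=.
  have mp : mu x ^+ p != 0 by rewrite expf_neq0.
  rewrite -(exprM _ 2 p) mulnC exprM; move: (mu x ^+ p) mp => m mn.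
  by field; rewrite oppr_eq0 expf_eq0 /= mn.
have wp : (q ^+ 2) ^+ p.-1 = (q ^+ 2)^-1.
  by apply: (mulfI (expf_neq0 2 q0)); rewrite -exprS (prednK p0) (q2pE hq) mulfV // expf_neq0.
have e0 : tB x 1 - tB x (q ^- 2) = mu x * (1 - (q ^+ 2) ^- 2) * f p.-1.
  rewrite /f wp !tB_mu //; move: (mu x) m0 {m2 hf f} => m m0.
  have -> : q ^- 2 ^+ 2 = (q ^+ 2) ^- 2 by rewrite exprVn.
  move: (q ^+ 2) (expf_neq0 2 q0) => w w0.
  by field; rewrite oppr_eq0; nz.
have el (l : nat) : tB x q^-1 - tB x (q ^+ l) = mu x / q ^+ 2 * (1 - (q ^+ 2) ^+ l.+1) * f l.
  rewrite /f !tB_mu //; move: (mu x) m0 {m2 hf f e0} => m m0.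
  have -> : (q ^+ l) ^+ 2 = (q ^+ 2) ^+ l by rewrite -!exprM mulnC.
  rewrite (exprS (q ^+ 2) l) (exprVn q 2); have := expf_neq0 l (expf_neq0 2 q0).
  move: (q ^+ 2) (expf_neq0 2 q0) => w w0; move: (w ^+ l) => W W0.
  by field; rewrite oppr_eq0; nz.
rewrite e0; under eq_bigr do rewrite el.
rewrite big_split big_split /= -/q2_prod prodr_const card_ord.
transitivity (mu x * (1 - (q ^+ 2) ^- 2) * (mu x / q ^+ 2) ^+ p.-1 * q2_prod * ((\prod_(l < p.-1) f l) * f p.-1)).
  by ring.
rewrite -split_p hf expr_div_n wp.
have -> : mu x * (1 - (q ^+ 2) ^- 2) * (mu x ^+ p.-1 / (q ^+ 2)^-1) * q2_prod * (1 - (mu x ^+ p) ^- 2) =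
   (1 - (q ^+ 2) ^- 2) * q ^+ 2 * q2_prod * (mu x * mu x ^+ p.-1 * (1 - (mu x ^+ p) ^- 2)).
  by rewrite invrK; ring.
rewrite -exprS (prednK p0); have mp : mu x ^+ p != 0 by rewrite expf_neq0.
by move: (mu x ^+ p) mp => m mn; field; nz.
Qed.

(** [ps x 1] is the index 0 absent from the product of the phi's. With it, each factor of [ps] runs
    over all powers of q^2 and multiplies out to a difference of d'-th powers. *)
Lemma num_formula (x : quad F) : nzq x ->
  - ((q ^+ 2 - q ^- 2) * ps q x 1) * \prod_(l < p.-1) ph q x (q ^+ l.+1) =
  (q ^+ 2 - q ^- 2) * q2_prod * iii_rhs x.
Proof.
move=> nx; have [a0 b0 c0 l0] := nx.
pose A := qa x * qb x * qc x / (ql x * q); pose B := qa x * qb x / (qc x * (ql x * q)).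
pose L := ql x * q; pose W l := (q ^+ 2) ^+ l.
have L0 : L != 0 by rewrite mulf_neq0.
have hps (l : nat) : ps q x (q ^+ l) = (q ^+ l) ^- 3 * (- (L / (qa x * qb x)) *
   ((L - L^-1 * W l) * ((1 - A * W l) * (1 - B * W l)))).
  have -> : W l = (q ^+ l) ^+ 2 by rewrite /W -!exprM mulnC.
  rewrite /ps /A /B /L; move: (q ^+ l) (expf_neq0 l q0) => Q Q0.
  by field; nz.
have hph (l : nat) : ph q x (q ^+ l.+1) = - (q ^+ l.+1)^-1 * ((1 - W l.+1) * ps q x (q ^+ l.+1)).
  have -> : W l.+1 = (q ^+ l.+1) ^+ 2 by rewrite /W -!exprM mulnC.
  rewrite /ph; move: (q ^+ l.+1) (expf_neq0 l.+1 q0) => Q Q0.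
  by field; nz.
under eq_bigr do rewrite hph.
rewrite big_split big_split /= -/q2_prod.
transitivity (- (q ^+ 2 - q ^- 2) * q2_prod * ((q ^+ 0)^-1 * \prod_(l < p.-1) - (q ^+ l.+1)^-1) *
   (ps q x (q ^+ 0) * \prod_(l < p.-1) ps q x (q ^+ l.+1))).
  by rewrite expr0 invr1; ring.
rewrite -(split_p0 (fun l => ps q x (q ^+ l))).
under [X in _ * X = _]eq_bigr do rewrite hps.
rewrite !big_split /= prod_const.
have h1 : \prod_(l < p) (L - L^-1 * W l) = L ^+ p - L^-1 ^+ p.
  by rewrite (prod_prim hq hd) // invr_eq0.
have hA (C : F) : C != 0 -> \prod_(l < p) (1 - C * W l) = 1 - C ^+ p.
  by move=> C0; rewrite (prod_prim hq hd) // expr1n.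
rewrite h1 !hA; last 2 first.
- by rewrite /A; nz.
- by rewrite /B; nz.
have hN : (q ^+ 0)^-1 * \prod_(l < p.-1) - (q ^+ l.+1)^-1 = - (- 1) ^+ p * (\prod_(l < p) q ^+ l)^-1.
  under eq_bigr do rewrite -mulN1r.
  rewrite big_split /= prodr_const card_ord -prodfV (split_p0 (fun l => (q ^+ l)^-1)).
  by rewrite -[in RHS](prednK p0) exprS; ring.
have h3 : \prod_(l < p) (q ^+ l) ^- 3 = (\prod_(l < p) q ^+ l) ^- 3.
  by rewrite prodfV -prodrXl.
(* The monomials left over from the factorisations combine into the inverse of this fourth power. *)
have h4 : (\prod_(l < p) q ^+ l) ^+ 4 = 1.
  transitivity ((\prod_(l < p) (q ^+ 2) ^+ l) ^+ 2); last exact: prod_qpow.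
  rewrite (exprM _ 2 2); congr (_ ^+ 2); rewrite -prodrXl.
  by apply: eq_bigr => l _; rewrite -!exprM mulnC.
rewrite hN h3 (exprNn (L / _)).
have e2 : ((- 1) ^+ p) ^+ 2 = 1 :> F by rewrite -exprM mulnC exprM sqrrN expr1n expr1n.
have Pn : \prod_(l < p) q ^+ l != 0 by apply/prodf_neq0 => l _; rewrite expf_neq0.
move: (\prod_(l < p) q ^+ l) h4 Pn => G h4 G0.
have hG : G^-1 * G ^- 3 = 1 by rewrite -[RHS]invr1 -h4; field; nz.
move: ((- 1) ^+ p) e2 => s e2.
transitivity ((q ^+ 2 - q ^- 2) * q2_prod * (s ^+ 2 * (G^-1 * G ^- 3)) *
   ((L / (qa x * qb x)) ^+ p * ((L ^+ p - L^-1 ^+ p) * ((1 - A ^+ p) * (1 - B ^+ p))))).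
  by ring.
rewrite e2 hG mulr1 mulr1 /iii_rhs /A /B /L !(exprMn, exprVn, invfM) mulnC (exprM _ p 2).
have hqp := qp2; have qp0 : q ^+ p != 0 by rewrite expf_neq0.
have hqi : (q ^+ p)^-1 = q ^+ p by apply: (mulfI qp0); rewrite hqp mulfV.
rewrite hqi.
have ap : qa x ^+ p != 0 by rewrite expf_neq0.
have bp : qb x ^+ p != 0 by rewrite expf_neq0.
have cp : qc x ^+ p != 0 by rewrite expf_neq0.
have lp0 : ql x ^+ p != 0 by rewrite expf_neq0.
move: (qa x ^+ p) (qb x ^+ p) (qc x ^+ p) (ql x ^+ p) ap bp cp lp0 => a b c l a1 b1 c1 l1.
move: (q ^+ p) hqp {qp0 hqi} => s2 hs2.
have hl : l * s2 * (l * s2 - l^-1 * s2) = l ^+ 2 - 1.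
  by transitivity ((s2 * s2) * (l ^+ 2 - 1)); [field; nz|rewrite hs2 mul1r].
transitivity ((q ^+ 2 - q ^- 2) * q2_prod * ((a * b)^-1 * (l * s2 * (l * s2 - l^-1 * s2)) *
   (a * b * c / l * s2 - 1) * (a * b / c / l * s2 - 1))).
  by field; nz.
by rewrite hl -!invfM -expr2.
Qed.

End Products.

(** * Move (iii) at generic weights *)

Section MoveIII.
Variables (F : closedFieldType) (q : F) (d : nat).
Hypothesis hq : d.-primitive_root q.
Hypothesis hd : d \notin [:: 1%N; 2%N; 4%N].
Local Notation p := (dprime d).
Local Notation WA := (@WA F q d).
Local Notation WB := (@WB F q d).
Local Notation WC := (@WC F q d).
Let q0 := root_q0 hq.
Let q4 := root_q4 hq hd.
Let p0 := dprime_gt0 hq hd.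
Let q2N := q2N q4.
Let q2B := q2B q4.
Let q4B := q4B q4.
Local Notation move_iii := (@move_iii F q).
Local Notation inPM := (@inPM F q d).
Local Notation q2_prod := (@q2_prod F q d).
Local Notation iii_rhs := (@iii_rhs F q d).
Local Notation top_co := (@top_co F q d).
Implicit Types (x y z : quint F) (u v w : 'cV[F]_p).

Lemma top_co_ratio (x : quad F) j : nzq x -> generic q x -> (j.+1 < p)%N ->
  (tB x q^-1 - tB x (q ^+ j)) * top_co x j = ph q x (q ^+ j.+1) * top_co x j.+1.
Proof.
move=> nx hg hj; have hj' : (j < p.-1)%N by rewrite -ltnS prednK.
rewrite /top_co big_ltn // /cf_ratio mulrA [X in X * _]mulrC divfK //.
exact: (generic_ne_top hq hd).
Qed.

Definition iii_eqn (x : quint F) := x.2 * (mu x.1 ^+ p - mu x.1 ^- p) = iii_rhs x.1.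

Lemma q2BV_neq0 : q ^+ 2 - q ^- 2 != 0.
Proof.
have -> : q ^+ 2 - q ^- 2 = (q ^+ 4 - 1) / q ^+ 2 by field; nz.
by rewrite mulf_neq0 ?invr_eq0 ?expf_eq0.
Qed.

(** The nonzero product of all theta*_(-1) - theta*_l clears the denominators of [top_co];
    [den_formula] and [num_formula] evaluate the two sides. *)
Lemma iii_coord0 x : nzq x.1 -> generic q x.1 ->
  iii_eqn x <-> x.2 * (tB x.1 1 - tB x.1 (q ^- 2)) = - ((q ^+ 2 - q ^- 2) * ps q x.1 1) * top_co x.1 0.
Proof.
move=> nx hg.
have hD : \prod_(l < p.-1) (tB x.1 q^-1 - tB x.1 (q ^+ l)) != 0.
  by apply/prodf_neq0 => l _; apply: (generic_ne_top hq hd).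
have ht : top_co x.1 0 * \prod_(l < p.-1) (tB x.1 q^-1 - tB x.1 (q ^+ l)) =
   \prod_(l < p.-1) ph q x.1 (q ^+ l.+1).
  rewrite /top_co big_mkord -big_split /=; apply: eq_bigr => l _.
  by rewrite /cf_ratio divfK //; apply: (generic_ne_top hq hd).
have kP : (q ^+ 2 - q ^- 2) * q2_prod != 0 by rewrite mulf_neq0 ?q2BV_neq0 ?(q2_prod_neq0 hq hd).
have e1 := den_formula hq hd nx; have e2 := num_formula hq hd nx.
rewrite -ht in e2.
split=> h.
  apply: (mulIf hD); rewrite -!mulrA mulrA [X in _ = X](_ : _ = (q ^+ 2 - q ^- 2) * q2_prod * iii_rhs x.1).
    rewrite -h -mulrA e1; ring.
  by rewrite -e2; ring.
apply: (mulfI kP); rewrite /iii_eqn -e2.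
transitivity (x.2 * ((q ^+ 2 - q ^- 2) * q2_prod * (mu x.1 ^+ p - mu x.1 ^- p))); first by ring.
by rewrite -e1 mulrA h; ring.
Qed.

Definition move_iiiq x : quint F := (move_iii x.1, x.2).

Lemma dinv_iii x : nzq x.1 -> dinv F d (move_iiiq x) = dinv F d x.
Proof.
by case: x => -[a b c l] dl [] /= a0 b0 c0 l0; apply: (dinv_ii hq).
Qed.

Lemma hasdata_iii x : nzq x.1 -> hasdata q d (WA x) (WB x) (WC x) (move_iiiq x).
Proof.
move=> nx; have [ea eb eg _] := inv_iii q0 nx.
apply: (hasdata_eq hq hd (y := move_iiiq x) nx (nzq_iii q0 nx)); rewrite ?ea ?eb ?eg ?dinv_iii //.
exact: W_hasdata.
Qed.

(* The equation is the m_0-coordinate of B A v = theta*_(-2) A v + kappa v. *)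
Lemma iii_fwd x v : nzq x.1 -> generic q x.1 -> v != 0 -> smv q (WA x) (WB x) (move_iii x.1) v -> iii_eqn x.
Proof.
move=> nx hg v0 [hB hBA]; have [t1 t2] := tB_iii hq nx; rewrite t1 in hB; rewrite t2 in hBA.
have hco := top_coE hq hd nx hg hB.
set c := co v p.-1 in hco.
have c0 : c != 0.
  apply: contraNneq v0 => h; apply/eqP/co_eq0 => i hi.
  by rewrite hco // h mulr0.
have p1 : (1 < p)%N by apply: leq_trans (dprime_gt2 hq hd).
apply/(iii_coord0 nx hg).
have := congr1 (fun t => co t 0) hBA.
rewrite coD !coZ (co_WB hq _ nx p0) !(co_WA _ _ _ p0) (co_WA _ _ _ p1) expr0 expr1.
rewrite (hco 0%N p0) (hco 1%N p1) -/c.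
have := top_co_ratio nx hg p1; rewrite expr0 expr1 => e h.
apply: (mulIf c0); rewrite -(bracketK hq) //.
transitivity ((tB x.1 1 * (tA x.1 1 * (top_co x.1 0 * c) + x.2 * c) +
   ph q x.1 q * (tA x.1 q * (top_co x.1 1 * c) + top_co x.1 0 * c))
  - (tB x.1 1 - tB x.1 (q ^- 2)) * tA x.1 1 * top_co x.1 0 * c
  - tB x.1 (q ^- 2) * x.2 * c - ph q x.1 q * top_co x.1 0 * c - tA x.1 q * c * (ph q x.1 q * top_co x.1 1)
  - tB x.1 (q ^- 2) * tA x.1 1 * (top_co x.1 0 * c)); first by ring.
by rewrite h -e; ring.
Qed.

(** Let t be the defect of the second marginality equation at the eigenvector [v] with coordinates
    [top_co]. The relation A B B gives B t = theta*_0 t, so t is a multiple of m_0, the theta*_i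
    being distinct; its m_0-coordinate vanishes by the equation in (iii). *)
Lemma iii_bwd x : nzq x.1 -> generic q x.1 -> iii_eqn x ->
  exists2 v : 'cV[F]_p, v != 0 & smv q (WA x) (WB x) (move_iii x.1) v.
Proof.
move=> nx hg /(iii_coord0 nx hg) heq.
have [t1 t2] := tB_iii hq nx; have p1 : (1 < p)%N by apply: leq_trans (dprime_gt2 hq hd).
have pp : (p.-1 < p)%N by rewrite prednK.
pose v : 'cV[F]_p := \col_j top_co x.1 j.
have hco j : (j < p)%N -> co v j = top_co x.1 j.
  by move=> h; rewrite -[j]/(nat_of_ord (Ordinal h)) co_ord mxE.
have ctop : co v p.-1 = 1 by rewrite hco // /top_co big_geq.
have hB : WB x *m v = tB x.1 q^-1 *: v.
  apply: co_ext => j hj; rewrite (co_WB hq) // coZ.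
  have [h|h] := ltnP j.+1 p.
    rewrite !hco // -(top_co_ratio nx hg h); ring.
  have ej : j = p.-1.
    by apply/eqP; rewrite -eqSS (prednK p0) eqn_leq hj h.
  by rewrite (co_ge _ h) mulr0 addr0 ej (tB_pred hq hd).
have v0 : v != 0.
  by apply/eqP => h; move: ctop; rewrite h co0 => /eqP; rewrite eq_sym oner_eq0.
exists v => //; rewrite /smv t1 t2; split=> //.
set k := kappa q (move_iii x.1).
set t := WB x *m (WA x *m v) - tB x.1 (q ^- 2) *: (WA x *m v) - k *: v.
suff : t = 0 by move=> /eqP; rewrite /t -addrA -opprD subr_eq0 => /eqP.
have r2 := W_ABB hq hd nx.
have hkk : k * (tB x.1 q^-1 - tB x.1 1) = (q - q^-1) ^+ 2 * ((q + q^-1) * alpha q x.1 - gamma q x.1 * tB x.1 q^-1).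
  have := kappa_alpha q0 (nzq_iii q0 nx); rewrite t1; have [-> _ -> _] := inv_iii q0 nx.
  have -> : tB (move_iii x.1) q^-1 = tB x.1 1.
    by case: nx => *; rewrite /tB /move_iii /=; field; nz.
  done.
have ht : WB x *m t = tB x.1 1 *: t.
  have := r2 v; rewrite hB !mulmxZ hB mulmxZ => e.
  apply: cfP => i; have := congr1 (cf i) e.
  rewrite /t !(mulmxDr, mulmxN, mulmxZ) hB !cfE.
  move: (cf i (WB x *m (WB x *m (WA x *m v)))) (cf i (WB x *m (WA x *m v))) (cf i (WA x *m v)) (cf i v) => s3 s2 s1 s0 {}e.
  have -> : s3 = (q ^+ 2 + q ^- 2) * (tB x.1 q^-1 * s2) - (q ^+ 2 - q ^- 2) ^+ 2 * s1
     - (q - q^-1) ^+ 2 * gamma q x.1 * (tB x.1 q^-1 * s0) + (q ^+ 2 - q ^- 2) * (q - q^-1) * alpha q x.1 * s0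
     - tB x.1 q^-1 * (tB x.1 q^-1 * s1).
    by rewrite e; ring.
  have -> : (q ^+ 2 - q ^- 2) * (q - q^-1) * alpha q x.1 * s0 =
     (k * (tB x.1 q^-1 - tB x.1 1) + (q - q^-1) ^+ 2 * (gamma q x.1 * tB x.1 q^-1)) * s0.
    by rewrite hkk; field; nz.
  move: (k) => k'; case: nx => *; rewrite /tB; field; nz.
have tge j : (0 < j)%N -> co t j = 0.
  move=> j0; have H l : (l <= p)%N -> forall i, (p - l <= i)%N -> (0 < i)%N -> co t i = 0.
    elim: l => [|l ih] hl i hi i0; first by rewrite co_ge // -(subn0 p).
    have [h|h] := leqP (p - l) i; first by apply: ih => //; apply: ltnW.
    have ip : (i < p)%N by apply: leq_trans h (leq_subr _ _).
    have ht' : WB x *m t = tB x.1 (q ^+ 0) *: t by rewrite expr0.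
    have := eig_rec hq nx ht' ip; rewrite (ih (ltnW hl) i.+1) // ?mulr0.
      move=> /eqP; rewrite mulf_eq0 => /orP [h0|/eqP //].
      have := generic_ne hq hd nx hg p0 ip; rewrite eq_sym -lt0n i0 => /(_ isT).
      by rewrite h0.
    by rewrite leq_subLR in hi; rewrite leq_subLR; apply: leq_trans hi _; rewrite addSnnS.
  by apply: (H p) => //; rewrite subnn.
apply: co_eq0 => -[|j] hj; last exact: tge.
rewrite /t !coD !coN !coZ (co_WB hq _ nx p0) !(co_WA _ _ _ p0) (co_WA _ _ _ p1) expr0 expr1.
rewrite ctop (hco 0%N p0) (hco 1%N p1).
have := top_co_ratio nx hg p1; rewrite expr0 expr1 => e.
rewrite -(bracketK hq) // -/k in heq.
transitivity (x.2 * (tB x.1 1 - tB x.1 (q ^- 2)) - (k - (tB x.1 1 - tB x.1 (q ^- 2)) * tA x.1 1 - ph q x.1 q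
   - tA x.1 q * (tB x.1 q^-1 - tB x.1 1)) * top_co x.1 0
   - tA x.1 q * ((tB x.1 q^-1 - tB x.1 1) * top_co x.1 0 - ph q x.1 q * top_co x.1 1)); first by ring.
by rewrite heq e; ring.
Qed.

Lemma iii_iso x v : inPM x -> v != 0 -> smv q (WA x) (WB x) (move_iii x.1) v ->
  mod_iso (WA (move_iiiq x)) (WB (move_iiiq x)) (WC (move_iiiq x)) (WA x) (WB x) (WC x) /\ inPM (move_iiiq x).
Proof.
move=> hx v0 hv; have nx := hx.1; have irr := PM_irr hq hd hx.
have iso := mx_iso_of hq hd (x := move_iiiq x) (nzq_iii q0 nx) (hasdata_iii nx) hv (irr_generates irr v0).
split=> //; apply: (irr_PM hq hd); first exact: nzq_iii.
by apply: iso_irr irr; apply: iso_sym.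
Qed.

End MoveIII.

(** * Decomposition of the generating moves *)

Section Equivalence.
Variables (F : closedFieldType) (q : F) (d : nat).
Hypothesis hq : d.-primitive_root q.
Hypothesis hd : d \notin [:: 1%N; 2%N; 4%N].
Local Notation p := (dprime d).
Local Notation approx := (@approx F q).
Let q0 := root_q0 hq.
Let q4 := root_q4 hq hd.
Let p0 := dprime_gt0 hq hd.
Let q2N := q2N q4.
Let q2B := q2B q4.
Let q4B := q4B q4.
Local Notation move_ii := (@move_ii F q).
Local Notation dual_quad := (@dual_quad F q).
Local Notation move_iii := (@move_iii F q).
Local Notation iii_rhs := (@iii_rhs F q d).
Local Notation iii_eqn := (@iii_eqn F q d).
Local Notation move_iiiq := (@move_iiiq F q).
Local Notation simeq := (@simeq F q d).
Local Notation generic := (@generic F q).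
Implicit Types (x y z : quint F) (u v w : 'cV[F]_p).

Definition q2pow (t : F) := exists k, t = (q ^+ k) ^+ 2.

Lemma q2pow_lt t : q2pow t -> exists2 k, (k < p)%N & t = (q ^+ k) ^+ 2.
Proof.
case=> k ->; exists (k %% p)%N; first by rewrite ltn_pmod.
by rewrite -!exprM !(mulnC _ 2) (q2_mod hq hd).
Qed.
Lemma q2powM s t : q2pow s -> q2pow t -> q2pow (s * t).
Proof. by case=> k -> [l ->]; exists (k + l)%N; rewrite -exprMn -exprD. Qed.
Lemma q2powV t : q2pow t -> q2pow t^-1.
Proof.
case=> k ->; have [j hj] := q2_inv hq hd k; exists j.
by rewrite -!exprM !(mulnC _ 2) hj.
Qed.
Lemma q2pow_q k : q2pow (q ^+ (2 * k)). Proof. by exists k; rewrite -exprM mulnC. Qed.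

Lemma q2pow_root t : t ^+ p = 1 -> q2pow t.
Proof.
move=> ht; have := prod_prim hq hd t (oner_neq0 F); rewrite ht expr1n subrr => /eqP.
rewrite prodf_seq_eq0 => /hasP [j _ /=]; rewrite subr_eq0 mul1r => /eqP ->.
by exists j; rewrite -!exprM mulnC.
Qed.

Lemma generic_dec (x : quad F) : generic x \/ q2pow (mu x ^+ 2).
Proof.
case: (boolP [exists k : 'I_p, mu x ^+ 2 == (q ^+ k) ^+ 2]) => [/existsP [k /eqP h]|/existsPn h].
  by right; exists k.
left=> k; apply/eqP => e; have [k' hk' e'] : exists2 k, (k < p)%N & mu x ^+ 2 = (q ^+ k) ^+ 2 by apply: q2pow_lt; exists k.
by have := h (Ordinal hk'); rewrite e' eqxx.
Qed.

Lemma iiK (x : quad F) : nzq x -> move_ii (move_ii x) = x.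
Proof. by case: x => a b c l [] /= *; rewrite /move_ii /=; congr Quad; field; nz. Qed.

Lemma dinv_iiq x : nzq x.1 -> dinv F d (move_ii x.1, x.2) = dinv F d x.
Proof. by case: x => -[a b c l] dl [] /= a0 b0 c0 l0; apply: (dinv_ii hq). Qed.

Lemma approx_34 (x : quad F) : nzq x -> approx x (Quad F (qa x)^-1 (qb x) (qc x) (ql x)).
Proof.
move=> nx; apply: rst_step; split=> //; split; first by case: nx => *; split; rewrite /=; nz.
by case: x nx => a b c l _; apply: Or43.
Qed.

Section Chain.
(* When mu^2 is a power of q^2, a move (iii) is a composite of moves (i) and (ii). *)
Variable E : quint F -> quint F -> Prop.
Hypothesis E_trans : forall x y z, E x y -> E y z -> E x z.
Hypothesis E_pm : forall x y, simeq_pmS4 F q d x y -> E x y.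
Hypothesis E_ii : forall x i, nzq x.1 -> (0 < i < p)%N -> ql x.1 ^+ 2 * q ^+ 2 = (q ^+ i) ^+ 2 ->
  E x (move_ii x.1, x.2).

Lemma E_approx x y : nzq x.1 -> approx x.1 y.1 -> dinv F d x = dinv F d y -> E x y.
Proof. by move=> nx xy e; apply: E_pm; split=> //; split; first exact: (approx_nz xy). Qed.

(** Up to (i), [move_iii] inverts b and lambda q. A [move_ii] inverts lambda q, and its conjugate by
    [dual_quad] inverts b. With lambda^2 q^2 = q^(2i) and b^-2 = q^(2j) they are available for i, j
    > 0, while index 0 means that the inversion changes nothing. *)
Lemma chain_iii0 x : nzq x.1 -> q2pow (mu x.1 ^+ 2) -> q2pow (ql x.1 ^+ 2) -> E x (move_iiiq x).
Proof.
move=> nx hm hl; have [a0 b0 c0 l0] := nx.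
have [i ip hi] : exists2 k, (k < p)%N & ql x.1 ^+ 2 * q ^+ 2 = (q ^+ k) ^+ 2.
  by apply: q2pow_lt; apply: q2powM => //; exists 1%N; rewrite expr1.
have [j jp hj] : exists2 k, (k < p)%N & (qb x.1 ^+ 2)^-1 = (q ^+ k) ^+ 2.
  apply: q2pow_lt; apply: q2powV; have -> : qb x.1 ^+ 2 = mu x.1 ^+ 2 * ql x.1 ^+ 2 by rewrite /mu; field; nz.
  exact: q2powM.
have n3 := nzq_iii q0 nx.
case: (posnP j) => [j0|j0].
  have hb : (qb x.1)^-1 = qb x.1.
    apply: (mulIf b0); rewrite mulVf // -expr2; apply: invr_inj.
    by rewrite hj j0 expr1n invr1.
  case: (posnP i) => [i0|i0]; last first.
    have := E_ii nx (introT andP (conj i0 ip)) hi.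
    by rewrite /move_iiiq /move_iii /move_ii hb.
  apply: E_approx => //; last by rewrite (dinv_iii hq).
  rewrite /move_iiiq /move_iii /= hb.
  have hl2 : (ql x.1)^-1 * q ^- 2 = ql x.1.
    apply: (mulIf l0); apply: (mulIf (expf_neq0 2 q0)).
    by rewrite -expr2 hi i0 expr1n; field; nz.
  by rewrite hl2; apply: approx_34.
case: (posnP i) => [i0|i0].
  have hl2 : (ql x.1)^-1 * q ^- 2 = ql x.1.
    apply: (mulIf l0); apply: (mulIf (expf_neq0 2 q0)).
    by rewrite -expr2 hi i0 expr1n; field; nz.
  have nt := nzq_tild hq nx.
  have xt := approx_tilde q0 q4 nx.
  have [dz [h1 h2]] := pm_lift d nx xt.
  apply: E_trans (E_pm h1) _; apply: E_trans (E_ii (x := (dual_quad x.1, dz)) nt (introT andP (conj j0 jp)) _) _.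
    by rewrite /= -hj; field; nz.
  have aa := approx_iii_ii hq hd nx.
  have nii : nzq (move_ii (dual_quad x.1)) by apply: (nzq_ii hq).
  apply: E_approx => //.
    apply: approx_trans (approx_sym aa) _.
    rewrite -[(move_iiiq x).1]/(move_iii x.1).
    have -> : move_iii x.1 = Quad F (qa (move_iii (move_ii x.1)))^-1 (qb (move_iii (move_ii x.1))) (qc (move_iii (move_ii x.1))) (ql (move_iii (move_ii x.1))).
      by rewrite /move_iii /move_ii /= hl2 invrK hl2.
    by apply: approx_34; apply: (nzq_iii q0); apply: (nzq_ii hq).
  by rewrite (dinv_iii hq nx) (dinv_iiq (x := (dual_quad x.1, dz)) nt) h2.2.2.2.
have nii := nzq_ii hq nx; have nt := nzq_tild hq nii.
apply: E_trans (E_ii nx (introT andP (conj i0 ip)) hi) _.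
have xt := approx_tilde q0 q4 nii.
have [dz [h1 h2]] := pm_lift d (x := (move_ii x.1, x.2)) nii xt.
apply: E_trans (E_pm h1) _; apply: E_trans (E_ii (x := (dual_quad (move_ii x.1), dz)) nt (introT andP (conj j0 jp)) _) _.
  by rewrite /= -hj; field; nz.
have aa := approx_iii_ii hq hd nii; rewrite iiK // in aa.
apply: E_approx => //.
- exact: (nzq_ii hq).
- exact: approx_sym.
by rewrite (dinv_iii hq nx) (dinv_iiq (x := (dual_quad (move_ii x.1), dz)) nt) h2.2.2.2 dinv_iiq.
Qed.

(** Applied with [E] the equivalence itself and with [E] the relation [PM_iso]. *)
Lemma chain_iii x (z : quad F) : nzq x.1 -> q2pow (mu x.1 ^+ 2) -> nzq z -> approx x.1 z -> q2pow (ql z ^+ 2) -> E x (move_iiiq x).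
Proof.
move=> nx hm nz' xz hl; have [dz [h1 h2]] := pm_lift d nx xz.
have [em _ _ _] := approx_inv q0 xz.
apply: E_trans (E_pm h1) _; apply: E_trans (@chain_iii0 (z, dz) nz' _ hl) _; first by rewrite /= -em.
apply: E_approx; first exact: nzq_iii.
  by apply: (approx_iii q0 q4) => //; apply: approx_sym.
by rewrite !(dinv_iii hq) // h2.2.2.2.
Qed.
End Chain.

Lemma simeq_pm x y : simeq_pmS4 F q d x y -> simeq x y.
Proof.
move=> h; have [nx [ny _]] := h; apply: rst_step; split=> //; split=> //.
by case: x h nx => -[a b c l] dl h nx; apply: Or31.
Qed.

Lemma simeq_ii x i : nzq x.1 -> (0 < i < p)%N -> ql x.1 ^+ 2 * q ^+ 2 = (q ^+ i) ^+ 2 ->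
  simeq x (move_ii x.1, x.2).
Proof.
move=> nx /andP [i0 ip] h; apply: rst_step; split=> //; split; first exact: (nzq_ii hq).
case: x nx h => -[a b c l] dl /= nx h; apply: Or32; split=> //.
apply: (lam_setP hq hd (i := i.-1)); first by rewrite prednK.
apply: (@mulIf _ (q ^+ 2)); first by rewrite expf_eq0.
by rewrite h -exprMn -exprSr prednK.
Qed.

Lemma blam_q2pow t : blam_set F q d t -> q2pow t.
Proof.
case=> i hi ->; exists (p - i + 1)%N; rewrite -exprM mulnC exprnP; congr (_ ^ _).
have ip : (i <= p)%N by apply: leq_trans hi (leq_subr _ _).
by rewrite PoszM PoszD -subzn.
Qed.

Lemma simeq_iii x : nzq x.1 -> generic x.1 -> iii_eqn x -> simeq x (move_iiiq x).
Proof.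
move=> nx hg h; apply: rst_step; split=> //; split; first exact: nzq_iii.
case: x nx hg h => -[a b c l] dl /= nx hg h; apply: Or33; split=> //.
  by move/blam_q2pow => [k hk]; move/eqP: (hg k); apply; rewrite /mu /= expr_div_n.
by move: h; rewrite /iii_eqn /iii_rhs /mu /= expr_div_n invf_div => ->.
Qed.

(** A vanishing factor says that lambda^2, a b c q / lambda or a b q / (c lambda) is a d'-th root of
    unity, hence a power of q^2. By [sextic] each of these is, up to inversion, the lambda^2 of a
    point in the orbit. *)
Lemma iii_rhs0 (x : quad F) : nzq x -> iii_rhs x = 0 -> exists z : quad F, [/\ nzq z, approx x z & q2pow (ql z ^+ 2)].
Proof.
move=> nx; have [a0 b0 c0 l0] := nx; rewrite /iii_rhs => /eqP.
have ap := expf_neq0 p a0; have bp := expf_neq0 p b0.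
rewrite !mulf_eq0 invr_eq0 mulf_eq0 (negbTE ap) (negbTE bp) /= !subr_eq0.
have H (z : quad F) t : nzq z -> approx x z -> qb z * ql z * q = t -> q2pow (t / (mu x * q)) ->
  exists z : quad F, [/\ nzq z, approx x z & q2pow (ql z ^+ 2)].
  move=> nz' xz <- hp; exists z; split=> //; have [em _ _ _] := approx_inv q0 xz.
  suff -> : ql z ^+ 2 = qb z * ql z * q / (mu x * q) by [].
  by rewrite em; case: nz' => *; rewrite /mu; field; nz.
case/orP => [/orP [/eqP h|/eqP h]|/eqP h].
- exists x; split=> //; first exact: approx_refl.
  by apply: q2pow_root; rewrite -exprM.
- have [z [nz' xz hz]] : exists z : quad F, [/\ nzq z, approx x z & qb z * ql z * q = (qa x * qc x)^-1].
    by apply: (sextic q0 nx); apply: Or33; apply: Or42.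
  apply: (H _ _ nz' xz hz).
  have -> : (qa x * qc x)^-1 / (mu x * q) = (qa x * qb x * qc x / ql x * q)^-1 by rewrite /mu; field; nz.
  by apply: q2powV; apply: q2pow_root; rewrite -h !exprMn exprVn.
- have [z [nz' xz hz]] : exists z : quad F, [/\ nzq z, approx x z & qb z * ql z * q = qc x / qa x].
    by apply: (sextic q0 nx); apply: Or33; apply: Or44.
  apply: (H _ _ nz' xz hz).
  have -> : qc x / qa x / (mu x * q) = (qa x * qb x / qc x / ql x * q)^-1 by rewrite /mu; field; nz.
  by apply: q2powV; apply: q2pow_root; rewrite -h !exprMn !exprVn.
Qed.

(** If mu^2 is a power of q^2, then mu^(2d') = 1 annihilates the left side of the equation in (iii),
    so its right side is 0 and [iii_rhs0] applies. *)
Lemma sim_cases x y : sim F q d x y ->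
  [\/ simeq_pmS4 F q d x y, nzq x.1 /\ y = (move_ii x.1, x.2) /\ (exists2 i, (0 < i < p)%N & ql x.1 ^+ 2 * q ^+ 2 = (q ^+ i) ^+ 2),
      [/\ nzq x.1, y = move_iiiq x, generic x.1 & iii_eqn x] |
      [/\ nzq x.1, y = move_iiiq x, q2pow (mu x.1 ^+ 2) & exists z : quad F, [/\ nzq z, approx x.1 z & q2pow (ql z ^+ 2)]]].
Proof.
case=> nx [ny]; case: x nx => -[a b c l] dl nx.
case=> [h|[-> h]|[-> _ h]]; first exact: Or41.
  apply: Or42; split=> //; split=> //; have [i hi e] := lam_set_elim hq hd h.
  by exists i.+1; rewrite //= e -exprMn -exprSr.
have {}h : iii_eqn (Quad F a b c l, dl).
  by rewrite /iii_eqn /iii_rhs /mu /= expr_div_n invf_div.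
case: (generic_dec (Quad F a b c l)) => hg; first exact: Or43.
apply: Or44; split=> //; apply: iii_rhs0 => //=.
rewrite -h /=; have m0 := mu_neq0 nx.
have e : (mu (Quad F a b c l) ^+ p) ^+ 2 = 1.
  case: hg => k hk; transitivity ((mu (Quad F a b c l) ^+ 2) ^+ p); first by rewrite -!exprM mulnC.
  rewrite hk; transitivity (((q ^+ 2) ^+ p) ^+ k); last by rewrite (q2pE hq) expr1n.
  by rewrite -!exprM; congr (q ^+ _); rewrite mulnCA (mulnC k).
have -> : mu (Quad F a b c l) ^- p = mu (Quad F a b c l) ^+ p.
  have mp := expf_neq0 p m0; apply: (mulfI mp).
  by rewrite mulfV // -expr2 e.
by rewrite subrr mulr0.
Qed.

End Equivalence.

(** * Equivalent parameters and isomorphic modules *)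

Section Injectivity.
Variables (F : closedFieldType) (q : F) (d : nat).
Hypothesis hq : d.-primitive_root q.
Hypothesis hd : d \notin [:: 1%N; 2%N; 4%N].
Local Notation p := (dprime d).
Local Notation approx := (@approx F q).
Local Notation WA := (@WA F q d).
Local Notation WB := (@WB F q d).
Local Notation WC := (@WC F q d).
Local Notation mvec := (@mvec F d).
Local Notation ev := (@ev F d).
Let q0 := root_q0 hq.
Let q4 := root_q4 hq hd.
Let p0 := dprime_gt0 hq hd.
Let q2N := q2N q4.
Let q2B := q2B q4.
Let q4B := q4B q4.
Local Notation move_ii := (@move_ii F q).
Local Notation move_iii := (@move_iii F q).
Local Notation inPM := (@inPM F q d).
Local Notation iii_rhs := (@iii_rhs F q d).
Local Notation iii_eqn := (@iii_eqn F q d).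
Local Notation move_iiiq := (@move_iiiq F q).
Local Notation simeq := (@simeq F q d).
Local Notation generic := (@generic F q).
Implicit Types (x y z : quint F) (u v w : 'cV[F]_p).
Local Notation iso x y := (mod_iso (WA x) (WB x) (WC x) (WA y) (WB y) (WC y)).

(** Symmetric, so that it passes through the symmetric closure in [simeq]; it carries membership in
    PM along paths whose inner points are not assumed to lie there. *)
Definition PM_iso x y := (inPM x -> inPM y /\ iso x y) /\ (inPM y -> inPM x /\ iso y x).

Lemma PM_iso_sym x y : PM_iso x y -> PM_iso y x.
Proof. by case. Qed.
Lemma PM_iso_trans x y z : PM_iso x y -> PM_iso y z -> PM_iso x z.
Proof.
case=> a1 a2 [b1 b2]; split.
  by move=> /a1 [/b1 [h i2] i1]; exact: (conj h (iso_trans i1 i2)).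
by move=> /b2 [/a2 [h i2] i1]; exact: (conj h (iso_trans i1 i2)).
Qed.
Lemma PM_iso_refl x : PM_iso x x.
Proof. by split=> h; exact: (conj h (iso_refl _ _ _)). Qed.

Lemma pm_sym x y : simeq_pmS4 F q d x y -> simeq_pmS4 F q d y x.
Proof.
by case=> nx [ny [xy e]]; split=> //; split=> //; split=> //; apply: approx_sym.
Qed.

Lemma PM_iso_pm x y : simeq_pmS4 F q d x y -> PM_iso x y.
Proof.
move=> h; split=> hx.
  by split; [apply: (PM_transport hx h)|apply: (iso_pmS4 hq hd h)].
by split; [apply: (PM_transport hx (pm_sym h))|apply: (iso_pmS4 hq hd (pm_sym h))].
Qed.

Lemma PM_iso_ii x i : nzq x.1 -> (0 < i < p)%N -> ql x.1 ^+ 2 * q ^+ 2 = (q ^+ i) ^+ 2 -> PM_iso x (move_ii x.1, x.2).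
Proof.
move=> nx /andP [i0 ip] h; split=> hx.
  by have [i1 i2] := ii_iso hq hd hx ip h; exact: (conj i2 (iso_sym i1)).
have ny := hx.1.
have hi : (p - i < p)%N by rewrite ltn_subrL i0.
(* [move_ii] is an involution that turns the index i into d' - i. *)
have e : ql (move_ii x.1) ^+ 2 * q ^+ 2 = (q ^+ (p - i)) ^+ 2.
  have qi := expf_neq0 2 (expf_neq0 i q0).
  apply: (mulfI qi); rewrite -[in RHS]exprMn -exprD subnKC ?(ltnW ip) // -[in RHS]exprM mulnC (q2p hq).
  by rewrite -h /=; case: nx => *; field; nz.
have := ii_iso hq hd hx hi e; rewrite /= (iiK hq) // => -[i1 i2].
by case: x nx h hx ny e i1 i2 => X dx nx h hx ny e i1 i2; exact: (conj i2 (iso_sym i1)).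
Qed.

Lemma generic_iii (x : quad F) : nzq x -> generic x -> generic (move_iii x).
Proof.
move=> nx hg k; rewrite (mu_iii q0) //; apply/eqP => h; have m0 := mu_neq0 nx.
have : q2pow q (mu x ^+ 2).
  have -> : mu x ^+ 2 = q ^+ (2 * 2) * ((q ^ 2 / mu x) ^+ 2)^-1.
    by rewrite -exprnP; field; nz.
  apply: (q2powM (q2pow_q q 2)); apply: (q2powV hq hd); rewrite -exprnP h; by exists k.
by case=> l hl; move/eqP: (hg l).
Qed.

(** The other side of the equation also changes sign, since mu^d' becomes mu^-d'. Hence (iii) can be
    reversed by (iii). *)
Lemma iii_rhs_iii (x : quad F) : nzq x -> iii_rhs (move_iii x) = - iii_rhs x.
Proof.
move=> nx; rewrite /iii_rhs /move_iii /=.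
have hqp := qp2 hq; have qp0 := expf_neq0 p q0.
have hl : ((ql x)^-1 * q ^- 2) ^+ p = (ql x ^+ p)^-1.
  by rewrite exprMn !exprVn (q2pE hq) invr1 mulr1.
rewrite !(mulnC 2 p) !(exprM _ p 2) hl !exprVn !invrK.
have [a0 b0 c0 l0] := nx.
move: (expf_neq0 p a0) (expf_neq0 p b0) (expf_neq0 p c0) (expf_neq0 p l0).
move: (qa x ^+ p) (qb x ^+ p) (qc x ^+ p) (ql x ^+ p) => a b c l a1 b1 c1 l1.
move: (q ^+ p) hqp qp0 => s hs s0.
have e1 t : t != 0 -> s / t - 1 = - (t * s - 1) * s / t.
  by move=> t0; transitivity (- (t * (s * s) - s) / t); [rewrite hs; field; nz | field; nz].
have X0 : a * b * c / l != 0 by nz.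
have Y0 : a * b / c / l != 0 by nz.
transitivity (a * b * (l ^- 2 - 1) * (s / (a * b / c / l) - 1) * (s / (a * b * c / l) - 1)).
  by field; nz.
rewrite !e1 //.
transitivity (- ((a * b)^-1 * (l ^+ 2 - 1) * (a * b * c / l * s - 1) * (a * b / c / l * s - 1)) * (s * s)).
  by field; nz.
by rewrite hs mulr1.
Qed.

Lemma iii_eqn_iii x : nzq x.1 -> iii_eqn x -> iii_eqn (move_iiiq x).
Proof.
move=> nx; rewrite /iii_eqn /= iii_rhs_iii // => <-; rewrite (mu_iii q0) // expr_div_n.
by rewrite (q2pE hq) mul1r invrK; ring.
Qed.

Lemma PM_iso_iii_fwd x : nzq x.1 -> generic x.1 -> iii_eqn x -> inPM x -> inPM (move_iiiq x) /\ iso x (move_iiiq x).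
Proof.
move=> nx hg h hx; have [v v0 hv] := iii_bwd hq hd nx hg h.
by have [i1 i2] := iii_iso hq hd hx v0 hv; exact: (conj i2 (iso_sym i1)).
Qed.

Lemma PM_iso_iii x : nzq x.1 -> generic x.1 -> iii_eqn x -> PM_iso x (move_iiiq x).
Proof.
move=> nx hg h; split; first exact: PM_iso_iii_fwd.
move=> hy; have := PM_iso_iii_fwd (x := move_iiiq x) (nzq_iii q0 nx) (generic_iii nx hg) (iii_eqn_iii nx h) hy.
rewrite /move_iiiq /= (iiiK q0) //; case: (x) => X dx; exact.
Qed.

Lemma simeq_PM_iso x y : simeq x y -> PM_iso x y.
Proof.
elim=> {x y} [x y /(sim_cases hq hd)|x|x y _|x y z _ h1 _ h2].
- case=> [|[nx [-> [i hi hl]]]|[nx -> hg h]|[nx -> hm [z [nz' xz hl]]]].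
  + exact: PM_iso_pm.
  + exact: (PM_iso_ii nx hi hl).
  + exact: PM_iso_iii.
  + exact: (chain_iii hq hd PM_iso_trans PM_iso_pm PM_iso_ii nx hm nz' xz hl).
- exact: PM_iso_refl.
- exact: PM_iso_sym.
- exact: PM_iso_trans h1 h2.
Qed.

Lemma simeq_trans x y z : simeq x y -> simeq y z -> simeq x z. Proof. exact: rst_trans. Qed.

Lemma simeq_chain x (z : quad F) : nzq x.1 -> q2pow q (mu x.1 ^+ 2) -> nzq z -> approx x.1 z -> q2pow q (ql z ^+ 2) ->
  simeq x (move_iiiq x).
Proof.
exact: (chain_iii hq hd simeq_trans (@simeq_pm F q d) (simeq_ii hq hd)).
Qed.

Lemma iso_chain (x y : quint F) X (P : 'M[F]_p) v i : P *m WA x = WA y *m P ->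
  chain q (WA y) X (P *m v) i = P *m chain q (WA x) X v i.
Proof.
by move=> e; elim: i => //= i ->; rewrite mulmxDr mulmxN mulmxZ !mulmxA e.
Qed.

Lemma iso_data x y : nzq x.1 -> nzq y.1 -> iso x y ->
  [/\ alpha q x.1 = alpha q y.1, beta q x.1 = beta q y.1, gamma q x.1 = gamma q y.1, omega q y.1 = omega q x.1 &
    dinv F d x = dinv F d y /\ exists2 v : 'cV[F]_p, v != 0 & smv q (WA x) (WB x) y.1 v].
Proof.
move=> nx ny i1; have i2 := iso_sym i1.
have [ea eb eg] := srel_inj q0 q4 p0 (iso_srel i1 (W_srel hq hd nx)) (W_srel hq hd ny).
have [Q uQ [QA QB QC]] := i2.
pose v := Q *m ev 0.
have e0 : ev 0 != 0 by rewrite -(mvec_lt y p0); apply: mvec_neq0.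
have v0 : v != 0.
  apply: contra e0 => /eqP h; rewrite -[ev 0](mulKmx uQ) -/v h mulmx0 //.
have hv : smv q (WA x) (WB x) y.1 v.
  have [h1 h2] := W_smv hq hd ny; split.
    by rewrite /v mulmxA -QB -mulmxA h1 mulmxZ.
  have -> : WA x *m v = Q *m (WA y *m ev 0) by rewrite /v !mulmxA QA.
  by rewrite mulmxA -QB -mulmxA h2 mulmxDr !mulmxZ.
split=> //; first by apply: (omega_eq hq hd nx ny _ _ _ hv v0).
split; last by exists v.
have [_ hx] := W_hasdata hq hd nx; have [_ hy] := W_hasdata hq hd ny.
have e1 : chain q (WA x) y.1 v p = y.2 *: v by rewrite (iso_chain _ _ _ QA) hy mulmxZ.
have := chain_p hq hd (WA x) v nx ny; rewrite hx e1 -!scalerDl => /eqP.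
rewrite -subr_eq0 -scalerBl scaler_eq0 (negbTE v0) orbF subr_eq0 => /eqP.
case: (x) (y) => -[a b c l] dx [[a' b' c' l'] dy].
by rewrite /theta_cst /dinv /= !addrA.
Qed.

Lemma ph_all_or (x : quad F) : nzq x ->
  (exists z : quad F, [/\ nzq z, approx x z & q2pow q (ql z ^+ 2)]) \/
  (forall i, (i < p)%N -> ps q x (q ^+ i) != 0).
Proof.
move=> nx; case: (boolP [exists s : 'I_p, ps q x (q ^+ s) == 0]) => [/existsP [s /eqP h]|/existsPn h].
  left; have [z [nz' xz hz]] := ps0 q0 nx (expf_neq0 s q0) h; exists z; split=> //.
  have -> : ql z ^+ 2 = (q ^+ s) ^+ 2 * (q ^+ (2 * 1))^-1.
    by rewrite muln1 -hz mulfK // expf_neq0.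
  by apply: q2powM; [exists s|apply: (q2powV hq hd); apply: q2pow_q].
by right=> i hi; have := h (Ordinal hi).
Qed.

(* B is nonderogatory when no phi_i vanishes. *)
Lemma eig_above x v r : nzq x.1 -> (r < p)%N -> (forall i, (i < p)%N -> ps q x.1 (q ^+ i) != 0) ->
  WB x *m v = tB x.1 (q ^+ r) *: v -> forall j, (r < j)%N -> co v j = 0.
Proof.
move=> nx rp hps hv; elim=> // j ih hj.
have [h|h] := ltnP j.+1 p; last by rewrite co_ge.
have e := eig_rec hq nx hv (ltnW h).
have phn : ph q x.1 (q ^+ j.+1) != 0 by rewrite (ph_eq0 hq) // hps.
have e2 : ph q x.1 (q ^+ j.+1) * co v j.+1 = 0.
  rewrite -e; move: hj; rewrite ltnS leq_eqVlt => /orP [/eqP ->|hj]; first by rewrite subrr mul0r.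
  by rewrite ih // mulr0.
by apply/eqP; move/eqP: e2; rewrite mulf_eq0 (negbTE phn).
Qed.

(** Off mu^2 = q^2 the weight and the central characters determine the orbit. Otherwise [y] may lie
    in the orbit of [move_iii x]: if some [ps] vanishes, that orbit is reached by (i) and (ii); if
    none does, the B-eigenspace of m_0 is a line, and both kappas are read off from it. *)
Lemma iso_simeq_same_weight x y : inPM x -> nzq y.1 -> iso x y -> mu x.1 = mu y.1 -> simeq x y.
Proof.
move=> hx ny i1 em; have nx := hx.1.
have [ea eb eg eo [ed [v v0 hv]]] := iso_data nx ny i1.
have fin : approx x.1 y.1 -> simeq x y by move=> h; apply: simeq_pm.
have [hdeg|hgen] := eqVneq (mu x.1 ^+ 2) (q ^+ 2); last first.
  by apply: fin; apply: approx_of_inv'.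
have [|h3] := approx_degenerate q0 nx ny em hdeg eb eg (esym eo); first exact: fin.
have [[z [nz' xz hz]]|hps] := ph_all_or nx.
  have hm : q2pow q (mu x.1 ^+ 2) by rewrite hdeg; exists 1%N; rewrite expr1.
  apply: simeq_trans (simeq_chain nx hm nz' xz hz) _.
  apply: simeq_pm; split; first exact: nzq_iii.
  by split=> //; split=> //; rewrite (dinv_iii hq).
apply: fin; apply: approx_of_inv => //.
have [h1 h2] := hv.
have hB : WB x *m v = tB x.1 (q ^+ 0) *: v by rewrite h1 expr0 !tB_mu // em.
have hz := eig_above nx p0 hps hB.
have vE : v = co v 0 *: ev 0.
  apply: co_ext => -[|j] hj; rewrite coZ co_ev // ?mulr1 //.
  by rewrite hz // mulr0.
have c0 : co v 0 != 0 by apply: contraNneq v0 => h; rewrite vE h scale0r.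
have [g1 g2] := W_smv hq hd nx.
have g3 : WB x *m (WA x *m v) = tB x.1 q *: (WA x *m v) + kappa q x.1 *: v.
  by rewrite vE !mulmxZ g2; apply/colP => i; rewrite !mxE; ring.
have : kappa q x.1 *: v = kappa q y.1 *: v.
  apply: (@addrI _ (tB x.1 q *: (WA x *m v))); rewrite -g3 h2.
  by rewrite !tB_mu // em.
move/eqP; rewrite -subr_eq0 -scalerBl scaler_eq0 (negbTE v0) orbF subr_eq0 => /eqP //.
Qed.

(** For generic mu, [iii_fwd] turns the marginal vector into the equation of (iii). Otherwise a zero
    of [ps] makes (iii) a composite of (i) and (ii), and in the absence of zeros [ps1_eq0_of_weight]
    gives the contradiction [ps x 1 = 0]. *)
Lemma iso_simeq_dual_weight x y : inPM x -> nzq y.1 -> iso x y -> mu y.1 = q ^+ 2 / mu x.1 -> mu x.1 ^+ 2 != q ^+ 2 -> simeq x y.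
Proof.
move=> hx ny i1 em hm2; have nx := hx.1; have m0 := mu_neq0 nx.
have [ea eb eg eo [ed [v v0 hv]]] := iso_data nx ny i1.
have n3 := nzq_iii q0 nx.
have [ja jb jg _] := inv_iii q0 nx.
have em3 : mu (move_iii x.1) = mu y.1 by rewrite mu_iii.
have hm3 : mu (move_iii x.1) ^+ 2 != q ^+ 2.
  apply: contra hm2 => /eqP h; apply/eqP; rewrite mu_iii // in h.
  transitivity ((q ^+ 2) ^+ 2 / ((q ^+ 2 / mu x.1) ^+ 2)); first by field; nz.
  by rewrite h; field; nz.
have a3 : approx (move_iii x.1) y.1.
  by apply: approx_of_inv' => //; rewrite ?ja ?jb ?jg.
have fin : simeq x (move_iiiq x) -> simeq x y.
  move=> h; apply: simeq_trans h _; apply: simeq_pm; split=> //; split=> //; split=> //.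
  by rewrite (dinv_iii hq).
have [_ _ _ ek] := approx_inv q0 a3.
have [hg|hm] := generic_dec hq hd x.1.
  apply: fin; apply: (simeq_iii hq) => //; apply: (iii_fwd hq hd nx hg v0).
  by apply: smv_eq hv.
have [[z [nz' xz hz]]|hps] := ph_all_or nx; first by apply: fin; apply: (simeq_chain nx hm nz' xz hz).
have [r rp hr] : exists2 r, (r < p)%N & (q ^+ r) ^+ 2 = q ^+ 2 / mu x.1 ^+ 2.
  have : q2pow q (q ^+ (2 * 1) * (mu x.1 ^+ 2)^-1) by apply: q2powM (q2pow_q _ _) (q2powV hq hd hm).
  by move/(q2pow_lt hq hd) => [r rp e]; exists r; rewrite // -e muln1.
have r0 : (0 < r)%N.
  rewrite lt0n; apply: contra hm2 => /eqP r0; rewrite r0 expr1n in hr.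
  by apply/eqP; rewrite -[LHS]mul1r hr divfK // expf_neq0.
have hmr : mu x.1 ^+ 2 * (q ^+ r) ^+ 2 = q ^+ 2 by rewrite hr mulrC divfK // expf_neq0.
have er : mu x.1 * (q ^+ r) ^+ 2 = mu y.1 by rewrite em hr; field; nz.
have [h1 h2] := hv.
have hB : WB x *m v = tB x.1 (q ^+ r) *: v by rewrite h1 !tB_mu // er expr1n mulr1.
have vgt := eig_above nx rp hps hB.
have rr : (0 < r < p)%N by rewrite r0.
have hne := thetas_neq_below hq hd nx rr hmr.
have c0 : co v r != 0.
  apply: contraNneq v0 => c0; apply/eqP/co_eq0.
  have H k : forall j, (r - k <= j)%N -> co v j = 0.
    elim: k => [|k ih] j hj.
      by move: hj; rewrite subn0 leq_eqVlt => /orP [/eqP <-|] //; apply: vgt.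
    have [h|h] := leqP (r - k) j; first exact: ih.
    have jr : (j < r)%N by apply: leq_trans h (leq_subr _ _).
    have := eig_rec hq nx hB (ltn_trans jr rp); rewrite (ih j.+1); last first.
      by rewrite leq_subLR in hj; rewrite leq_subLR; apply: leq_trans hj _; rewrite addSnnS.
    by rewrite mulr0 => /eqP; rewrite mulf_eq0 subr_eq0 (negbTE (hne _ jr)) => /eqP.
  by move=> j _; apply: (H r); rewrite subnn.
pose w := (co v r)^-1 *: v.
have p1 : ps q x.1 1 = 0.
  apply: (ps1_eq0_of_weight hq hd (v := w) (k := kappa q y.1) nx rr hmr).
  - by rewrite coZ mulVf.
  - by move=> j hj; rewrite coZ (vgt j) // mulr0.
  - by rewrite mulmxZ hB !scalerA mulrC.
  - have -> : tB x.1 (q ^+ r.+1) = tB y.1 q by rewrite !tB_mu // -er (exprS q r); congr (_ + _^-1); ring.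
    by rewrite !mulmxZ h2 scalerDr !scalerA !(mulrC (co v r)^-1).
  - by move=> s /andP [s0 sr]; apply: hps; apply: leq_ltn_trans sr rp.
by have := hps 0%N p0; rewrite expr0 p1 eqxx.
Qed.

Lemma top_exists v : v != 0 -> exists r, [/\ (r < p)%N, co v r != 0 & forall j, (r < j)%N -> co v j = 0].
Proof.
move=> v0; have H n : (forall j, (n <= j)%N -> co v j = 0) ->
   exists r, [/\ (r < p)%N, co v r != 0 & forall j, (r < j)%N -> co v j = 0].
  elim: n => [|n ih] hn; first by case/eqP: v0; apply: co_eq0 => j _; apply: hn.
  have [c|c] := eqVneq (co v n) 0.
    by apply: ih => j; rewrite leq_eqVlt => /orP [/eqP <-|] //; apply: hn.
  exists n; split=> //; rewrite ltnNge; apply: contra c => h; by rewrite co_ge.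
by apply: (H p) => j hj; rewrite co_ge.
Qed.

(** The degree r of [v] leaves mu q^(2r) and its inverse. If mu^2 is a power of q^2, the inverse
    again has the first form. For generic mu the m_(r+1)-coordinate of the second equation rules it
    out unless r = d' - 1, where it is q^2 / mu. *)
Lemma weight_cases x y v : nzq x.1 -> nzq y.1 -> v != 0 -> smv q (WA x) (WB x) y.1 v ->
  (exists2 r, (r < p)%N & mu y.1 = mu x.1 * (q ^+ r) ^+ 2) \/ mu y.1 = q ^+ 2 / mu x.1.
Proof.
move=> nx ny v0 [h1 h2]; have [r [rp c0 vgt]] := top_exists v0.
have m0 := mu_neq0 nx; have n0 := mu_neq0 ny.
have qr := expf_neq0 2 (expf_neq0 r q0).
have e1 : tB y.1 1 = tB x.1 (q ^+ r).
  have := congr1 (fun t => co t r) h1; rewrite (co_WB hq) // coZ (vgt r.+1) // mulr0 addr0.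
  by move/(mulIf c0).
have e2 : mu y.1 + (mu y.1)^-1 = mu x.1 * (q ^+ r) ^+ 2 + (mu x.1 * (q ^+ r) ^+ 2)^-1.
  by rewrite -tB_mu // -e1 tB_mu // expr1n mulr1.
have k0 : mu x.1 * (q ^+ r) ^+ 2 != 0 by rewrite mulf_neq0.
have [e|e] := sum_inv_eq n0 k0 e2; first by left; exists r.
have [hg|hm] := generic_dec hq hd x.1; last first.
  left; have : q2pow q ((mu x.1 ^+ 2)^-1 * ((q ^+ r) ^+ 2)^-1).
    by apply: q2powM; apply: (q2powV hq hd) => //; exists r.
  move/(q2pow_lt hq hd) => [s sp hs]; exists s => //; rewrite -hs e; move: (q ^+ r) (expf_neq0 r q0) => Q Q0; field; nz.
have := rp; rewrite leq_eqVlt => /orP [/eqP er|rp1].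
  right; rewrite e.
  have : (q ^+ r) ^+ 2 * q ^+ 2 = 1.
    by rewrite -exprMn -exprSr er -exprM mulnC (q2p hq).
  move=> hq2; rewrite -[RHS]divr1 -hq2; move: (q ^+ r) (expf_neq0 r q0) => Q Q0; field; nz.
exfalso; have := congr1 (fun t => co t r.+1) h2.
rewrite coD !coZ (co_WB hq _ nx rp1) (co_WA _ _ _ rp1) (vgt r.+1) // mulr0 add0r mulr0 addr0.
have -> : co (WA x *m v) r.+2 = 0.
  have [h|h] := ltnP r.+2 p; last by rewrite co_ge.
  by rewrite co_WA // (vgt r.+2) ?(vgt r.+1) ?mulr0 ?addr0 // ltnW.
rewrite mulr0 addr0 => /(mulIf c0).
have qrn := expf_neq0 r q0.
have -> : tB y.1 q = tB x.1 (q ^+ r / q).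
  rewrite !tB_mu // e; move: (q ^+ r) qrn {qr k0 e1 e2 e} => Q Q0.
  by field; nz.
have q1 : q ^+ r / q != 0 by rewrite mulf_neq0 ?invr_eq0.
case/(tB_eq nx (expf_neq0 r.+1 q0) q1).
  rewrite (exprS q r) => h; move/eqP: q4; apply.
  apply: (mulIf qr); apply: (mulIf (invr_neq0 (expf_neq0 2 q0))).
  transitivity ((q * q ^+ r) ^+ 2); first by field; nz.
  by rewrite h; field; nz.
move=> h; have hq4 : mu x.1 ^+ 2 = ((q ^+ (2 * (2 * r))))^-1.
  have qq := expf_neq0 (2 * (2 * r)) q0; apply: (mulIf qq); rewrite mulVf // -h (exprS q r).
  have -> : q ^+ (2 * (2 * r)) = ((q ^+ r) ^+ 2) ^+ 2 by rewrite (mulnC 2%N (2 * r)%N) (mulnC 2%N r) !exprM.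
  by move: (q ^+ r) qrn => Q Q0; field; nz.
have [k hk] := q2_inv hq hd (2 * r)%N.
by move/eqP: (hg k); apply; rewrite hq4 hk -exprM mulnC.
Qed.

Lemma iso_simeq x y : inPM x -> inPM y -> iso x y -> simeq x y.
Proof.
move=> hx hy i1; have nx := hx.1; have ny := hy.1.
have [ea eb eg eo [ed [v v0 hv]]] := iso_data nx ny i1.
have B : mu y.1 = q ^+ 2 / mu x.1 -> simeq x y.
  move=> em; have [h|h] := eqVneq (mu x.1 ^+ 2) (q ^+ 2); last exact: iso_simeq_dual_weight.
  by apply: iso_simeq_same_weight => //; rewrite em -h expr2 mulfK // mu_neq0.
have [em|em|[z [nz' xz hz]]] := quartic_cases hq ny nx (esym ea) (esym eb) (esym eg) eo.
- exact: iso_simeq_same_weight.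
- exact: B.
have [[r rp er]|] := weight_cases nx ny v0 hv; last exact: B.
have [emz _ _ _] := approx_inv q0 xz.
case: (posnP r) => [r0|r0].
  by apply: iso_simeq_same_weight => //; rewrite er r0 !expr1n mulr1.
(* Comparing b_z lambda_z q^2 and mu q^(2r), two expressions for the weight of [y], gives the
   condition for (ii) at z; the result [move_ii z] has that weight. *)
have hl : ql z ^+ 2 * q ^+ 2 = (q ^+ r) ^+ 2.
  have mz := mu_neq0 nz'; rewrite er emz in hz.
  transitivity ((qb z * ql z * q) * q / mu z); first by rewrite /mu; case: nz' => *; field; nz.
  by rewrite hz; field; nz.
have [dz [s1 s2]] := pm_lift d nx xz.
have rr : (0 < r < p)%N by rewrite r0.
have sx2 : simeq x (move_ii z, dz).
  by apply: simeq_trans (simeq_pm s1) (simeq_ii hq hd (x := (z, dz)) nz' rr hl).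
have [/(_ hx) [hx2 i2] _] := simeq_PM_iso sx2.
apply: simeq_trans sx2 _; apply: iso_simeq_same_weight => //.
  exact: iso_trans (iso_sym i2) i1.
by rewrite /= (mu_ii hq) // expr2 mulrA hz divfK.
Qed.

End Injectivity.

(** * Irreducible modules with a marginal weight *)

Section Surjectivity.
Variables (F : closedFieldType) (q : F) (d : nat).
Hypothesis hq : d.-primitive_root q.
Hypothesis hd : d \notin [:: 1%N; 2%N; 4%N].
Local Notation p := (dprime d).
Local Notation WA := (@WA F q d).
Local Notation WB := (@WB F q d).
Local Notation WC := (@WC F q d).
Local Notation mvec := (@mvec F d).
Local Notation ev := (@ev F d).
Let q0 := root_q0 hq.
Let q4 := root_q4 hq hd.
Let p0 := dprime_gt0 hq hd.
Let q2N := q2N q4.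
Let q2B := q2B q4.
Let q4B := q4B q4.
Local Notation inPM := (@inPM F q d).

Implicit Types (x y z : quint F).
Ltac vlin := let i := fresh "i" in apply: cfP => i; rewrite ?cfE.

Lemma stable_eigen n (K Y : 'M[F]_n) : K != 0 -> (K *m Y <= K)%MS ->
  exists a, exists2 u : 'rV[F]_n, u != 0 & (u <= K)%MS /\ u *m Y = a *: u.
Proof.
move=> K0 hK; have r0 : (0 < \rank K)%N by rewrite lt0n mxrank_eq0.
pose R := row_base K.
have hR : (R *m Y <= R)%MS by rewrite eq_row_base (submx_trans _ hK) // submxMr // eq_row_base.
pose D := R *m Y *m pinvmx R.
have hD : D *m R = R *m Y by rewrite /D mulmxKpV.
have [a [w w0 hw]] := eigen_exists D^T r0.
exists a, (w^T *m R).
  apply: contraNneq w0 => /eqP; rewrite mulmx_free_eq0 ?row_base_free // => /eqP /(congr1 trmx).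
  by rewrite trmxK trmx0 => ->.
split; first by rewrite (submx_trans (submxMl _ _)) // eq_row_base.
have := congr1 trmx hw; rewrite trmx_mul trmxK linearZ /= => h.
by rewrite -mulmxA -hD mulmxA h scalemxAl.
Qed.

(** Equivalently, (B - t)(B - t') A v is a multiple of v for t = m q^2 + m^-1 q^-2 and t' = m q^-2 +
    m^-1 q^2. *)
Lemma ABB_eigen n (A B : 'M[F]_n) (a c m : F) (v : 'cV[F]_n) : rel_ABB q A B a c -> B *m v = (m + m^-1) *: v ->
  B *m (B *m (A *m v)) =
    ((q ^+ 2 + q ^- 2) * (m + m^-1)) *: (B *m (A *m v))
    - ((m + m^-1) ^+ 2 + (q ^+ 2 - q ^- 2) ^+ 2) *: (A *m v)
    + ((q ^+ 2 - q ^- 2) * (q - q^-1) * a - (q - q^-1) ^+ 2 * c * (m + m^-1)) *: v.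
Proof.
move=> r2 hv; have := r2 v; rewrite ?(hv, mulmxZ) => h.
apply: cfP => i; move: (congr1 (cf i) h); rewrite !cfE.
move/eqP; rewrite -subr_eq0 => /eqP e; apply/eqP; rewrite -subr_eq0 -[X in _ == X]e; apply/eqP.
ring.
Qed.

(* If m^2 != q^2, subtract the relation A B B at [v] from the marginality equation.  Otherwise
   (B - theta*_1) A preserves the B-eigenspace, and [u] is one of its eigenvectors there. *)
Lemma strong_marginal n (A B : 'M[F]_n) (a c m : F) (v : 'cV[F]_n) : rel_ABB q A B a c -> m != 0 -> v != 0 ->
  B *m v = (m + m^-1) *: v ->
  (B - (m * q ^+ 2 + m^-1 * q ^- 2)%:M) *m ((B - (m + m^-1)%:M) *m (A *m v)) = 0 ->
  exists k, exists2 u : 'cV[F]_n, u != 0 & B *m u = (m + m^-1) *: u /\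
    B *m (A *m u) = (m * q ^+ 2 + (m * q ^+ 2)^-1) *: (A *m u) + k *: u.
Proof.
move=> r2 m0 v0 hv hm; have h2 := ABB_eigen r2 hv.
move: hm; rewrite !(mulmxBl, mulmxDr, mulmxN, mul_scalar_mx, mulmxZ) h2.
set s := _ - (q - q^-1) ^+ 2 * c * _ => hm.
have [e|ne] := eqVneq (m ^+ 2) (q ^+ 2).
  have em : m / q ^+ 2 + q ^+ 2 / m = m + m^-1 by rewrite -e; field; nz.
  (* Here theta*_(-1) = theta*_0, so marginality and [ABB_eigen] have the same left side and s v =
     0. *)
  have s0 : s = 0.
    apply/eqP; move: v0; apply: contraNT => s0; apply/eqP; apply: (scalerI s0).
    rewrite scaler0 -[RHS]hm -e; vlin; field; nz.
  pose K := kermx (B - (m + m^-1)%:M)^T.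
  have hK (u : 'cV[F]_n) : ((u^T <= K)%MS <-> B *m u = (m + m^-1) *: u).
    split=> [/sub_kermxP|h]; last apply/sub_kermxP.
      rewrite -trmx_mul => /(congr1 trmx); rewrite trmxK trmx0 mulmxBl mul_scalar_mx.
      by move/eqP; rewrite subr_eq0 => /eqP.
    by rewrite -trmx_mul mulmxBl mul_scalar_mx h subrr trmx0.
  pose T := (B - (m * q ^+ 2 + (m * q ^+ 2)^-1)%:M) *m A.
  have hT : (K *m T^T <= K)%MS.
    apply: inV_inv => u /hK hu; apply/hK; have := ABB_eigen r2 hu; rewrite -/s s0 => h3.
    rewrite /T -mulmxA !(mulmxBl, mulmxDr, mulmxN, mul_scalar_mx, mulmxZ) h3.
    rewrite -e; vlin; field; nz.
  have K0 : K != 0.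
    by apply: contraNneq v0 => K0; move/hK: hv; rewrite K0 submx0 => /eqP /(congr1 trmx); rewrite trmxK trmx0 => ->.
  have [k [u u0 [hu hk]]] := stable_eigen K0 hT; exists k, u^T.
    by apply: contraNneq u0 => h; rewrite -(trmxK u) h trmx0.
  split; first by apply/hK; rewrite trmxK.
  have := congr1 trmx hk; rewrite trmx_mul trmxK linearZ /= /T -mulmxA mulmxBl mul_scalar_mx => /eqP.
  by rewrite subr_eq addrC => /eqP.
have d0 : (q ^+ 2 - 1) * (q ^+ 2 - m ^+ 2) != 0 by rewrite mulf_neq0 // subr_eq0 eq_sym.
(* The difference of the two equations is (theta*_0 - theta*_(-1)) (B - theta*_1) A v = s v; the
   scalar is s over that factor. *)
exists (- s * (m * q ^+ 2) / ((q ^+ 2 - 1) * (q ^+ 2 - m ^+ 2))), v => //; split=> //.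
apply: cfP => i; move: (congr1 (cf i) hm); rewrite !cfE => hi.
apply/eqP; rewrite -subr_eq0 -(mulrI_eq0 _ (mulfI d0)); apply/eqP.
transitivity (m * q ^+ 2 * 0 : F); last by rewrite mulr0.
rewrite -hi.
move: s (cf i _) (cf i v) (cf i _) {hi hm} => s X Y Z; field; nz.
by rewrite subr_eq0 eq_sym.
Qed.

Section Period.
Variables (A B C : 'M[F]_p) (x : quad F) (v : 'cV[F]_p).
Hypothesis nx : nzq x.
Hypothesis sr : srel q A B C (alpha q x) (beta q x) (gamma q x).
Hypothesis sm : smv q A B x v.
Hypothesis irr : irreducible A B C.
Hypothesis v0 : v != 0.
Local Notation c i := (chain q A x v i).

Lemma chain_chain i : chain q A x (c i) p = c (p + i).
Proof.
elim: i => [|i ih]; first by rewrite addn0.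
have -> : c i.+1 = A *m c i + (- tA x (q ^+ i)) *: c i by rewrite /= scaleNr.
rewrite chainD chainZ chainAC ih addnS /= scaleNr; congr (_ - _ *: _).
by rewrite -[RHS](tA_mod hq hd) modnDl (tA_mod hq hd).
Qed.

(* The span of the vectors chain i stops growing and is then a submodule, so they span everything;
   hence v |-> chain v p, which commutes with A, also commutes with B and C. *)
Definition cspan k : 'M[F]_p := (\sum_(i < k) <<(c i)^T>>)%MS.

Lemma cspan_in k i : (i < k)%N -> inV (cspan k) (c i).
Proof.
by move=> h; rewrite /inV /cspan (sumsmx_sup (Ordinal h)) // genmxE.
Qed.

Lemma cspan_stop : exists k, inV (cspan k) (c k).
Proof.
suff [k hk] : exists k : 'I_p.+1, inV (cspan k) (c k) by exists k.
apply/existsP; apply: contraT; rewrite negb_exists => /forallP h.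
have : (p.+1 <= \rank (cspan p.+1))%N.
  have H k : (k <= p.+1)%N -> (k <= \rank (cspan k))%N.
    elim: k => // k ih hk; apply: leq_ltn_trans (ih (ltnW hk)) _.
    apply: rank_ltmx; rewrite /cspan.
    have := h (Ordinal hk); rewrite /inV /= => hn.
    rewrite big_ord_recr /= ltmxE addsmxSl /=; apply: contra hn => hn.
    by apply: submx_trans hn; rewrite (submx_trans _ (addsmxSr _ _)) // genmxE.
  exact: H.
by rewrite leqNgt ltnS rank_leq_row.
Qed.

Lemma cspan_sub k (U : 'M[F]_p) : (forall i, inV U (c i)) -> (cspan k <= U)%MS.
Proof. by move=> h; apply/sumsmx_subP => i _; rewrite genmxE; apply: h. Qed.

Lemma cspan_ind k (X U : 'M[F]_p) : (forall i, (i < k)%N -> inV U (X *m c i)) -> (cspan k *m X^T <= U)%MS.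
Proof.
move=> h; rewrite sumsmxMr; apply/sumsmx_subP => i _.
rewrite (eqmxMr _ (genmxE _)) -trmx_mul; exact: h.
Qed.

Lemma cspan_full (U : 'M[F]_p) : (forall i, inV U (c i)) -> forall w, inV U w.
Proof.
move=> hU w; have [k hk] := cspan_stop.
suff fU : row_full (cspan k) by apply: submx_trans (submx_full _ fU) (cspan_sub k hU).
have hc i : (i <= k)%N -> inV (cspan k) (c i).
  by rewrite leq_eqVlt => /predU1P [-> //|]; apply: cspan_in.
have hA : (cspan k *m A^T <= cspan k)%MS.
  apply: cspan_ind => i hi; rewrite chainA.
  by apply: inV_D; [apply: hc|apply/inV_Z/hc/ltnW].
have hB : (cspan k *m B^T <= cspan k)%MS.
  apply: cspan_ind => i hi; rewrite (chainB q0 nx (srel_BAA q0 q4 sr) sm).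
  by apply: inV_D; apply/inV_Z/hc; [apply: ltnW|apply: leq_trans (leq_pred i) (ltnW hi)].
apply: (irr_generates irr v0); last exact: (hc 0).
split=> //; apply: inV_inv => u hu; rewrite (srel_C q0 q4 sr).
have a1 := inV_A hA; have b1 := inV_A hB.
by apply: inV_B; [apply: inV_Z|apply/inV_Z/inV_B; apply/inV_Z; [apply/a1/b1|apply/b1/a1]].
Qed.

Lemma chain_period : exists dl, forall w, chain q A x w p = dl *: w.
Proof.
pose X : 'M[F]_p := \matrix_(i, j) chain q A x (delta_mx j 0) p i 0.
have hX w : X *m w = chain q A x w p.
  have e : w = \sum_j w j 0 *: delta_mx j 0.
    by rewrite {1}(matrix_sum_delta w); apply: eq_bigr => j _; rewrite big_ord1.
  have hs (s : seq 'I_p) : chain q A x (\sum_(j <- s) w j 0 *: delta_mx j 0) p =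
     \sum_(j <- s) w j 0 *: chain q A x (delta_mx j 0) p.
    elim: s => [|j s ih]; last by rewrite !big_cons chainD chainZ ih.
    by rewrite !big_nil -(scale0r (0 : 'cV[F]_p)) chainZ !scale0r.
  rewrite [in RHS]e hs; apply/colP => i; rewrite mxE summxE.
  by apply: eq_bigr => j _; rewrite !mxE mulrC.
have XA : X *m A = A *m X by apply: mx_ext => w; rewrite -!mulmxA !hX chainAC.
have XB : X *m B = B *m X.
  apply/eqP; rewrite -subr_eq0; apply/eqP; apply: mx_ext => w; rewrite mul0mx.
  have := @cspan_full (kermx (X *m B - B *m X)^T) _ w.
  move=> H; apply: trmx_inj; rewrite trmx_mul trmx0; apply/sub_kermxP; apply: H => i.
  apply/sub_kermxP; rewrite -trmx_mul -[RHS]trmx0; congr trmx.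
  have cB := chainB q0 nx (srel_BAA q0 q4 sr) sm.
  rewrite mulmxBl -!mulmxA cB !hX chainD !chainZ !chain_chain cB.
  rewrite -(tB_mod hq hd x (p + i)) -(ph_mod hq hd (p + i) nx) modnDl (tB_mod hq hd) (ph_mod hq hd i nx).
  (* By periodicity the coefficients agree. At i = 0 the predecessors of d' + 0 and of 0 do not
     correspond, but phi_0 = 0. *)
  case: i => [|i]; last by rewrite addnS subrr.
  by rewrite expr0 ph1 !scale0r subrr.
have [|dl hdl] := schur irr XA XB.
  apply: mx_ext => w; rewrite -!mulmxA !(srel_C q0 q4 sr) mulmxDr mulmxN !mulmxZ mulmxDr mulmxN !mulmxZ.
  by rewrite !(mulmxA X) XA XB -!mulmxA !(mulmxA X) XA XB -!mulmxA.
by exists dl => w; rewrite -hX hdl mul_scalar_mx.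
Qed.

End Period.

Lemma exists_W_iso A B C : is_module q A B C -> irreducible A B C -> has_marginal_weight q A B ->
  exists2 x : quint F, inPM x & mod_iso (WA x) (WB x) (WC x) A B C.
Proof.
case=> [[a1 a2 a3] [b1 b2 b3] [c1 c2 c3]] irr [m [m0 [v [v0 hv hm]]]].
have [a ha] := schur irr a1 a2 a3; have [b hb] := schur irr b1 b2 b3.
have [c hc] := schur irr c1 c2 c3.
have qq : q + q^-1 != 0.
  have -> : q + q^-1 = (q ^+ 2 + 1) / q by field; nz.
  by rewrite mulf_neq0 ?invr_eq0.
have sr : srel q A B C (a * (q + q^-1)) (b * (q + q^-1)) (c * (q + q^-1)).
  by split; rewrite ?ha ?hb ?hc mulfK.
have [k [u u0 [h1 h2]]] := strong_marginal (srel_ABB q0 q4 sr) m0 v0 hv hm.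
have [x [nx _ _ sm [ea eb ec]]] := smv_exists hq hd sr u0 m0 h1 h2.
rewrite -ea -eb -ec in sr.
have [dl hdl] := chain_period nx sr sm irr u0.
have hi : mod_iso (WA (x, dl)) (WB (x, dl)) (WC (x, dl)) A B C.
  apply: (mx_iso_of hq hd (v := u)) => //; exact: irr_generates.
exists (x, dl) => //; apply: (irr_PM hq hd) => //.
exact: iso_irr (iso_sym hi) irr.
Qed.

Lemma W_marginal x : nzq x.1 -> has_marginal_weight q (WA x) (WB x).
Proof.
move=> nx; exists (mu x.1); split; first exact: mu_neq0.
have [h1 h2] := W_smv hq hd nx; move: h1 h2; rewrite !tB_mu // expr1n mulr1 => h1 h2.
exists (ev 0); split=> //; first by rewrite -(mvec_lt x p0); exact: mvec_neq0.
rewrite !(mulmxBl, mulmxDr, mulmxN, mul_scalar_mx, mulmxZ) h2 -invfM !(mulmxDr, mulmxN, mulmxZ) h1 h2.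
by vlin; ring.
Qed.
End Surjectivity.

Unset Implicit Arguments.

Theorem theorem1p14 (F : closedFieldType) (q : F) (d : nat)
  (hq : d.-primitive_root q) (hd : d \notin [:: 1%N; 2%N; 4%N]) :
  (* the map lands in IM: W is a d'-dimensional irreducible module
     with a marginal weight *)
  (forall x : quint F, inPM F q d x ->
     [/\ is_module q (WA F q d x) (WB F q d x) (WC F q d x),
         irreducible (WA F q d x) (WB F q d x) (WC F q d x)
       & has_marginal_weight q (WA F q d x) (WB F q d x)]) /\
  (* well-defined and injective on PM / ~= *)
  (forall x y : quint F, inPM F q d x -> inPM F q d y ->
     (simeq F q d x y <->
      mod_iso (WA F q d x) (WB F q d x) (WC F q d x)
              (WA F q d y) (WB F q d y) (WC F q d y))) /\
  (* surjective onto IM *)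
  (forall A B C : 'M[F]_(dprime d),
     is_module q A B C -> irreducible A B C -> has_marginal_weight q A B ->
     exists2 x : quint F, inPM F q d x &
       mod_iso (WA F q d x) (WB F q d x) (WC F q d x) A B C).
Proof.
split=> [x hx|]; last split=> [x y hx hy|A B C].
- have nx := hx.1.
  exact: (And3 (srel_module (W_srel hq hd nx)) (PM_irr hq hd hx) (W_marginal hq hd nx)).
- have h1 := @simeq_PM_iso F q d hq hd x y; have h2 := @iso_simeq F q d hq hd x y hx hy.
  by split=> [/h1 [h _]|/h2 //]; have [] := h hx.
- exact: exists_W_iso.
Qed.
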